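(* Let $\mathbb{F}$ be a non-Archimedean local field and let $V$ be an $n$-dimensional vector space over $\mathbb{F}$, $n\ge 2$. For any lattice $\Lambda\subset V$, the form $$Q(\phi)=-\phi\cdot\bar\phi\cdot (V_{\Lambda,1})^{n-2}\in Val_n^\infty(V)=D(V)$$ is positive definite on the subspace $$P_1=\{\phi\in Val_1^\infty(V)\mid \phi\cdot (V_{\Lambda,1})^{n-1}=0\},$$ that is, for every $\phi\in P_1\setminus\{0\}$ the measure $Q(\phi)$ is a positive Haar measure on $V$ (a strictly positive multiple of $vol_\Lambda$).
   Context: $\mathbb{F}$ has ring of integers $\mathcal{O}$. A lattice $\Lambda\subset V$ is a compact open $\mathcal{O}$-submodule; $GL(\Lambda)=\{g\in GL(V): g(\Lambda)=\Lambda\}$; $vol_\Lambda$ is the Haar measure on $V$ with $vol_\Lambda(\Lambda)=1$. For a finite-dimensional $\mathbb{F}$-vector space $E$, $D(E)$ is the one-dimensional complex space of $\mathbb{C}$-valued Haar (Lebesgue) measures on $E$ (for $E=0$, $D(E)=\mathbb{C}$). $Gr_i^V$ is the Grassmannian of $i$-dimensional subspaces of $V$, and $\mathcal{L}_i$ is the $GL(V)$-equivariant complex line bundle over it with fiber $D(E)$ over $E$. $C^\infty(Gr_i^V,\mathcal{L}_i)$ is the space of smooth sections, i.e. sections fixed by an open subgroup of $GL(V)$. $Val_i^\infty(V)$ is the unique non-zero irreducible $GL(V)$-invariant subspace of $C^\infty(Gr_i^V,\mathcal{L}_i)$; for $i=0,1,n-1,n$ it is the whole space. So $Val_0^\infty(V)=\mathbb{C}$,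 $Val_n^\infty(V)=D(V)$. Put $Val^\infty(V)=\bigoplus_{i=0}^n Val_i^\infty(V)$. $\bar\phi$ is the complex conjugate section of $\phi$. Description of $Val_i^\infty(V)$. For a linear map $T:E\to W$ between spaces of equal dimension and $\mu\in D(W)$, let $T^*\mu\in D(E)$ be the measure $A\mapsto \mu(T(A))$ if $T$ is an isomorphism, and $0$ otherwise. For a subspace $L\subset V$ let $p_L:V\to V/L$ be the quotient map and $\mu_L$ the Haar measure on $V/L$ with $\mu_L(p_L(\Lambda))=1$. Then $Val_i^\infty(V)$ consists exactly of the sections $$\phi(E)=\int_{Gr_{n-i}^V}\hat f(L)\,(p_L|_E)^*\mu_L\,dL,\qquad E\in Gr_i^V,$$ with $\hat f$ a complex-valued locally constant function on $Gr_{n-i}^V$ and $dL$ the $GL(\Lambda)$-invariant probability measure. Product. $Val^\infty(V)$ is a commutative associative graded algebra with unit $1\in Val_0^\infty(V)=\mathbb{C}$. If $\phi\in Val_i^\infty(V)$ is given by $\hat f$ and $\psi\in Val_j^\infty(V)$ is given by $\hat g$ in this way, then $\phi\cdot\psi=0$ if $i+j>n$, and otherwise for $E\in Gr_{i+j}^V$ $$(\phi\cdot\psi)(E)=\int_{Gr_{n-i}^V}\int_{Gr_{n-j}^V}\hat f(L)\hat g(M)\,\big((p_L\times p_M)|_E\big)^*(\mu_L\boxtimes\mu_M)\,dM\,dL,$$ where $p_L\times p_M:V\to V/L\oplus V/M$ and $\mu_L\boxtimes\mu_M$ is the product measure. This is known to be well defined (independent of the choice of $\hat f,\hat g$ and of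 $\Lambda$). $V_{\Lambda,1}\in Val_1^\infty(V)$ is the $GL(\Lambda)$-invariant element (unique up to a scalar), normalized as the section assigning to each line $E$ the Haar measure on $E$ with $E\cap\Lambda$ of measure $1$. *)

(* Defs.v *)
From HB Require Import structures.
From mathcomp Require Import all_boot all_order all_algebra.
From mathcomp Require Import all_classical all_reals all_analysis.
From mathcomp Require Import complex.
Set Implicit Arguments.
Unset Strict Implicit.
Unset Printing Implicit Defensive.
Import Order.TTheory GRing.Theory Num.Theory.

Local Open Scope classical_set_scope.
Local Open Scope ring_scope.
Local Open Scope complex_scope.

(* The library norm [`|x|] cannot be used for the absolute value: its axiom
   [normrMn] ([`|x *+ n| = `|x| *+ n]) excludes non-Archimedean norms. *)
HB.mixin Record isNonArchLocalField (R : realType) F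
    & GRing.Field F & Topological F := {
  absv : F -> R;
  absv_ge0 : forall x, 0 <= absv x;
  absv_eq0 : forall x, absv x = 0 -> x = 0;
  absvM : forall x y, absv (x * y) = absv x * absv y;
  absvD_max : forall x y, absv (x + y) <= Num.max (absv x) (absv y);
  absv_nontrivial : exists2 x, x != 0 & absv x != 1;
  nbhs_absv : forall (x : F) (A : set F),
    nbhs x A <-> exists2 e : R, 0 < e & [set y | absv (y - x) < e] `<=` A;
  absv_locally_compact : locally_compact [set: F]
}.

#[short(type="nonArchLocalFieldType")]
HB.structure Definition NonArchLocalField (R : realType) :=
  {F of GRing.Field F & Topological F & isNonArchLocalField R F}.

Definition coords (K : fieldType) (W : vectType K) (w : W) :
  'rV[K]_(\dim {:W}) := \row_i coord (vbasis {:W}) i w.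

(* The canonical vector topology of W (independent of the basis). *)
Definition topvec (R : realType) (F : nonArchLocalFieldType R)
  (W : vectType F) : Type := initial_topology (@coords F W).

HB.instance Definition _ (R : realType) (F : nonArchLocalFieldType R)
  (W : vectType F) := Topological.copy (topvec W) (initial_topology (@coords F W)).
HB.instance Definition _ (R : realType) (F : nonArchLocalFieldType R)
  (W : vectType F) := isPointed.Build (topvec W) (0 : W).

Notation borel W := (g_sigma_algebraType (@open (topvec W))).

Section LinearGroup.
Variables (R : realType) (F : nonArchLocalFieldType R).

Definition is_lattice (V : vectType F) (Lam : set V) : Prop :=
  [/\ compact (Lam : set (topvec V)), open (Lam : set (topvec V)), Lam 0,
      (forall u v, Lam u -> Lam v -> Lam (u + v)) &
      (forall a u, @absv R F a <= 1 -> Lam u -> Lam (a *: u))].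

Definition GLV (V : vectType F) : set 'End(V) := [set g | lker g == 0%VS].

Definition GLlat (V : vectType F) (Lam : set V) : set 'End(V) :=
  [set g | GLV g /\ g @` Lam = Lam].

Definition open_subgroup (V : vectType F) (H : set 'End(V)) : Prop :=
  [/\ open (H : set (topvec 'End(V))), H `<=` @GLV V, H \1%VF,
      (forall g h, H g -> H h -> H (g \o h)%VF) &
      (forall g, H g -> H (g^-1)%VF)].

End LinearGroup.

(* The disjoint union over k of the Grassmannians Gr_k. *)
Definition Gr (R : realType) (F : nonArchLocalFieldType R)
  (V : vectType F) : Type := {vspace V}.

Section GrTopology.
Variables (R : realType) (F : nonArchLocalFieldType R) (V : vectType F).

(* Each orbit Gr_k = GL(V) E carries the quotient topology of GL(V): U is open
   iff {g | gE in U} is open in GL(V) for all E, which by translation may be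
   tested at g = 1. *)
Definition gr_open : set (set {vspace V}) := [set U |
  forall E, U E -> nbhs (\1%VF : topvec 'End(V)) [set g | GLV g -> U (g @: E)%VS]].

Lemma gr_openT : gr_open setT.
Proof. by move=> E _; apply: filterS filterT => g _ _. Qed.

Lemma gr_openI : setI_closed gr_open.
Proof.
move=> A B oA oB E [AE BE].
by apply: filterS (filterI (oA _ AE) (oB _ BE)) => g [Ag Bg] gG; split; auto.
Qed.

Lemma gr_open_bigU (I : Type) (f : I -> set {vspace V}) :
  (forall i, gr_open (f i)) -> gr_open (\bigcup_i f i).
Proof.
move=> of_ E [i _ fE].
by apply: filterS (of_ i _ fE) => g fg gG; exists i => //; exact: fg.
Qed.

HB.instance Definition _ := Choice.copy (Gr V) {vspace V}.
HB.instance Definition _ := isPointed.Build (Gr V) (0%VS : {vspace V}).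
HB.instance Definition _ :=
  isOpenTopological.Build (Gr V) gr_openT gr_openI gr_open_bigU.

End GrTopology.

Notation borelGr V := (g_sigma_algebraType (@open (Gr V))).

Section Haar.
Variables (R : realType) (F : nonArchLocalFieldType R).

Definition is_haar (W : vectType F) (h : {measure set (borel W) -> \bar R}) :=
  [/\ (forall (v : W) (A : set W), measurable (A : set (borel W)) ->
         h [set v + w | w in A] = h A),
      (forall K : set W, compact (K : set (topvec W)) -> (h K < +oo)%E) &
      h setT != 0%E].

Definition bounded_borel (W : vectType F) (A : set W) : Prop :=
  measurable (A : set (borel W)) /\ precompact (A : set (topvec W)).

(* D(W).  A complex measure is a function on the relatively compact Borel
   sets; it is given the value 0 on all other sets. *)
Definition haar_space (W : vectType F) : set (set W -> R[i]) := [set mu |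
  exists (c : R[i]) (h : {measure set (borel W) -> \bar R}), is_haar h /\
    forall A, mu A = if `[< bounded_borel A >] then c * (fine (h A))%:C else 0].

Definition haar1 (W : vectType F) (B : set W) : set W -> R[i] :=
  xget (fun=> 0) [set mu | haar_space mu /\ mu B = 1].

Definition box_measure (W1 W2 : vectType F)
    (mu : set W1 -> R[i]) (nu : set W2 -> R[i]) : set (W1 * W2) -> R[i] :=
  xget (fun=> 0) [set rho : set (W1 * W2)%type -> R[i] | haar_space rho /\
    forall A B, bounded_borel A -> bounded_borel B ->
      rho (A `*` B) = mu A * nu B].

Definition pullback (W1 W2 : vectType F) (T : W1 -> W2)
    (mu : set W2 -> R[i]) : set W1 -> R[i] :=
  fun A => if `[< bijective T >] then mu (T @` A) else 0.

End Haar.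

Section Quotient.
Variables (K : fieldType) (V : vectType K).

(* V / L, realised on the library's complement of L by the projection along L. *)
Definition quot (L : {vspace V}) : vectType K := subvs_of (L^C)%VS.

Definition quot_proj (L : {vspace V}) (v : V) : quot L :=
  vsproj (L^C)%VS (daddv_pi (L^C)%VS L v).

Lemma quot_projD (L : {vspace V}) u v :
  quot_proj L (u + v) = quot_proj L u + quot_proj L v.
Proof. by rewrite /quot_proj !linearD. Qed.

Lemma quot_projZ (L : {vspace V}) a u : quot_proj L (a *: u) = a *: quot_proj L u.
Proof. by rewrite /quot_proj !linearZ. Qed.

Lemma quot_proj_eq0 (L : {vspace V}) v : (quot_proj L v == 0) = (v \in L).
Proof.
have dLC : (L^C :&: L = 0)%VS by rewrite capvC capv_compl.
have dCL : (L :&: L^C = 0)%VS by exact: capv_compl.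
have vin : v \in (L^C + L)%VS by rewrite addvC addv_complf memvf.
rewrite -(inj_eq val_inj) /= vsprojK ?memv_pi //.
apply/eqP/idP => [p0|vL].
  by rewrite -(daddv_pi_add dLC vin) p0 add0r memv_pi.
apply: (addIr (daddv_pi L (L^C)%VS v)).
by rewrite daddv_pi_add // add0r daddv_pi_id.
Qed.

Lemma quot_proj_surj (L : {vspace V}) (w : quot L) :
  exists v, quot_proj L v = w.
Proof.
have dLC : (L^C :&: L = 0)%VS by rewrite capvC capv_compl.
exists (vsval w); apply: val_inj.
rewrite /= vsprojK ?memv_pi //.
by rewrite daddv_pi_id // subvsP.
Qed.

End Quotient.

Section Valuations.
Variables (R : realType) (F : nonArchLocalFieldType R) (V : vectType F).

(* A section of the density bundle over the union of all Gr_i; an element of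
   degree i is a section that vanishes on the subspaces of dimension <> i. *)
Definition section := forall E : {vspace V}, set (subvs_of E) -> R[i].

Implicit Types (phi psi : section) (S : set section) (i j k : nat).

Definition szero : section := fun E A => 0.
Definition sconj phi : section := fun E A => (phi E A)^*.
Definition sopp phi : section := fun E A => - phi E A.
Definition sscale (c : R[i]) phi : section := fun E A => c * phi E A.
Definition sadd phi psi : section := fun E A => phi E A + psi E A.

Definition sact (g : 'End(V)) phi : section := fun E =>
  pullback (fun v : subvs_of E => vsproj (g^-1 @: E)%VS ((g^-1)%VF (vsval v)))
    (phi (g^-1 @: E)%VS).

(* C^oo(Gr_i, L_i) *)
Definition smooth_section i : set section := [set phi |
  [/\ (forall E, haar_space (phi E)),
      (forall E A, \dim E <> i -> phi E A = 0) &
      exists H : set 'End(V), open_subgroup H /\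
        forall g, H g -> sact g phi = phi]].

Definition invariant_subspace S : Prop :=
  [/\ S szero,
      (forall phi psi, S phi -> S psi -> S (sadd phi psi)),
      (forall c phi, S phi -> S (sscale c phi)) &
      (forall g phi, GLV g -> S phi -> S (sact g phi))].

Definition irreducible_subspace S : Prop :=
  [/\ invariant_subspace S, S <> [set szero] &
      forall S', invariant_subspace S' -> S' `<=` S ->
        S' = [set szero] \/ S' = S].

(* Val_i^oo(V); the irreducible subspace S is unique. *)
Definition Val i : set section := [set phi |
  exists S, [/\ irreducible_subspace S, S `<=` smooth_section i & S phi]].

Definition grass k : set {vspace V} := [set E | \dim E = k].

Definition locally_constant (f : {vspace V} -> R[i]) : Prop :=
  forall L : Gr V, \forall M \near L, f M = f L.

Variable Lam : set V.

Definition gr_prob k : probability (borelGr V) R :=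
  xget (dirac (0%VS : borelGr V) : probability (borelGr V) R)
  [set P | P (grass k) = 1%E /\
     forall g (A : set {vspace V}), GLlat Lam g ->
       measurable (A : set (borelGr V)) -> P [set (g @: E)%VS | E in A] = P A].

(* The integral over Gr_k of a complex-valued function with respect to dL. *)
Definition gr_int k (f : {vspace V} -> R[i]) : R[i] :=
  (\int[gr_prob k]_(L in grass k) complex.Re (f L)) +i*
  (\int[gr_prob k]_(L in grass k) complex.Im (f L)).

Definition muL (L : {vspace V}) : set (quot L) -> R[i] :=
  haar1 (quot_proj L @` Lam).

Definition val_rep i phi (f : {vspace V} -> R[i]) : Prop :=
  locally_constant f /\ forall E A, phi E A =
    if \dim E == i then
      gr_int (\dim {:V} - i) (fun L => f L *
        pullback (fun v : subvs_of E => quot_proj L (vsval v)) (@muL L) A)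
    else 0.

Definition hat i phi : {vspace V} -> R[i] := xget (fun=> 0) (val_rep i phi).

(* The product of phi in Val_i and psi in Val_j; when i + j > dim V it
   vanishes because no subspace has dimension i + j. *)
Definition smul i j phi psi : section := fun E A =>
  if \dim E == (i + j)%N then
    gr_int (\dim {:V} - i) (fun L => gr_int (\dim {:V} - j) (fun M =>
      hat i phi L * hat j psi M *
      pullback (fun v : subvs_of E =>
                  (quot_proj L (vsval v), quot_proj M (vsval v)))
        (box_measure (@muL L) (@muL M)) A))
  else 0.

(* The section of degree k with value the Haar measure on E giving measure 1 to
   the intersection of E and Lam: the unit of Val for k = 0, V_{Lam,1} for
   k = 1, and vol_Lam for k = dim V. *)
Definition lat_section k : section := fun E A =>
  if \dim E == k then haar1 [set v : subvs_of E | Lam (vsval v)] A else 0.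

Fixpoint lat_pow k : section :=
  if k is k'.+1 then smul 1 k' (lat_section 1) (lat_pow k') else lat_section 0.

Definition P1 : set section := [set phi | Val 1 phi /\
  smul 1 (\dim {:V}).-1 phi (lat_pow (\dim {:V}).-1) = szero].

Definition Q phi : section := sopp
  (smul 2 (\dim {:V} - 2) (smul 1 1 phi (sconj phi)) (lat_pow (\dim {:V} - 2))).

End Valuations.

Arguments szero {R F} V.

(* Main.v *)
Require Import Defs.
From HB Require Import structures.
From mathcomp Require Import all_boot all_order all_algebra.
From mathcomp Require Import all_classical all_reals all_analysis.
From mathcomp Require Import complex ring lra zify.
Set Implicit Arguments.
Unset Strict Implicit.
Unset Printing Implicit Defensive.
Import Order.TTheory GRing.Theory Num.Theory.

Local Open Scope classical_set_scope.
Local Open Scope ring_scope.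
Local Open Scope complex_scope.

(** In units of the lattice, a section of degree i is a function c on the
    i-dimensional subspaces: its value at E is c(E) times the Haar measure that
    gives the intersection of E and Lam the volume 1.  The pull-back of mu_L to
    E becomes the number delta E L, the volume of the image of this
    intersection in V / L relative to the image of Lam.  So a section with hat
    f is the transform of f,
<<
      (T f)(E) = \int f(L) delta(E, L) dL,
>>
    and the product of the sections with hats f and g is the double integral
    of f(L) g(M) against the kernel delta2 E L M (pullback_delta,
    pullback_delta2).  This kernel factors in two ways, according to the order
    of the projections (delta2E, delta2_cap):
<<
      delta2(E, L, M) = delta(E, L) delta(E :&: L, M)
                      = delta(L, M) delta(E, L :&: M).
>>

    The sign comes from hyperplanes. For hyperplanes L and M the number
    delta(L, M) is 0 if L = M, and otherwise r^j for a fixed r < 1, where j is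
    the largest exponent such that L and M agree modulo pi^j (delta_hyper).
    Hence 1 - delta is a combination with positive coefficients of the
    indicators of nested equivalence relations. The quadratic form of such an
    indicator is the sum of the squares of the integrals over the classes. So
    the double integral of a(L) a(M) delta(L, M) is negative for every locally
    constant a, not identically 0, with integral 0 (ultrametric_negative,
    hyper_negative).

    The definition of a product uses hats of its factors, so these have to be
    shown to exist.  Averaging delta(e, L) over the lines e of a subspace E
    gives a constant times delta(E, L) (slice).  Therefore a function on
    hyperplanes whose transform vanishes on lines has integral 0 and makes the
    quadratic form above vanish, and so is 0 (transform_inj).  On functions of
    a given level the transform is a finite matrix, and there are at most as
    many classes of lines as of hyperplanes (lines_le_hyperplanes).  So the
    transform is onto (solve_lines), and every smooth section of degree 1 has a
    hat (smooth_rep).  In degree 2 the product of phi and its conjugate has a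
    hat because, by the second factorisation, it is orthogonal to every
    function that is orthogonal to all delta(-, N) (pair_transform_mean,
    solve_pairs).

    Now let f be the hat of phi.  The k-th power of the invariant section of
    degree 1 is a positive multiple of the invariant section of degree k
    (lat_powE), and the product with it in degree n is a positive multiple of
    the integral of the hat of the other factor.  So phi lies in P_1 exactly
    when f has integral 0, and Q(phi) is - c times the integral of a hat h of
    the product of phi and its conjugate.  The average of delta(E, N) over E
    does not depend on N (kappa).  Integrating over all planes E therefore
    gives, by the second factorisation again, that the integral of h is a
    positive multiple of the double integral of f(L) and the conjugate of f(M)
    against delta(L, M) (transform_total, pair_transform_total), which is
    negative.

    Integration over Grassmannians rests on a Haar measure, obtained from
    Lebesgue measure by digit expansions (haar_exists), whose restriction to
    the group of the lattice gives the invariant probability measure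
    (gr_prob_exists).  All integrands are uniformly continuous, so an integral
    is a limit of averages over representatives of the orbits of congruence
    subgroups; linearity, positivity and the exchange of integrals are proved
    for such limits in general (mean, mean_fubini). *)

(** * Absolute values of a local field *)

Section LocalField.
Variables (R : realType) (F : nonArchLocalFieldType R).
Implicit Types (x y a b : F).

Lemma absv0 : absv (0 : F) = 0.
Proof.
have [x _ x1] := @absv_nontrivial R F.
have /eqP := absvM (0 : F) x; rewrite mul0r -subr_eq0 -{1}[absv 0]mulr1 -mulrBr.
by rewrite mulf_eq0 subr_eq0 [1 == _]eq_sym (negbTE x1) orbF => /eqP.
Qed.

Lemma absv_eq0E x : (absv x == 0) = (x == 0).
Proof. by apply/eqP/eqP => [/absv_eq0//|->]; exact: absv0. Qed.

Lemma absv_gt0 x : (0 < absv x) = (x != 0).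
Proof. by rewrite lt0r absv_ge0 andbT absv_eq0E. Qed.

Lemma absv1 : absv (1 : F) = 1.
Proof.
have := absvM (1 : F) 1; rewrite mulr1 => /eqP.
rewrite -subr_eq0 -{1}[absv 1]mulr1 -mulrBr mulf_eq0 absv_eq0E oner_eq0 /=.
by rewrite subr_eq0 => /eqP.
Qed.

Lemma absvN x : absv (- x) = absv x.
Proof.
have h : absv (-1 : F) = 1.
  apply/eqP; rewrite -(@eqrXn2 _ 2) ?absv_ge0// expr1n expr2 -absvM mulrNN mulr1.
  by rewrite absv1.
by rewrite -mulN1r absvM h mul1r.
Qed.

Lemma absvV x : absv x^-1 = (absv x)^-1.
Proof.
have [->|x0] := eqVneq x 0; first by rewrite invr0 absv0 invr0.
apply: (@mulfI _ (absv x)); first by rewrite absv_eq0E.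
by rewrite -absvM !divff ?absv1// absv_eq0E.
Qed.

Lemma absvX x n : absv (x ^+ n) = absv x ^+ n.
Proof. by elim: n => [|n ih]; rewrite ?expr0 ?absv1// !exprS absvM ih. Qed.

Lemma absvD_le (r : R) x y : absv x <= r -> absv y <= r -> absv (x + y) <= r.
Proof. by move=> hx hy; rewrite (le_trans (absvD_max _ _))// ge_max hx. Qed.

Lemma absvD_lt (r : R) x y : absv x < r -> absv y < r -> absv (x + y) < r.
Proof. by move=> hx hy; rewrite (le_lt_trans (absvD_max _ _))// gt_max hx. Qed.

Lemma absv_sum_le (I : Type) (s : seq I) (P : pred I) (f : I -> F) (r : R) :
  0 <= r -> (forall i, P i -> absv (f i) <= r) ->
  absv (\sum_(i <- s | P i) f i) <= r.
Proof.
move=> r0 h; elim/big_ind: _ => //; first by rewrite absv0.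
by move=> x y; exact: absvD_le.
Qed.

Lemma absvM_le1 x y : absv x <= 1 -> absv y <= 1 -> absv (x * y) <= 1.
Proof. by move=> hx hy; rewrite absvM mulr_ile1 ?absv_ge0. Qed.

Lemma absv_near1 x : absv (x - 1) < 1 -> absv x = 1.
Proof.
move=> h; apply/eqP; rewrite eq_le; apply/andP; split.
  rewrite -(subrK 1 x); apply: absvD_le; rewrite ?absv1//; exact: ltW.
rewrite leNgt; apply/negP => hx.
suff : absv (1 : F) < 1 by rewrite absv1 ltxx.
rewrite -[1](subKr x); apply: absvD_lt => //.
by rewrite absvN.
Qed.

(** Some power of an element of absolute value below 1 will do. *)
Lemma absv_small (e : R) : 0 < e -> exists2 a : F, a != 0 & absv a < e.
Proof.
move=> e0; have [x x0 x1] := @absv_nontrivial R F.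
wlog xlt : x x0 x1 / absv x < 1.
  move=> hw; have [xlt|xge] := ltP (absv x) 1; first exact: (hw x).
  apply: (hw x^-1); rewrite ?invr_eq0// absvV.
    by rewrite invr_eq1.
  by rewrite invf_lt1 ?absv_gt0// lt_neqAle eq_sym x1.
have := @cvg_expr R (absv x); rewrite ger0_norm ?absv_ge0// => /(_ xlt).
move=> /cvgrPdist_lt /(_ _ e0) [N _ /(_ N (leqnn N))] /=.
rewrite sub0r normrN -absvX ger0_norm ?absv_ge0// => h.
by exists (x ^+ N); rewrite ?expf_neq0.
Qed.

Lemma nbhs_ballF x (e : R) : 0 < e -> nbhs x [set y | absv (y - x) < e].
Proof. by move=> e0; apply/nbhs_absv; exists e. Qed.

Lemma closed_ballF x (r : R) : 0 < r -> closed [set y | absv (y - x) <= r].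
Proof.
move=> r0 y /= cly.
have /cly [z /= [zx zy]] := nbhs_ballF y r0.
rewrite -(subrK z y) -addrA; apply: absvD_le => //.
by rewrite -opprB absvN ltW.
Qed.

Lemma scale_continuous a : continuous (fun x => a * x).
Proof.
move=> x A /= /nbhs_absv[e e0 hA]; apply/nbhs_absv.
have [a0|a0] := eqVneq a 0.
  rewrite a0 in hA *; by exists 1 => // y _ /=; apply: hA => /=; rewrite !mul0r subrr absv0.
exists (e / absv a); first by rewrite divr_gt0 ?absv_gt0.
move=> y /= hy; apply: hA => /=; rewrite -mulrBr absvM mulrC -ltr_pdivlMr ?absv_gt0//.
Qed.

(** Some small ball is compact by local compactness, and a scaling carries it
    to the unit ball. *)
Lemma compact_ballF : compact [set x : F | absv x <= 1].
Proof.
have /(_ 0 I) := @absv_locally_compact R F; rewrite /within/=.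
move=> [U /nbhs_absv[e e0 hU] [cU _]].
have [a a0 ha] := absv_small e0.
have cB : compact [set x : F | absv x <= absv a].
  apply: subclosed_compact cU _.
    have := @closed_ballF 0 (absv a); rewrite absv_gt0 => /(_ a0).
    by under eq_set do rewrite subr0.
  by move=> x /= hx; apply: (hU x) => //=; rewrite subr0 (le_lt_trans hx).
have -> : [set x : F | absv x <= 1] =
    (fun x => a^-1 * x) @` [set x : F | absv x <= absv a].
  rewrite eqEsubset; split=> x /=.
    move=> hx; exists (a * x); last by rewrite mulKf.
    by rewrite /= absvM ler_piMr ?absv_ge0.
  move=> [y /= hy <-]; rewrite absvM absvV mulrC ler_pdivrMr ?absv_gt0//.
  by rewrite mul1r.
apply: continuous_compact => //.
apply: continuous_subspaceT; exact: scale_continuous.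
Qed.

(** If absolute values below 1 came arbitrarily close to 1, they would cluster
    in the compact ball of radius 1 at an element of absolute value below 1. *)
Lemma absv_gap : exists2 r : R, 0 < r < 1 & forall x, absv x < 1 -> absv x <= r.
Proof.
apply: contrapT => hn.
have H (r : R) : 0 < r < 1 -> exists x, r < absv x < 1.
  move=> r01; apply: contrapT => hx; apply: hn; exists r => // x x1.
  by rewrite leNgt; apply/negP => rx; apply: hx; exists x; rewrite rx.
pose G := [set A : set F | exists2 r : R, 0 < r < 1 &
  [set x | r < absv x < 1] `<=` A].
have PG : ProperFilter G.
  apply: Build_ProperFilter.
    by move=> [r /H[x hx] /(_ x hx)].
  split.
  - by exists 2^-1 => //; lra.
  - move=> A B [r r01 hA] [r' r01' hB]; exists (Num.max r r').
      by rewrite lt_max gt_max; move: r01 r01' => /andP[-> ->] /andP[_ ->].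
    by move=> x /=; rewrite gt_max => /andP[/andP[h1 h2] h3]; split;
      [apply: hA|apply: hB] => /=; rewrite ?h1 ?h2 h3.
  - by move=> A B AB [r r01 hA]; exists r => //; exact: subset_trans AB.
have GO : G [set x : F | absv x <= 1].
  by exists 2^-1; [lra|move=> x /= /andP[_ /ltW]].
have [c [/= c1 clc]] := compact_ballF PG GO.
have cl1 : absv c < 1.
  rewrite lt_neqAle c1 andbT; apply/eqP => ce.
  have h1 : G [set x | absv x < 1] by exists 2^-1; [lra|move=> x /= /andP[]].
  have [y [/= y1 yc]] := clc _ _ h1 (nbhs_ballF c ltr01).
  suff : absv c < 1 by rewrite ce ltxx.
  by rewrite -(subKr y c); apply: absvD_lt => //; rewrite absvN.
pose r := Num.max (absv c) 2^-1.
have r01 : 0 < r < 1 by rewrite /r lt_max gt_max cl1 /=; apply/andP; split; [apply/orP; right; lra|lra].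
have h2 : G [set x | r < absv x < 1] by exists r.
have h0 : (0 : R) < 2^-1 by lra.
have [y [/= /andP[ry _] yc]] := clc _ _ h2 (nbhs_ballF c h0).
suff : absv y <= r by rewrite leNgt ry.
rewrite -(subrK c y); apply: absvD_le; rewrite /r le_max ?lexx//.
by rewrite (ltW yc) orbT.
Qed.

(** By absv_gap the ratio of two distinct absolute values stays away from 1,
    so a set without a maximal element is unbounded. *)
Lemma absv_max_attained (P : set F) : (exists2 x, P x & x != 0) ->
  (exists C, forall x, P x -> absv x <= C) ->
  exists x, [/\ P x, x != 0 & forall y, P y -> absv y <= absv x].
Proof.
move=> [x0 Px0 x0n] [C hC]; apply: contrapT => hn.
have [r /andP[r0 r1] hr] := absv_gap.
have step x : P x -> x != 0 -> exists y, [/\ P y, y != 0 & absv x <= absv y * r].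
  move=> Px xn; apply: contrapT => hy; apply: hn; exists x; split=> // y Py.
  rewrite leNgt; apply/negP => xy; apply: hy; exists y.
  have yn : y != 0 by rewrite -absv_gt0 (le_lt_trans _ xy)// absv_ge0.
  split=> //; rewrite mulrC -ler_pdivrMr ?absv_gt0//.
  by rewrite -absvV -absvM hr// absvM absvV ltr_pdivrMr ?absv_gt0// mul1r.
have iterate k : exists y, [/\ P y, y != 0 & absv x0 <= absv y * r ^+ k].
  elim: k => [|k [y [Py yn hy]]]; first by exists x0; rewrite expr0 mulr1.
  have [z [Pz zn hz]] := step y Py yn; exists z; split=> //.
  by rewrite (le_trans hy)// exprS mulrA ler_wpM2r// exprn_ge0// ltW.
have C0 : 0 < C by rewrite (lt_le_trans _ (hC _ Px0))// absv_gt0.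
have e0 : 0 < absv x0 / C by rewrite divr_gt0// absv_gt0.
have := @cvg_expr R r; rewrite ger0_norm ?ltW// => /(_ r1).
move=> /cvgrPdist_lt /(_ _ e0) [N _ /(_ N (leqnn N))] /=.
rewrite sub0r normrN ger0_norm ?exprn_ge0 ?ltW//.
have [y [Py yn hy]] := iterate N.
rewrite ltr_pdivlMr// => h.
suff : absv x0 < absv x0 by rewrite ltxx.
rewrite (le_lt_trans hy)// (le_lt_trans _ h)// mulrC ler_wpM2l ?hC//.
by rewrite exprn_ge0// ltW.
Qed.

Lemma uniformizer_exists : exists p : F,
  [/\ p != 0, absv p < 1 & forall x, absv x < 1 -> absv x <= absv p].
Proof.
have [a a0 a1] := absv_small ltr01.
have [p [p1 p0 hp]] : exists x, [/\ absv x < 1, x != 0 &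
    forall y, absv y < 1 -> absv y <= absv x].
  apply: (absv_max_attained (P := [set x | absv x < 1])); first by exists a.
  by exists 1 => x /= /ltW.
by exists p.
Qed.

Definition unif : F := xget 0 [set p : F |
  [/\ p != 0, absv p < 1 & forall x, absv x < 1 -> absv x <= absv p]].

Lemma unifP : [/\ unif != 0, absv unif < 1 &
  forall x, absv x < 1 -> absv x <= absv unif].
Proof. by have := @xgetPex _ 0 _ uniformizer_exists. Qed.

Lemma unif_neq0 : unif != 0. Proof. by have [] := unifP. Qed.
Lemma unif_lt1 : absv unif < 1. Proof. by have [] := unifP. Qed.
Lemma unif_max x : absv x < 1 -> absv x <= absv unif.
Proof. by have [_ _] := unifP; apply. Qed.

Lemma unifX_neq0 n : unif ^+ n != 0. Proof. by rewrite expf_neq0 ?unif_neq0. Qed.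

Lemma absv_unif_le1 n : absv (unif ^+ n) <= 1.
Proof. by rewrite absvX exprn_ile1 ?absv_ge0// ltW ?unif_lt1. Qed.

Lemma absv_unifX_small a : a != 0 -> exists n, absv (unif ^+ n) <= absv a.
Proof.
move=> a0; have := @cvg_expr R (absv unif).
rewrite ger0_norm ?absv_ge0// => /(_ unif_lt1).
have : 0 < absv a by rewrite absv_gt0.
move=> e0 /cvgrPdist_lt /(_ _ e0) [N _ /(_ N (leqnn N))] /=.
rewrite sub0r normrN -absvX ger0_norm ?absv_ge0// => h.
by exists N; rewrite ltW.
Qed.

End LocalField.

(** * Lattices *)

Section Lattices.
Variables (R : realType) (F : nonArchLocalFieldType R).
Implicit Types (V W : vectType F).

(** The unit ball for the coordinates that define the topology of W; it is the
    lattice to which all others are compared. *)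
Definition cLam W : set W := [set w | forall i, absv (coords w 0 i) <= 1].

Lemma coordsD W (u v : W) : coords (u + v) = coords u + coords v.
Proof. by apply/rowP => i; rewrite !mxE linearD. Qed.

Lemma coordsZ W a (u : W) : coords (a *: u) = a *: coords u.
Proof. by apply/rowP => i; rewrite !mxE linearZ. Qed.

Lemma coordsDE W (u v : W) i : coords (u + v) 0 i = coords u 0 i + coords v 0 i.
Proof. by rewrite coordsD [LHS]mxE. Qed.

Lemma coordsZE W a (u : W) i : coords (a *: u) 0 i = a * coords u 0 i.
Proof. by rewrite coordsZ [LHS]mxE. Qed.

Lemma coordsBE W (u v : W) i : coords (u - v) 0 i = coords u 0 i - coords v 0 i.
Proof. by rewrite coordsDE -scaleN1r coordsZE mulN1r. Qed.

Lemma coords_sum W (w : W) : w = \sum_i coords w 0 i *: (vbasis {:W})`_i.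
Proof.
by rewrite {1}(coord_vbasis (memvf w)); apply: eq_bigr => i _; rewrite mxE.
Qed.

Lemma coords_sumE W (c : 'rV_(\dim {:W})) :
  coords (\sum_i c 0 i *: (vbasis {:W})`_i) = c.
Proof.
by apply/rowP => i; rewrite mxE coord_sum_free// (basis_free (vbasisP _)).
Qed.

Lemma coords_inj W : injective (@coords F W).
Proof. by move=> u v h; rewrite (coords_sum u) (coords_sum v) h. Qed.

Lemma topvec_nbhs0 W (v : topvec W) (A : set W) : nbhs v A <->
  exists2 e : R, 0 < e &
    forall w : W, (forall i, absv (coords w 0 i) < e) -> A ((v : W) + w).
Proof.
split=> [|[e e0 hA]].
  rewrite nbhsE /open_nbhs /= => -[B [[C oC CB] Bv] BA].
  have : nbhs (coords (v : W)) C.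
    by apply: open_nbhs_nbhs; split=> //; rewrite -CB in Bv.
  rewrite /nbhs /= => -[P hP PC].
  have he j : exists e : R, 0 < e /\
      [set y | absv (y - coords (v : W) 0 j) < e] `<=` P 0 j.
    by have /nbhs_absv[e e0 he] := hP 0 j; exists e.
  have [e he2] := choice he.
  exists (\big[Num.min/1]_j e j).
    by apply: (big_ind (fun x => 0 < x)) => // [x y x0 y0|j _]; [rewrite lt_min x0|case: (he2 j)].
  move=> w hw; apply: BA; rewrite -CB; apply: PC => i j.
  rewrite (ord1 i); apply: (he2 j).2 => /=.
  rewrite coordsDE [_ + coords w 0 j]addrC addrK.
  by rewrite (lt_le_trans (hw j))//; exact: bigmin_le_cond.
have hC : nbhs (coords (v : W))
    [set c | forall j, absv (c 0 j - coords (v : W) 0 j) < e].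
  rewrite /nbhs /=; exists (fun _ j => [set y | absv (y - coords (v : W) 0 j) < e]).
    by move=> i j; rewrite (ord1 i); exact: nbhs_ballF.
  by move=> c hc j; exact: hc.
have hn : nbhs v [set u : topvec W | forall j,
    absv (coords (u : W) 0 j - coords (v : W) 0 j) < e].
  exact: (@initial_continuous W _ (@coords F W) v _ hC).
apply: filterS hn => u /= hu; rewrite -(subrK (v : W) u) addrC; apply: hA => i.
by have := hu i; rewrite coordsBE.
Qed.

Lemma topvec_nbhs W (v : topvec W) (A : set W) : nbhs v A <->
  exists2 a : F, a != 0 & forall w : W, cLam w -> A ((v : W) + a *: w).
Proof.
split=> [/topvec_nbhs0[e e0 hA]|[a a0 hA]].
  have [a a0 ha] := @absv_small R F e e0.
  exists a => // w hw; apply: hA => i.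
  by rewrite coordsZE absvM (le_lt_trans _ ha)// ler_piMr ?absv_ge0 ?hw.
apply/topvec_nbhs0; exists (absv a); first by rewrite absv_gt0.
move=> w hw; rewrite -(scalerKV a0 w); apply: hA => i.
by rewrite coordsZE absvM absvV mulrC ler_pdivrMr ?absv_gt0// mul1r ltW.
Qed.

Lemma cLam0 W : @cLam W 0.
Proof. by move=> i; rewrite mxE linear0 absv0 ler01. Qed.

Lemma cLamD W u v : @cLam W u -> @cLam W v -> @cLam W (u + v).
Proof. by move=> hu hv i; rewrite coordsDE; apply: absvD_le. Qed.

Lemma cLamZ W a u : absv a <= 1 -> @cLam W u -> @cLam W (a *: u).
Proof. by move=> ha hu i; rewrite coordsZE; apply: absvM_le1. Qed.

(** Tychonoff for finitely many coordinates: an ultrafilter converges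
    coordinatewise. *)
Lemma cLam_compact W : compact (@cLam W : set (topvec W)).
Proof.
rewrite compact_ultra => U UU UL.
have PU : ProperFilter U by exact: ultra_proper.
have h j : exists c : F, absv c <= 1 /\
    forall B, nbhs c B -> U [set w : W | B (coords w 0 j)].
  pose f (w : topvec W) : F := coords (w : W) 0 j.
  have PfU : ProperFilter (f @ U) by exact: fmap_proper_filter.
  have /(_ _ PfU)[|c [c1 cc]] := @compact_ballF R F.
    by apply: (@filterS _ U _ (cLam (W:=W))) UL => w /(_ j).
  exists c; split=> // B cB.
  have [//|UnB] := in_ultra_setVsetC (f @^-1` B) UU.
  by have [x [/= + Bx]] := cc (~` B) _ UnB cB; move/(_ Bx).
have [c hc] := choice h.
exists (\sum_i c i *: (vbasis {:W})`_i : W).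
have cE : coords (\sum_i c i *: (vbasis {:W})`_i : W) = \row_i c i.
  rewrite -[RHS]coords_sumE; congr coords.
  by apply: eq_bigr => i _; rewrite mxE.
split=> [i|A /topvec_nbhs0[e e0 hA]]; first by rewrite cE mxE; case: (hc i).
have : U [set w : W | forall i, absv (coords w 0 i - c i) < e].
  apply: (@filter_forall _ _ (fun i => [set w : W | absv (coords w 0 i - c i) < e])).
  by move=> i; apply: (hc i).2 ([set y | absv (y - c i) < e]) _; exact: nbhs_ballF.
apply: filterS => w /= hw.
set s := \sum_i _ in hA cE *.
rewrite -(subrK s w) addrC; apply: hA => i.
have cEi : coords s 0 i = c i by rewrite cE [LHS]mxE.
by have := hw i; rewrite coordsBE cEi.
Qed.

(** Lattices, described algebraically as the submodules commensurable with the
    unit lattice of the reference basis. *)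
Definition submod W (X : set W) := [/\ X 0,
  (forall u v, X u -> X v -> X (u + v)) &
  (forall (a : F) u, absv a <= 1 -> X u -> X (a *: u))].

Definition latt W (X : set W) := [/\ submod X,
  (exists2 a : F, a != 0 & forall x, X x -> cLam (a *: x)) &
  (exists2 a : F, a != 0 & forall x, cLam x -> X (a *: x))].

Lemma submodN W (X : set W) u : submod X -> X u -> X (- u).
Proof. by case=> _ _ h Xu; rewrite -scaleN1r; apply: h; rewrite // absvN absv1. Qed.

Lemma submodB W (X : set W) u v : submod X -> X u -> X v -> X (u - v).
Proof. by move=> sX Xu Xv; have [_ h _] := sX; apply: h => //; exact: submodN. Qed.

Lemma submodD W (X : set W) u v : submod X -> X u -> X v -> X (u + v).
Proof. by case=> _ h _; exact: h. Qed.

Lemma submodZ W (X : set W) a u : submod X -> absv a <= 1 -> X u -> X (a *: u).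
Proof. by case=> _ _; apply. Qed.

Lemma submod_sum W (X : set W) (I : Type) (s : seq I) (P : pred I) (f : I -> W) :
  submod X -> (forall i, P i -> X (f i)) -> X (\sum_(i <- s | P i) f i).
Proof. by move=> [X0 XD _] h; elim/big_ind: _ => //. Qed.

Lemma latt_submod W (X : set W) : latt X -> submod X. Proof. by case. Qed.

Lemma cLam_latt W : latt (@cLam W).
Proof.
split; first by split; [exact: cLam0|exact: cLamD|exact: cLamZ].
- by exists 1; rewrite ?oner_eq0// => x; rewrite scale1r.
- by exists 1; rewrite ?oner_eq0// => x; rewrite scale1r.
Qed.

Lemma latt_nbhs W (X : set W) (v : topvec W) (A : set W) : latt X ->
  nbhs v A <-> exists2 a : F, a != 0 & forall w, X w -> A ((v : W) + a *: w).
Proof.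
move=> [_ [a a0 ha] [b b0 hb]]; split=> [/topvec_nbhs[c c0 hc]|[c c0 hc]].
  exists (c * a); rewrite ?mulf_neq0// => w Xw.
  by rewrite -scalerA; apply: hc; exact: ha.
apply/topvec_nbhs; exists (c * b); rewrite ?mulf_neq0// => w Xw.
by rewrite -scalerA; apply: hc; exact: hb.
Qed.

Lemma submod_open W (X : set W) (a : F) : submod X -> a != 0 ->
  (forall x, cLam x -> X (a *: x)) -> open (X : set (topvec W)).
Proof.
move=> sX a0 ha; rewrite openE => x Xx; apply/topvec_nbhs; exists a => // w hw.
by apply: submodD => //; exact: ha.
Qed.

Lemma latt_open W (X : set W) : latt X -> open (X : set (topvec W)).
Proof. by move=> [sX _ [a a0 ha]]; exact: submod_open ha. Qed.

Lemma latt_closed W (X : set W) : latt X -> closed (X : set (topvec W)).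
Proof.
move=> lX x clx; have sX := latt_submod lX.
have /clx[y [Xy /= Xyx]] : nbhs x [set y : W | X (y - (x : W))].
  apply/(latt_nbhs _ _ lX); exists 1; rewrite ?oner_eq0// => w Xw /=.
  by rewrite addrC addKr scale1r.
by rewrite -(subKr (y : W) (x : W)); exact: submodB.
Qed.

Lemma latt_scale W (X : set W) (a : F) : a != 0 -> latt X -> latt [set a *: x | x in X].
Proof.
move=> a0 [[X0 XD XZ] [b b0 hb] [c c0 hc]]; split.
- split; first by exists 0; rewrite ?scaler0.
  + by move=> _ _ [u Xu <-] [v Xv <-]; exists (u + v); rewrite ?scalerDr//; apply: XD.
  + move=> e _ he [u Xu <-]; exists (e *: u); first exact: XZ.
    by rewrite !scalerA mulrC.
- exists (b / a); rewrite ?mulf_neq0 ?invr_eq0// => _ [u Xu <-].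
  by rewrite scalerA mulfVK//; exact: hb.
- exists (a * c); rewrite ?mulf_neq0// => u hu.
  by exists (c *: u); rewrite ?scalerA//; exact: hc.
Qed.

Lemma cLam_scale_compact W (a : F) : a != 0 ->
  compact ([set a *: x | x in @cLam W] : set (topvec W)).
Proof.
move=> a0; apply: (@continuous_compact (topvec W) (topvec W) (fun w => a *: (w : W))).
  apply: continuous_subspaceT => x A /= /topvec_nbhs[b b0 hb].
  apply/topvec_nbhs; exists (b / a); rewrite ?mulf_neq0 ?invr_eq0// => w hw /=.
  by rewrite scalerDr scalerA mulrCA mulfV// mulr1; apply: hb.
exact: cLam_compact.
Qed.

Lemma latt_compact W (X : set W) : latt X -> compact (X : set (topvec W)).
Proof.
move=> lX; have [_ [a a0 ha] _] := lX.
have ai0 : a^-1 != 0 by rewrite invr_eq0.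
apply: subclosed_compact (latt_closed lX) (cLam_scale_compact ai0) _.
by move=> x Xx; exists (a *: x); [exact: ha|rewrite scalerK].
Qed.

End Lattices.

Section LinearMaps.
Variables (R : realType) (F : nonArchLocalFieldType R).
Implicit Types (V W : vectType F).
Local Notation pi_ := (unif F).

Lemma common_scalar (I : finType) (P : I -> F -> Prop) :
  (forall i a b, absv b <= absv a -> P i a -> P i b) ->
  (forall i, exists2 a, a != 0 & P i a) -> exists2 a, a != 0 & forall i, P i a.
Proof.
move=> hP hex.
have h i : exists a, a != 0 /\ P i a by have [a a0 Pa] := hex i; exists a.
have [a ha] := choice h.
have e0 : 0 < \big[Num.min/1]_i absv (a i).
  apply: (big_ind (fun x => 0 < x)) => // [x y x0 y0|i _]; first by rewrite lt_min x0.
  by rewrite absv_gt0; case: (ha i).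
have [b b0 hb] := absv_small F e0.
exists b => // i; apply: hP (ha i).2.
by rewrite (le_trans (ltW hb))//; exact: bigmin_le_cond.
Qed.

Lemma submod_scale_le W (X : set W) (a b : F) (w : W) : submod X ->
  absv b <= absv a -> X (a *: w) -> X (b *: w).
Proof.
move=> sX hab Xa; have [a0|a0] := eqVneq a 0.
  move: hab; rewrite a0 absv0 le_eqVlt ltNge absv_ge0 orbF absv_eq0E => /eqP->.
  by rewrite scale0r; case: sX.
rewrite -(mulfVK a0 b) -scalerA; apply: submodZ => //.
by rewrite absvM absvV ler_pdivrMr ?absv_gt0// mul1r.
Qed.

Lemma cLam_absorb W (w : W) : exists2 a : F, a != 0 & cLam (a *: w).
Proof.
apply: (@common_scalar _ (fun i a => absv (coords (a *: w) 0 i) <= 1)).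
  move=> i a b hab; rewrite !coordsZE !absvM => h.
  by rewrite (le_trans _ h)// ler_wpM2r// absv_ge0.
move=> i; set x := coords w 0 i.
have e0 : 0 < (absv x + 1)^-1 by rewrite invr_gt0 ltr_wpDl// absv_ge0.
have [a a0 ha] := absv_small F e0.
exists a => //; rewrite coordsZE absvM -/x.
have x1 : 0 < absv x + 1 by rewrite ltr_wpDl// absv_ge0.
have : absv a * (absv x + 1) < 1 by rewrite -ltr_pdivlMr// mul1r.
have := absv_ge0 a; have := absv_ge0 x; nra.
Qed.

Lemma latt_absorb W (X : set W) (w : W) : latt X -> exists2 a : F, a != 0 & X (a *: w).
Proof.
move=> [_ _ [b b0 hb]]; have [a a0 ha] := cLam_absorb w.
by exists (b * a); rewrite ?mulf_neq0// -scalerA; apply: hb.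
Qed.

Lemma lin_bounded V W (T : 'Hom(V, W)) :
  exists2 a : F, a != 0 & forall x, cLam x -> cLam (a *: T x).
Proof.
have [a a0 ha] : exists2 a, a != 0 & forall i : 'I_(\dim {:V}),
    cLam (a *: T (vbasis {:V})`_i).
  apply: common_scalar => [i a b hab|i]; last exact: cLam_absorb.
  by apply: submod_scale_le => //; exact: latt_submod (cLam_latt _).
exists a => // x hx; rewrite (coords_sum x) linear_sum scaler_sumr.
apply: submod_sum => [|i _]; first exact: latt_submod (cLam_latt _).
by rewrite linearZ /= scalerA mulrC -scalerA; apply: cLamZ.
Qed.

Lemma latt_lin V W (T : 'Hom(V, W)) (X : set V) (Y : set W) : latt X -> latt Y ->
  exists2 a : F, a != 0 & forall x, X x -> Y (a *: T x).
Proof.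
move=> [_ [a a0 ha] _] [_ _ [b b0 hb]].
have [c c0 hc] := lin_bounded T.
exists (b * c * a); rewrite ?mulf_neq0// => x Xx.
have -> : (b * c * a) *: T x = b *: (c *: T (a *: x)) by rewrite [T (_ *: _)]linearZ /= !scalerA.
exact/hb/hc/ha.
Qed.

Lemma latt_comm W (X Y : set W) : latt X -> latt Y ->
  exists2 a : F, a != 0 & forall x, X x -> Y (a *: x).
Proof.
move=> lX lY; have [a a0 ha] := latt_lin \1%VF lX lY.
by exists a => // x /ha; rewrite id_lfunE.
Qed.

Lemma submod_img V W (T : 'Hom(V, W)) (X : set V) : submod X -> submod (T @` X).
Proof.
move=> sX; split; first by exists 0; rewrite ?linear0//; case: sX.
- by move=> _ _ [u Xu <-] [v Xv <-]; exists (u + v); rewrite ?linearD//; exact: submodD.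
- by move=> a _ ha [u Xu <-]; exists (a *: u); rewrite ?linearZ//; exact: submodZ.
Qed.

Lemma latt_img V W (T : 'Hom(V, W)) (X : set V) : limg T = fullv -> latt X ->
  latt (T @` X).
Proof.
move=> sT lX; split; first exact/submod_img/latt_submod.
- have [a a0 ha] := latt_lin T lX (cLam_latt W).
  by exists a => // _ [x Xx <-]; exact: ha.
- have [a a0 ha] := latt_lin (T^-1)%VF (cLam_latt W) lX.
  exists a => // w hw; exists (a *: (T^-1)%VF w); first exact: ha.
  by rewrite linearZ /= limg_lfunVK// sT memvf.
Qed.

Lemma latt_preim V W (T : 'Hom(V, W)) (X : set W) : lker T == 0%VS -> latt X ->
  latt (T @^-1` X).
Proof.
move=> iT lX; have sX := latt_submod lX; split.
- split => /=; first by rewrite linear0; case: sX.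
  + by move=> u v Xu Xv; rewrite linearD; exact: submodD.
  + by move=> a u ha Xu; rewrite linearZ; exact: submodZ.
- have [a a0 ha] := latt_lin (T^-1)%VF lX (cLam_latt V).
  by exists a => // x /= /ha; rewrite lker0_lfunK.
- have [a a0 ha] := latt_lin T (cLam_latt V) lX.
  by exists a => // x /= /ha; rewrite linearZ.
Qed.

(** The multiples pi^-k of the unit lattice are open and increase to the whole
    space. *)
Lemma compact_in_multiple W (K : set W) : compact (K : set (topvec W)) ->
  exists k, forall x, K x -> cLam (pi_ ^+ k *: x).
Proof.
move=> cX; apply: contrapT => hn.
have H k : exists x, K x /\ ~ cLam (pi_ ^+ k *: x).
  apply: contrapT => h; apply: hn; exists k.
  by move=> x Xx; apply: contrapT => hx; apply: h; exists x.
pose G := [set A : set (topvec W) | exists k,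
  [set x : W | K x /\ ~ cLam (pi_ ^+ k *: x)] `<=` A].
have sc : submod (@cLam R F W) by exact: latt_submod (cLam_latt _).
have mono k l : (k <= l)%N -> [set x : W | K x /\ ~ cLam (pi_ ^+ l *: x)] `<=`
    [set x : W | K x /\ ~ cLam (pi_ ^+ k *: x)].
  move=> kl x [Xx hx]; split=> // hk; apply: hx; apply: submod_scale_le hk => //.
  rewrite -(subnK kl) exprD absvM ler_piMl ?absv_ge0//.
  exact: absv_unif_le1.
have PG : ProperFilter G.
  apply: Build_ProperFilter.
    by move=> [k hk]; have [x /hk] := H k.
  split; first by exists 0%N.
  - move=> A B [k hA] [l hB]; exists (maxn k l) => x hx.
    by split; [apply: hA|apply: hB]; apply: mono hx; rewrite ?leq_maxl ?leq_maxr.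
  - by move=> A B AB [k hA]; exists k; exact: subset_trans AB.
have [|c [Xc clc]] := cX G PG; first by exists 0%N => x [].
have [a a0 ha] := cLam_absorb (c : W).
have [k hk] := absv_unifX_small a0.
have hc : cLam (pi_ ^+ k *: (c : W)) by apply: submod_scale_le ha.
have GA : G [set x : W | K x /\ ~ cLam (pi_ ^+ k *: x)] by exists k.
have nc : nbhs c [set x : W | cLam (pi_ ^+ k *: x)].
  apply/topvec_nbhs; exists 1; rewrite ?oner_eq0// => w hw /=.
  by rewrite scalerDr; apply: cLamD => //; rewrite scale1r; apply: cLamZ => //;
    exact: absv_unif_le1.
by have [x [[_ +] hx]] := clc _ _ GA nc; apply.
Qed.

(** Compactness bounds the lattice from above and openness at 0 bounds it from
    below. *)
Lemma is_lattice_latt V (X : set V) : is_lattice X -> latt X.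
Proof.
move=> [cX oX X0 XD XZ]; have sX : submod X by [].
split=> //.
  by have [k hk] := compact_in_multiple cX; exists (pi_ ^+ k); rewrite ?unifX_neq0.
move: oX; rewrite openE => /(_ 0 X0) /topvec_nbhs[a a0 ha].
by exists a => // x /ha; rewrite add0r.
Qed.

(** The cosets of aX are open and X is compact. *)
Lemma latt_finite_cover V (X : set V) (a : F) : latt X -> a != 0 ->
  exists s : seq V, (forall y, y \in s -> X y) /\
    forall x, X x -> exists2 y, y \in s & exists2 z, X z & x = y + a *: z.
Proof.
move=> lX a0; have sX := latt_submod lX.
have := latt_compact lX; rewrite compact_cover => cX.
pose f (y : topvec V) : set (topvec V) := [set x | exists2 z, X z & (x : V) = (y : V) + a *: z].
have of_ y : X y -> open (f y).
  move=> Xy; rewrite openE => x [z Xz xE]; apply/(latt_nbhs _ _ lX).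
  exists a => // w Xw; exists (z + w); first exact: submodD.
  by rewrite xE scalerDr addrA.
have cov : X `<=` cover X f.
  move=> x Xx; exists x => //; exists 0; first by case: sX.
  by rewrite scaler0 addr0.
have [D DX XD] := cX _ X f of_ cov.
exists (finmap.enum_fset D); split=> [y yD|x /XD[y yD [z Xz xE]]].
  by have := DX y yD; rewrite inE.
by exists y => //; exists z.
Qed.

Lemma line_bounded W (X : set W) (w : W) : latt X -> w != 0 ->
  exists C, forall c, X (c *: w) -> absv c <= C.
Proof.
move=> [_ [a a0 ha] _] w0.
have [i wi] : exists i, coords w 0 i != 0.
  apply: contrapT => h; move/eqP: w0; apply; apply: (@coords_inj _ F).
  apply/rowP => i; rewrite [RHS]mxE linear0; apply/eqP.
  by apply: contrapT => /negP hi; apply: h; exists i.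
exists ((absv a)^-1 * (absv (coords w 0 i))^-1) => c' /= Xc'.
have := ha _ Xc' i; rewrite !coordsZE !absvM.
have p1 : 0 < absv a by rewrite absv_gt0.
have p2 : 0 < absv (coords w 0 i) by rewrite absv_gt0.
by rewrite -invfM -[_^-1]mul1r ler_pdivlMr ?mulr_gt0// mulrCA.
Qed.

Lemma topvec_hausdorff W : hausdorff_space (topvec W).
Proof.
move=> p q clpq; apply: contrapT => pq.
have w0 : (q : W) - (p : W) != 0.
  by rewrite subr_eq0; apply/eqP => qp; apply: pq; rewrite qp.
have [C hC] := line_bounded (cLam_latt W) w0.
have C0 : 0 < (Num.max C 0 + 1)^-1 by rewrite invr_gt0 ltr_wpDl// le_max lexx orbT.
have [a a0 ha] := absv_small F C0.
have np (r : topvec W) : nbhs r [set x : W | cLam (a^-1 *: (x - (r : W)))].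
  apply/topvec_nbhs; exists a => // w hw /=.
  by rewrite addrC addKr scalerK.
have [z [/= zp zq]] := clpq _ _ (np p) (np q).
have : cLam (a^-1 *: ((q : W) - (p : W))).
  have e (x y t : W) : y - x = (t - x) - (t - y) by rewrite opprB [RHS]addrC subrKA.
  by rewrite (e p q z) scalerBr; apply: (submodB (latt_submod (cLam_latt W))).
move=> /hC; rewrite absvV; apply/negP; rewrite -ltNge.
have a1 : 0 < absv a by rewrite absv_gt0.
have M0 : 0 < Num.max C 0 + 1 by rewrite ltr_wpDl// le_max lexx orbT.
have M1 : Num.max C 0 + 1 < (absv a)^-1 by rewrite -[ltLHS]invrK ltf_pV2 ?posrE ?invr_gt0.
by apply: le_lt_trans M1; rewrite ler_wpDr// le_max lexx.
Qed.

(** A vector of the kernel, or a vector outside X with image in X, has a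
    largest multiple in X; since t is the identity modulo pi X, that multiple
    would lie in pi X. *)
Lemma near1_stab W (t : 'End(W)) (X : set W) : latt X ->
  (forall x, X x -> exists2 y, X y & t x = x + pi_ *: y) ->
  lker t == 0%VS /\ t @` X = X.
Proof.
move=> lX ht; have sX := latt_submod lX.
have ht2 x : X x -> X (t x).
  move=> Xx; have [y Xy ->] := ht x Xx; apply: submodD => //.
  by apply: submodZ => //; exact/ltW/unif_lt1.
(* the largest multiple of a nonzero vector that lies in X is not in pi X *)
have top (w : W) : w != 0 -> exists c, [/\ c != 0, X (c *: w) &
    forall y, X y -> c *: w <> pi_ *: y].
  move=> w0; have [c [/= Xc c0 hc]] : exists c, [/\ X (c *: w), c != 0 &
      forall c', X (c' *: w) -> absv c' <= absv c].
    apply: (absv_max_attained (P := [set c | X (c *: w)])).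
      by have [a a0 ha] := latt_absorb w lX; exists a.
    exact: line_bounded.
  exists c; split=> // y Xy hy.
  have : X ((c / pi_) *: w).
    by rewrite mulrC -scalerA hy scalerA mulVf ?unif_neq0// scale1r.
  move=> /hc; rewrite absvM absvV ler_pdivrMr ?absv_gt0 ?unif_neq0//.
  by rewrite ler_pMr ?absv_gt0// leNgt unif_lt1.
have it : lker t == 0%VS.
  apply/lker0P => u v uv; apply/eqP; rewrite -subr_eq0; apply/negPn/negP => n0.
  have [c [c0 Xc hc]] := top _ n0.
  have [y Xy] := ht _ Xc; rewrite linearZ linearB /= uv subrr scaler0 => h.
  have := hc (- y) (submodN sX Xy); apply.
  by rewrite scalerN; apply/eqP; rewrite -addr_eq0 -h.
split=> //; rewrite eqEsubset; split=> [_ [x Xx <-]|x Xx]; first exact: ht2.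
have [y ty] : exists y, t y = x.
  have : x \in limg t by rewrite (lker0_limgf it) ?memvf.
  by move=> /memv_imgP[y _ ->]; exists y.
exists y => //; apply: contrapT => nXy.
have y0 : y != 0 by apply/eqP => y0; apply: nXy; rewrite y0; case: sX.
have [c [c0 Xc hc]] := top _ y0.
have c1 : absv c < 1.
  rewrite ltNge; apply/negP => c1; apply: nXy.
  rewrite -[y]scale1r; apply: submod_scale_le Xc => //.
  by rewrite absv1.
have [z Xz] := ht _ Xc; rewrite linearZ /= ty => h.
have cpi : absv (c / pi_) <= 1.
  by rewrite absvM absvV ler_pdivrMr ?absv_gt0 ?unif_neq0// mul1r unif_max.
apply: (hc ((c / pi_) *: x - z)).
  by apply: submodB => //; apply: submodZ.
rewrite scalerBr scalerA mulrC mulfVK ?unif_neq0//.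
by rewrite h addrK.
Qed.

End LinearMaps.

(** * Orthonormal bases of a lattice *)

Section OrthogonalBases.
Variables (R : realType) (F : nonArchLocalFieldType R) (V : vectType F).
Variables (X : set V) (lX : latt X).

(** The orthonormal bases of E for the norm with unit ball X. *)
Definition obasis (E : {vspace V}) (b : seq V) := basis_of E b /\
  forall c : nat -> F, X (\sum_(i < size b) c i *: b`_i) <->
    forall i, (i < size b)%N -> absv (c i) <= 1.

Lemma obasis0 : obasis 0 [::].
Proof.
split; first by rewrite /basis_of span_nil eqxx nil_free.
by move=> c; split=> // _; rewrite big_ord0; case: (latt_submod lX).
Qed.

(** Among the vectors c v + e of X with e in E, one with the largest
    coefficient c extends the basis: by maximality the coefficient of any
    vector of X along it is integral. *)
Lemma obasis_ext E b v : obasis E b -> v \notin E ->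
  exists x, obasis (E + <[v]>) (b ++ [:: x]).
Proof.
move=> [bE hb] vE; have sX := latt_submod lX.
pose P := [set c : F | exists2 e, e \in E & X (c *: v + e)].
have [c0 [[e0 e0E Xe0] c00 hc0]] : exists c, [/\ P c, c != 0 &
    forall c', P c' -> absv c' <= absv c].
  apply: absv_max_attained.
    have [a a0 ha] := latt_absorb v lX.
    by exists a => //; exists 0; rewrite ?mem0v// addr0.
  pose T : 'End(V) := (\1 - projv E)%VF.
  have TE e : e \in E -> T e = 0.
    by move=> eE; rewrite lfunE /= opp_lfunE id_lfunE projv_id// subrr.
  have Tv : T v != 0.
    rewrite lfunE /= opp_lfunE id_lfunE subr_eq0; apply: contraNneq vE => ->.
    exact: memv_proj.
  have [a a0 ha] := latt_lin T lX (cLam_latt V).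
  have aTv : a *: T v != 0 by rewrite scaler_eq0 negb_or a0.
  have [C hC] := line_bounded (cLam_latt V) aTv.
  exists C => c [e eE /ha]; rewrite linearD linearZ /= (TE e)// addr0 => h.
  by apply: hC; rewrite scalerA mulrC -scalerA.
set x0 := c0 *: v + e0 in Xe0.
have sE : (E + <[v]> = E + <[x0]>)%VS.
  apply/eqP; rewrite eqEsubv !subv_add !addvSl /=; apply/andP; split.
    rewrite -memvE -(scalerK c00 v) memvZ//.
    have -> : c0 *: v = - e0 + x0 by rewrite /x0 addrCA addNr addr0.
    by apply: memv_add; rewrite ?memvN// memv_line.
  rewrite -memvE /x0 addrC; apply: memv_add => //.
  by rewrite memvZ// memv_line.
have x0E : x0 \notin E.
  apply: contra vE => h; rewrite -(scalerK c00 v) memvZ//.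
  have -> : c0 *: v = x0 - e0 by rewrite /x0 addrK.
  by rewrite memvB.
exists x0; split.
  rewrite sE; apply: cat_basis => //.
    apply/directv_addP; apply/eqP; rewrite -subv0; apply/subvP => y.
    rewrite memv_cap => /andP[yE /vlineP[k yk]].
    have [k0|k0] := eqVneq k 0; first by rewrite yk k0 scale0r mem0v.
    move/negP: x0E; case; rewrite -(scalerK k0 x0) -yk memvZ//.
  rewrite /basis_of span_seq1 eqxx seq1_free.
  by apply: contraNneq x0E => ->; exact: mem0v.
move=> c; rewrite size_cat addn1 big_ord_recr /= nth_cat ltnn subnn /=.
have -> : \sum_(i < size b) c i *: (b ++ [:: x0])`_i = \sum_(i < size b) c i *: b`_i.
  by apply: eq_bigr => i _; rewrite nth_cat ltn_ord.
set S := \sum_(i < size b) _.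
have SE : S \in E.
  apply: memv_suml => i _; rewrite memvZ// (basis_mem bE)// mem_nth//.
split=> [XS|hc].
  have h1 : absv (c (size b)) <= 1.
    have : P (c (size b) * c0).
      exists (S + c (size b) *: e0); first by rewrite memvD// memvZ.
      by rewrite addrCA -scalerA -scalerDr.
    by move=> /hc0; rewrite absvM ger_pMl// absv_gt0.
  move=> i; rewrite ltnS leq_eqVlt => /orP[/eqP->//|ib].
  apply: (hb c).1 => //; rewrite -/S.
  rewrite -(addrK (c (size b) *: x0) S); apply: submodB => //.
  exact: submodZ.
apply: submodD => //; first by apply/hb => i ib; apply: hc; rewrite ltnS ltnW.
by apply: submodZ => //; exact: hc.
Qed.

Lemma obasis_extend E b (U : {vspace V}) : obasis E b -> (E <= U)%VS ->
  exists b', obasis U (b ++ b').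
Proof.
have [k] := ubnP (\dim U - \dim E)%N; elim: k E b => // k ih E b; rewrite ltnS => hk hb EU.
have [UE|/subvPn[v vU vE]] := boolP (U <= E)%VS.
  have -> : U = E by apply/eqP; rewrite eqEsubv UE.
  by exists [::]; rewrite cats0.
have [x hx] := obasis_ext hb vE.
have EvU : (E + <[v]> <= U)%VS by rewrite subv_add EU -memvE.
have [|b' hb'] := ih _ _ _ hx EvU.
  have h1 : (\dim E < \dim (E + <[v]>))%N.
    rewrite ltnNge; apply/negP => h; move/negP: vE; apply.
    have /eqP -> : (E == E + <[v]>)%VS by rewrite eqEdim addvSl.
    by rewrite memvE addvSr.
  by have h2 := dimvS EvU; lia.
by exists ([:: x] ++ b'); rewrite catA.
Qed.

Lemma obasis_exists E : exists b, obasis E b.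
Proof. by have [b] := obasis_extend obasis0 (sub0v E); exists b. Qed.

Lemma obasis_adapted E : exists b b', obasis E b /\ obasis fullv (b ++ b').
Proof.
have [b hb] := obasis_exists E; have [b' hb'] := obasis_extend hb (subvf E).
by exists b, b'.
Qed.

End OrthogonalBases.

(** * Cosets and balls *)

Lemma transversal_exists (T : eqType) (s : seq T) (e : T -> T -> Prop) :
  (forall x y, e x y -> e y x) ->
  (forall x y z, e x y -> e y z -> e x z) ->
  (forall x, x \in s -> e x x) ->
  exists s', [/\ uniq s', {subset s' <= s},
    (forall x, x \in s -> exists2 y, y \in s' & e x y) &
    (forall x y, x \in s' -> y \in s' -> e x y -> x = y)].
Proof.
move=> eS eT; elim: s => [|a s ih] eR; first by exists [::].
have [|s' [us' ss' cs' is']] := ih; first by move=> x xs; apply: eR; rewrite inE xs orbT.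
have [[y ys' ay]|na] := pselect (exists2 y, y \in s' & e a y).
  exists s'; split=> // [x /ss' h|x]; first by rewrite inE h orbT.
  by rewrite inE => /orP[/eqP->|/cs'//]; exists y.
exists (a :: s'); split.
- rewrite /= us' andbT; apply/negP => h; apply: na; exists a => //.
  by apply: eR; rewrite inE eqxx.
- by move=> x; rewrite !inE => /orP[->//|/ss' ->]; rewrite orbT.
- move=> x; rewrite inE => /orP[/eqP->|/cs' [y ys xy]].
    by exists a; [rewrite inE eqxx|apply: eR; rewrite inE eqxx].
  by exists y => //; rewrite inE ys orbT.
- move=> x y; rewrite !inE => /orP[/eqP->|xs] /orP[/eqP->|ys] xy //.
  + by exfalso; apply: na; exists y.
  + by exfalso; apply: na; exists x => //; exact: eS.
  + exact: is'.
Qed.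

Section Cosets.
Variables (R : realType) (F : nonArchLocalFieldType R).
Implicit Types (V W : vectType F).
Local Notation pi_ := (unif F).

Lemma coset_transversal W (X Z : set W) : latt X -> latt Z -> Z `<=` X ->
  exists s : seq W, [/\ uniq s, (forall y, y \in s -> X y),
    (forall x, X x -> exists2 y, y \in s & Z (x - y)) &
    (forall x y, x \in s -> y \in s -> Z (x - y) -> x = y)].
Proof.
move=> lX lZ ZX; have sZ := latt_submod lZ.
have [a a0 ha] := latt_comm lX lZ.
have [s [sX cs]] := latt_finite_cover lX a0.
have [|||s' [us' ss' cs' is']] := @transversal_exists _ s (fun x y => Z (x - y)).
- by move=> x y; rewrite -opprB => /(submodN sZ); rewrite opprK.
- by move=> x y z h1 h2; rewrite -(subrKA y); exact: submodD.
- by move=> x _; rewrite subrr; case: sZ.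
exists s'; split=> // [y /ss'/sX//|x Xx].
have [y ys [z Xz ->]] := cs _ Xx; have [y' ys' h] := cs' _ ys.
exists y' => //; rewrite addrAC; apply: submodD => //; exact: ha.
Qed.

(** Balls of radius |pi|^m for the norm with unit ball cLam, that is, cosets
    of pi^m cLam. *)
Definition bal W (m : nat) (v : W) : set W :=
  [set w | cLam ((pi_ ^+ m)^-1 *: (w - v))].

Lemma bal_center W m (v : W) : bal m v v.
Proof. by rewrite /bal /= subrr scaler0; exact: cLam0. Qed.

Lemma bal0 W : @bal W 0 0 = @cLam R F W.
Proof. by apply/seteqP; split => w; rewrite /bal /= subr0 expr0 invr1 scale1r. Qed.

Lemma bal_le W l m (u v : W) : (l <= m)%N -> bal m v u -> bal l v u.
Proof.
move=> lm; rewrite /bal /=; apply: submod_scale_le; first exact: latt_submod (cLam_latt _).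
rewrite !absvV lef_pV2 ?posrE ?absv_gt0 ?unifX_neq0//.
by rewrite -(subnK lm) exprD absvM ler_piMl ?absv_ge0 ?absv_unif_le1.
Qed.

Lemma bal_eq W m (u v : W) : bal m v u -> bal m u = bal m v.
Proof.
have sc := latt_submod (cLam_latt W).
move=> h; apply/seteqP; split=> w; rewrite /bal /= => hw.
  by rewrite -(subrKA u) scalerDr; apply: (submodD sc).
rewrite -(subrKA v) scalerDr; apply: (submodD sc) => //.
by rewrite -opprB scalerN; apply: (submodN sc).
Qed.

Lemma bal_sub W l m (u v : W) : (l <= m)%N -> bal l v u -> bal m u `<=` bal l v.
Proof. by move=> lm /bal_eq <- w; exact: bal_le. Qed.

Lemma balE W m (v w : W) : bal m v w <-> exists2 z, cLam z & w = v + pi_ ^+ m *: z.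
Proof.
split=> [h|[z hz ->]]; last by rewrite /bal /= addrC addKr scalerK ?unifX_neq0.
by exists ((pi_ ^+ m)^-1 *: (w - v)); rewrite // scalerKV ?unifX_neq0// addrC subrK.
Qed.

Lemma bal_nbhs W m (v : topvec W) : nbhs v (bal m (v : W)).
Proof.
apply/topvec_nbhs; exists (pi_ ^+ m); first exact: unifX_neq0.
by move=> w hw; apply/balE; exists w.
Qed.

Lemma bal_open W m (v : W) : open (bal m v : set (topvec W)).
Proof. by rewrite openE => x /bal_eq <-; exact: bal_nbhs. Qed.

Lemma nbhs_bal W (v : topvec W) (A : set W) : nbhs v A <-> exists m, bal m (v : W) `<=` A.
Proof.
split=> [/topvec_nbhs[a a0 ha]|[m mA]]; last exact: filterS mA (bal_nbhs m v).
have [m hm] := absv_unifX_small a0; exists m => w /balE[z hz ->].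
have := ha ((a^-1 * pi_ ^+ m) *: z); rewrite scalerA mulrA mulfV// mul1r; apply.
apply: cLamZ => //; rewrite absvM absvV mulrC ler_pdivrMr ?absv_gt0//.
by rewrite mul1r.
Qed.

(** The point is a cluster point of the centers, which exists by compactness. *)
Lemma cLam_complete W (u : nat -> W) : cLam (u 0%N) ->
  (forall m, bal m (u m) (u m.+1)) ->
  exists2 w, cLam w & forall m, bal m (u m) w.
Proof.
move=> u0 hu.
have hle l m : (l <= m)%N -> bal l (u l) (u m).
  move=> lm; rewrite -(subnK lm) addnC; elim: (m - l)%N => [|k ih].
    by rewrite addn0; exact: bal_center.
  rewrite addnS -(bal_eq ih); apply: (@bal_le _ _ (l + k)); [exact: leq_addr|exact: hu].
have hc m : cLam (u m).
  have := hle _ _ (leq0n m); rewrite /bal /= expr0 invr1 scale1r => h.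
  by rewrite -(subrK (u 0%N) (u m)); apply: cLamD.
pose G := [set A : set (topvec W) | exists k, [set u m | m in [set m | (k <= m)%N]] `<=` A].
have PG : ProperFilter G.
  apply: Build_ProperFilter.
    by move=> [k hk]; have := hk (u k); apply; exists k => /=.
  split; first by exists 0%N.
  - move=> A B [k hA] [l hB]; exists (maxn k l) => _ [m /= + <-].
    by rewrite geq_max => /andP[km lm]; split; [apply: hA; exists m|apply: hB; exists m].
  - by move=> A B AB [k hA]; exists k; exact: subset_trans AB.
have [|w [Lw clw]] := @cLam_compact _ _ W G PG.
  by exists 0%N => _ [m _ <-].
exists w => // m.
have GA : G [set u l | l in [set l | (m <= l)%N]] by exists m.
have [_ [[l /= ml <-] h]] := clw _ _ GA (bal_nbhs m w).
have h2 := hle _ _ ml.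
by rewrite -(bal_eq h2) (bal_eq h); exact: bal_center.
Qed.

End Cosets.

(** * Digit expansions *)

Section Digits.
Variables (R : realType) (F : nonArchLocalFieldType R) (W : vectType F).
Local Notation pi_ := (unif F).
Variables (N : nat) (r : nat -> W).
Hypothesis rL : forall i, (i < N)%N -> cLam (r i).
Hypothesis r_cover : forall x, cLam x -> exists2 i, (i < N)%N & bal 1 (r i) x.
Hypothesis r_inj : forall i j, (i < N)%N -> (j < N)%N -> bal 1 (r i) (r j) -> i = j.

Lemma digits_gt0 : (0 < N)%N.
Proof. by have [[|i]] := r_cover (@cLam0 _ _ W); case: N. Qed.

Definition digit (x : R) : nat := Num.truncn (N%:R * x).
Definition shift (x : R) : R := N%:R * x - (digit x)%:R.

(** The partial sums of the expansion of x in base N, with the digit i read as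
    the representative r i and the base as the uniformizer. *)
Fixpoint expansion (m : nat) (x : R) : W :=
  if m is m'.+1 then r (digit x) + pi_ *: expansion m' (shift x) else 0.

Lemma digit_lt x : 0 <= x < 1 -> (digit x < N)%N.
Proof.
move=> /andP[x0 x1]; rewrite /digit truncn_lt_nat ?mulr_ge0//.
by rewrite gtr_pMr// ltr0n digits_gt0.
Qed.

Lemma shift_itv x : 0 <= x < 1 -> 0 <= shift x < 1.
Proof.
move=> /andP[x0 x1]; rewrite /shift /digit.
have /truncn_itv/andP[h1 h2] : 0 <= N%:R * x :> R by rewrite mulr_ge0.
by rewrite subr_ge0 h1 ltrBlDr -natr1 in h2 *; rewrite addrC.
Qed.

Lemma expansion_cLam m x : 0 <= x < 1 -> cLam (expansion m x).
Proof.
elim: m x => [|m ih] x x01 /=; first exact: cLam0.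
apply: cLamD; first by apply: rL; exact: digit_lt.
by apply: cLamZ; [exact/ltW/unif_lt1|exact/ih/shift_itv].
Qed.

Lemma bal_scale m (u v : W) : bal m.+1 (pi_ *: u) (pi_ *: v) <-> bal m u v.
Proof.
rewrite /bal /= -scalerBr scalerA exprS invfM mulrAC mulVf ?unif_neq0// mul1r.
by [].
Qed.

Lemma bal_add m (w u v : W) : bal m (w + u) (w + v) <-> bal m u v.
Proof. by rewrite /bal /= opprD addrACA subrr add0r. Qed.

Lemma expansion_step m x : 0 <= x < 1 -> bal m (expansion m x) (expansion m.+1 x).
Proof.
elim: m x => [|m ih] x x01.
  by change (bal 0 0 (expansion 1 x)); rewrite bal0; exact: expansion_cLam.
have -> : expansion m.+1 x = r (digit x) + pi_ *: expansion m (shift x) by [].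
have -> : expansion m.+2 x = r (digit x) + pi_ *: expansion m.+1 (shift x) by [].
by apply/bal_add/bal_scale/ih/shift_itv.
Qed.

(** Each ball of radius index m is the value of the m-th partial sum on exactly
    one interval of length N^-m. *)
Lemma expansion_bal m (v : W) : cLam v -> exists c : R,
  [/\ 0 <= c, c + (N%:R ^- m) <= 1 & forall x, 0 <= x < 1 ->
    (bal m v (expansion m x) <-> c <= x < c + (N%:R ^- m))].
Proof.
have N0 : (0 : R) < N%:R by rewrite ltr0n digits_gt0.
elim: m v => [|m ih] v hv.
  exists 0; rewrite expr0 invr1 add0r; split=> // x x01; split=> // _.
  by rewrite /bal /= sub0r expr0 invr1 scale1r; exact: (submodN (latt_submod (cLam_latt W))).
have [i iN hi] := r_cover hv.
have [v' hv' vE] : exists2 v', cLam v' & v = r i + pi_ *: v'.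
  by have /balE[z hz ->] := hi; exists z; rewrite ?expr1.
have [c [c0 c1 hc]] := ih v' hv'.
exists ((i%:R + c) / N%:R); split.
- by rewrite divr_ge0// addr_ge0.
- rewrite exprS invfM mulrC -mulrDr mulrC ler_pdivrMr// mul1r -addrA.
  have : (i.+1)%:R <= N%:R :> R by rewrite ler_nat.
  by rewrite -natr1; lra.
- move=> x x01; have dN := digit_lt x01; have sx := shift_itv x01.
  have -> : expansion m.+1 x = r (digit x) + pi_ *: expansion m (shift x) by [].
  have -> : (i%:R + c) / N%:R + N%:R ^- m.+1 = (i%:R + (c + N%:R ^- m)) / N%:R :> R.
    by rewrite exprS invfM [_^-1 * _]mulrC -mulrDl addrA.
  rewrite ler_pdivrMr// ltr_pdivlMr// vE.
  have xE : x * N%:R = (digit x)%:R + shift x by rewrite /shift addrC subrK mulrC.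
  split=> [h|].
    have di : digit x = i.
      apply/esym/r_inj => //.
      have h1 : bal 1 (r i) (r i + pi_ *: v') by apply/balE; exists v'; rewrite ?expr1.
      have h2 := bal_le (ltn0Sn m) h.
      have h3 : bal 1 (r (digit x)) (r (digit x) + pi_ *: expansion m (shift x)).
        by apply/balE; exists (expansion m (shift x)); rewrite ?expr1//; exact: expansion_cLam.
      rewrite -(bal_eq h1) -(bal_eq h2) (bal_eq h3).
      by exact: bal_center.
    move: h; rewrite di => /bal_add/bal_scale/(hc _ sx).
    by rewrite xE di => /andP[h1 h2]; apply/andP; split; lra.
  rewrite xE => h.
  have di : digit x = i.
    move: h sx => /andP[h1 h2] /andP[h3 h4].
    apply/eqP; rewrite eqn_leq; apply/andP.
    by split; rewrite -ltnS -(ltr_nat R) -natr1; lra.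
  rewrite di; apply/bal_add/bal_scale/(hc _ sx).
  by move: h; rewrite di => /andP[h1 h2]; apply/andP; split; lra.
Qed.

(** The sum of the full expansion of x. *)
Definition digit_point (x : R) : W := if 0 <= x < 1
  then xget 0 [set w | cLam w /\ forall m, bal m (expansion m x) w] else 0.

Lemma digit_pointP x : 0 <= x < 1 ->
  cLam (digit_point x) /\ forall m, bal m (expansion m x) (digit_point x).
Proof.
move=> x01; rewrite /digit_point x01.
have [||w hw1 hw2] := @cLam_complete _ _ _ (expansion^~ x).
- exact: cLam0.
- by move=> m; exact: expansion_step.
apply: (@xgetPex _ 0 [set w | cLam w /\ forall m, bal m (expansion m x) w]).
by exists w.
Qed.

Lemma digit_point_cLam x : cLam (digit_point x).
Proof.
have [/digit_pointP[]//|n] := boolP (0 <= x < 1).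
by rewrite /digit_point (negbTE n); exact: cLam0.
Qed.

Lemma digit_point_bal m (v : W) : cLam v -> exists c : R,
  [/\ 0 <= c, c + (N%:R ^- m) <= 1 & forall x, 0 <= x < 1 ->
    (bal m v (digit_point x) <-> c <= x < c + (N%:R ^- m))].
Proof.
move=> hv; have [c [c0 c1 hc]] := expansion_bal m hv.
exists c; split=> // x x01; have [_ /(_ m) h] := digit_pointP x01.
rewrite -(hc x x01); split=> h2.
  by rewrite -(bal_eq h2) (bal_eq h); exact: bal_center.
by rewrite -(bal_eq h2).
Qed.

(** Thus the digit map carries Lebesgue measure on [0, 1) to a measure on the
    unit lattice that gives all balls of the same radius the same volume. *)
Lemma preimage_digit_point m (v : W) (mu := @lebesgue_measure R) : cLam v ->
  measurable (digit_point @^-1` bal m v : set R) /\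
  mu (digit_point @^-1` bal m v `&` `[0, 1[%classic) = (N%:R ^- m)%:E.
Proof.
move=> hv; have [c [c0 c1 hc]] := digit_point_bal m hv.
have e : digit_point @^-1` bal m v `&` `[0, 1[%classic = `[c, c + N%:R ^- m[%classic.
  apply/seteqP; split=> x /=; rewrite !in_itv /=.
    by move=> [h x01]; apply/hc.
  move=> h; have x01 : 0 <= x < 1.
    by move/andP: h => [h1 h2]; rewrite (le_trans c0 h1) (lt_le_trans h2 c1).
  by split=> //; apply/hc.
split; last first.
  rewrite /mu e lebesgue_measure_itv /= lte_fin ltrDl.
  rewrite invr_gt0 exprn_gt0 ?ltr0n ?digits_gt0// -EFinD.
  by rewrite addrAC subrr add0r.
rewrite -(setIT (digit_point @^-1` bal m v)) -(setUv `[0, 1[%classic) setIUr.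
apply: measurableU; first by rewrite e; exact: measurable_itv.
have [h0|h0] := pselect (bal m v 0).
  rewrite (_ : _ `&` _ = ~` `[0, 1[%classic); first by apply: measurableC; exact: measurable_itv.
  apply/seteqP; split=> x /=; first by case.
  move=> nx; split=> //; rewrite /digit_point.
  by move: nx; rewrite in_itv /= => /negP/negbTE ->.
rewrite (_ : _ `&` _ = set0)//.
apply/seteqP; split=> x //= [+ nx]; rewrite /digit_point.
by move: nx; rewrite in_itv /= => /negP/negbTE ->.
Qed.

End Digits.

(** * Borel sets and balls *)

Section BorelSets.
Variables (R : realType) (F : nonArchLocalFieldType R).
Implicit Types (V W : vectType F).
Local Notation pi_ := (unif F).

Lemma measurable_open W (A : set W) : open (A : set (topvec W)) ->
  measurable (A : set (borel W)).
Proof. exact: sub_sigma_algebra. Qed.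

Lemma measurable_closed W (A : set W) : closed (A : set (topvec W)) ->
  measurable (A : set (borel W)).
Proof.
move=> cA; rewrite -[A]setCK; apply: measurableC; apply: measurable_open.
exact: closed_openC.
Qed.

Lemma measurable_bal W m (v : W) : measurable (bal m v : set (borel W)).
Proof. by apply: measurable_open; exact: bal_open. Qed.

Lemma measurable_latt W (X : set W) : latt X -> measurable (X : set (borel W)).
Proof. by move=> lX; apply: measurable_open; exact: latt_open. Qed.

Lemma measurable_compact W (K : set W) : compact (K : set (topvec W)) ->
  measurable (K : set (borel W)).
Proof. by move=> cK; apply: measurable_closed; apply: compact_closed cK; exact: topvec_hausdorff. Qed.

Definition balls W : set (set W) :=
  [set B | B = set0 \/ exists m v, B = bal m v].

(** Each of the countably many multiples of the unit lattice is compact, hence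
    covered by finitely many balls of a given radius. *)
Lemma ball_centers W m : exists u : nat -> W, forall x, exists i, bal m (u i) x.
Proof.
have h k : exists s : seq W, forall x, cLam (pi_ ^+ k *: x) ->
    exists2 y, y \in s & bal m y x.
  have a0 : pi_ ^- k != 0 by rewrite invr_eq0 unifX_neq0.
  have lX := latt_scale a0 (cLam_latt W).
  have b0 : pi_ ^+ (k + m) != 0 by exact: unifX_neq0.
  have [s [_ hs]] := latt_finite_cover lX b0.
  exists s => x hx; have [|y ys [_ [z hz <-] xE]] := hs x.
    by exists (pi_ ^+ k *: x); rewrite ?scalerK ?unifX_neq0.
  exists y => //; apply/balE; exists z => //.
  by rewrite xE scalerA exprD mulrAC mulfV ?unifX_neq0// mul1r.
have [s hs] := choice h.
exists (fun i => if @unpickle (nat * nat)%type i is Some (k, j) then nth 0 (s k) j else 0).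
move=> x; have [a a0 ha] := cLam_absorb x.
have [k hk] := absv_unifX_small a0.
have hx : cLam (pi_ ^+ k *: x).
  by apply: submod_scale_le ha => //; exact: latt_submod (cLam_latt _).
have [y ys hy] := hs k x hx.
by exists (pickle (k, index y (s k))); rewrite pickleK nth_index.
Qed.

Lemma open_bigcup_balls W (A : set W) : open (A : set (topvec W)) ->
  exists B : nat -> set W, (forall i, balls (B i)) /\ A = \bigcup_i B i.
Proof.
move=> oA; have [u hu] := choice (@ball_centers W).
exists (fun i => if @unpickle (nat * nat)%type i is Some (m, j) then
  if `[< bal m (u m j) `<=` A >] then bal m (u m j) else set0 else set0).
split=> [i|].
  case: (unpickle i) => [[m j]|]; last by left.
  by case: ifP => _; [right; exists m, (u m j)|left].
apply/seteqP; split=> x; last first.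
  move=> [i _]; case: (unpickle i) => [[m j]|//].
  by case: ifPn => // /asboolP h /h.
move=> Ax; have [m hm] : exists m, bal m x `<=` A.
  by apply/nbhs_bal; move: oA; rewrite openE => /(_ x Ax).
have [j hj] := hu m x.
exists (pickle (m, j)) => //; rewrite pickleK asboolT//.
by rewrite -(bal_eq hj).
Qed.

Lemma borel_balls W : @measurable _ (borel W) = <<s @balls W >>.
Proof.
apply/seteqP; split; apply: smallest_sub; try exact: smallest_sigma_algebra.
  move=> A /open_bigcup_balls[B [hB ->]].
  have [_ _] := smallest_sigma_algebra setT (@balls W); apply.
  by move=> i; apply: sub_sigma_algebra; exact: hB.
by move=> A [->|[m [v ->]]]; [exact: measurable0|exact: measurable_bal].
Qed.

Lemma balls_setI W : setI_closed (@balls W).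
Proof.
move=> A B [->|[m [v ->]]]; first by rewrite set0I => _; left.
move=> [->|[l [w ->]]]; first by rewrite setI0; left.
have [[z [zv zw]]|n] := pselect (exists z, bal m v z /\ bal l w z); last first.
  by left; apply/seteqP; split=> z //= [h1 h2]; apply: n; exists z.
right; rewrite -(bal_eq zv) -(bal_eq zw).
have [ml|/ltnW lm] := leqP m l.
  exists l, z; apply/setIidPr; exact: bal_sub (bal_center _ _).
exists m, z; apply/setIidPl; exact: bal_sub (bal_center _ _).
Qed.

(** Two balls are disjoint or nested, so the balls form a pi-system; it
    generates the Borel sets and contains a countable cover of the space. *)
Lemma measure_balls_unique W (h1 h2 : {measure set (borel W) -> \bar R}) :
  (forall m v, h1 (bal m v) = h2 (bal m v)) -> (forall v, h1 (bal 0 v) < +oo)%E ->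
  forall A : set W, measurable (A : set (borel W)) -> h1 A = h2 A.
Proof.
move=> h12 hfin A mA; have [u hu] := @ball_centers W 0.
apply: (@measure_unique _ R (borel W) (@balls W) (fun i => bal 0 (u i))) => //.
- exact: borel_balls.
- exact: balls_setI.
- by move=> i; right; exists 0%N, (u i).
- by apply/seteqP; split=> x // _; have [i hi] := hu x; exists i.
- by move=> _ [->|[m [v ->]]]; rewrite ?measure0.
Qed.

End BorelSets.

(** * Existence of Haar measure *)

Section HaarExistence.
Variables (R : realType) (F : nonArchLocalFieldType R).
Implicit Types (V W : vectType F).
Local Notation pi_ := (unif F).

Lemma pushforward_measure d d' (T1 : measurableType d) (T2 : measurableType d')
    (m : {measure set T1 -> \bar R}) (f : T1 -> T2) : measurable_fun setT f ->
  exists m' : {measure set T2 -> \bar R}, forall A, m' A = m (f @^-1` A).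
Proof.
by move=> mf; exists (@measure_function_pushforward__canonical__measure_function_Measure
  _ _ _ _ _ m f mf).
Qed.

Lemma bal0_latt W m : latt (@bal R F W m 0).
Proof.
have -> : @bal R F W m 0 = [set pi_ ^+ m *: x | x in @cLam R F W].
  apply/seteqP; split=> w; last by move=> [z hz <-]; apply/balE; exists z; rewrite ?add0r.
  by move=> /balE[z hz ->]; exists z; rewrite ?add0r.
by apply: latt_scale (cLam_latt W); exact: unifX_neq0.
Qed.

(** On the unit lattice take the image of Lebesgue measure under the digit
    map. Scaling by pi^-k and multiplying by N^k gives the measure on larger
    and larger lattices, and the measure on W is the sum of its parts on the
    annuli between consecutive lattices. *)
Lemma haar_exists W : exists (h : {measure set (borel W) -> \bar R}) (N : nat),
  (0 < N)%N /\ forall m (v : W), h (bal m v) = (N%:R ^- m)%:E.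
Proof.
have L1 : bal 1 (0 : W) `<=` @cLam R F W by rewrite -bal0; apply: bal_sub; rewrite // bal0; exact: cLam0.
have [s [us sX cs inj_s]] := coset_transversal (cLam_latt W) (bal0_latt W 1) L1.
pose N := size s; pose r i : W := nth 0 s i.
have rL i : (i < N)%N -> cLam (r i) by move=> iN; apply: sX; rewrite mem_nth.
have b1 (x y : W) : bal 1 (0 : W) (x - y) <-> bal 1 y x by rewrite /bal /= subr0.
have r_cover x : cLam x -> exists2 i, (i < N)%N & bal 1 (r i) x.
  move=> /cs[y ys /b1 h]; exists (index y s); first by rewrite index_mem.
  by rewrite /r nth_index.
have r_inj i j : (i < N)%N -> (j < N)%N -> bal 1 (r i) (r j) -> i = j.
  move=> iN jN /b1 h.
  have h2 : nth 0 s j = nth 0 s i by apply: inj_s; [exact: mem_nth|exact: mem_nth|exact: h].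
  by have := nth_uniq 0 jN iN us; rewrite h2 eqxx => /esym/eqP/esym.
have N0 : (0 < N)%N by exact: digits_gt0 r_cover.
pose Phi := digit_point N r.
have PhiL x : cLam (Phi x) by apply: digit_point_cLam.
have preim k m (v : W) : (fun x => pi_ ^- k *: Phi x) @^-1` bal m v =
    Phi @^-1` bal (m + k) (pi_ ^+ k *: v).
  apply/seteqP; split=> x; rewrite /bal /= exprD invfM.
    by move=> h; rewrite -scalerA scalerBr scalerK ?unifX_neq0.
  by rewrite -scalerA scalerBr scalerK ?unifX_neq0.
have preim0 k m (v : W) : ~ cLam (pi_ ^+ k *: v) -> Phi @^-1` bal (m + k) (pi_ ^+ k *: v) = set0.
  move=> nv; apply/seteqP; split=> x //= h; apply: nv.
  have := bal_le (leq0n _) h; rewrite /bal /= expr0 invr1 scale1r => h2.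
  have sc := latt_submod (cLam_latt W).
  by rewrite -(subKr (Phi x) (_ *: v)); apply: (submodB sc).
have mPhi k : measurable_fun [set: measurableTypeR R] (fun x => pi_ ^- k *: Phi x : borel W).
  apply: (@measurability _ _ (measurableTypeR R) (borel W) _ _ _ (borel_balls W)).
  move=> _ [_ [->|[m [v ->]]] <-]; first by rewrite preimage_set0 setI0.
  rewrite setTI preim.
  have [hv|nv] := pselect (cLam (pi_ ^+ k *: v)); last by rewrite preim0.
  by have [] := preimage_digit_point rL r_cover r_inj (m + k) hv.
pose leb := mrestr (@lebesgue_measure R) (measurable_itv `[0%R:R,1%R:R[).
have [mu hmu] := choice (fun k => pushforward_measure leb (mPhi k)).
pose ann k : set W := if k is k'.+1 then
  [set x | cLam (pi_ ^+ k *: x) /\ ~ cLam (pi_ ^+ k' *: x)] else @cLam R F W.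
have mLk k : measurable ([set x : W | cLam (pi_ ^+ k *: x)] : set (borel W)).
  rewrite (_ : [set x | _] = [set pi_ ^- k *: x | x in @cLam R F W]).
    by apply: measurable_latt; apply: latt_scale (cLam_latt W); rewrite invr_eq0 unifX_neq0.
  apply/seteqP; split=> x /=; last by move=> [z hz <-]; rewrite scalerKV ?unifX_neq0.
  by move=> hx; exists (pi_ ^+ k *: x); rewrite ?scalerK ?unifX_neq0.
have mann k : measurable (ann k : set (borel W)).
  case: k => [|k] /=; first by have := mLk 0%N; under eq_set do rewrite expr0 scale1r.
  rewrite (_ : [set x | _] = [set x | cLam (pi_ ^+ k.+1 *: x)] `\` [set x | cLam (pi_ ^+ k *: x)]) //.
  by apply: measurableD; exact: mLk.
have ge0N k : 0 <= (N%:R ^+ k : R) by rewrite exprn_ge0.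
pose nu k : {measure set (borel W) -> \bar R} := mscale (NngNum (ge0N k)) (mrestr (mu k) (mann k)).
have nuE k (A : set W) : nu k A = ((N%:R ^+ k)%:E * mu k (A `&` ann k))%E by [].
exists (mseries nu 0), N; split=> // m v.
have annV k (w : W) : bal m v w -> ann k v -> ann k w.
  have sc := latt_submod (cLam_latt W).
  have key j (x y : W) : bal m x y -> cLam (pi_ ^+ j *: x) -> cLam (pi_ ^+ j *: y).
    move=> /balE[z hz ->] hx; rewrite scalerDr; apply: (submodD sc) => //.
    rewrite scalerA -exprD; apply: cLamZ => //; exact: absv_unif_le1.
  move=> vw; have wv : bal m w v by rewrite (bal_eq vw); exact: bal_center.
  case: k => [|k] /=.
    by have := key 0%N v w vw; rewrite !expr0 !scale1r.
  move=> [h1 h2]; split; first exact: (key _ _ _ vw h1).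
  by move=> h3; apply: h2; exact: (key _ _ _ wv h3).
have sc := latt_submod (cLam_latt W).
have [k0 hk0] : exists k, ann k v.
  have [a a0 ha] := cLam_absorb v.
  have [k hk] := absv_unifX_small a0.
  have hx : cLam (pi_ ^+ k *: v) by apply: submod_scale_le ha.
  elim: k {hk} hx => [|k ih] hx; first by exists 0%N; move: hx; rewrite expr0 scale1r.
  have [/ih//|n] := pselect (cLam (pi_ ^+ k *: v)).
  by exists k.+1.
have ann_mono k l (x : W) : (k < l)%N -> ann k x -> ~ ann l x.
  case: l => // l; rewrite ltnS => kl hk [_]; apply.
  have hk' : cLam (pi_ ^+ k *: x) by case: k hk {kl} => [|k] /=; [rewrite expr0 scale1r|case].
  apply: submod_scale_le hk' => //.
  by rewrite -(subnK kl) exprD absvM ler_piMl ?absv_ge0 ?absv_unif_le1.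
have ann_uniq k l (x : W) : ann k x -> ann l x -> k = l.
  by move=> hk hl; case: (ltngtP k l) => // /ann_mono h; [have := h _ hk|have := h _ hl].
have kv : cLam (pi_ ^+ k0 *: v).
  by case: k0 hk0 => [|k] /=; [rewrite expr0 scale1r|case].
have nu0 : nu k0 (bal m v) = (N%:R ^- m)%:E.
  rewrite nuE setIidl; last by move=> w /annV; exact.
  have lebE : leb (Phi @^-1` bal (m + k0) (pi_ ^+ k0 *: v)) = (N%:R ^- (m + k0))%:E.
    exact: (preimage_digit_point rL r_cover r_inj (m + k0) kv).2.
  have muE : mu k0 (bal m v) = (N%:R ^- (m + k0))%:E.
    by rewrite -lebE -preim; exact: hmu.
  rewrite muE.
  rewrite -EFinM exprD invfM mulrCA mulfV ?mulr1// expf_neq0// pnatr_eq0 -lt0n.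
  exact: N0.
transitivity (nu k0 (bal m v) + \sum_(0 <= k <oo | k != k0) nu k (bal m v))%E.
  exact: (@nneseriesD1 _ (fun k => nu k (bal m v)) k0 xpredT (fun k _ => measure_ge0 (nu k) _) isT).
rewrite [X in (_ + X)%E]eseries0 ?adde0// => k _ /= kk0.
rewrite nuE (_ : _ `&` _ = set0) ?measure0 ?mule0//.
apply/seteqP; split=> w //= [bw aw].
move/eqP: kk0; apply; apply: (ann_uniq _ _ w) => //.
exact: annV bw hk0.
Qed.

End HaarExistence.

(** * Translation invariant measures *)

Section HaarUniqueness.
Variables (R : realType) (F : nonArchLocalFieldType R).
Implicit Types (V W : vectType F).

Definition translation_invariant W (h : {measure set (borel W) -> \bar R}) :=
  forall (v : W) (A : set W), measurable (A : set (borel W)) ->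
    h [set v + w | w in A] = h A.

Lemma translateE W (v : W) (A : set W) :
  [set v + w | w in A] = (fun w => w - v) @^-1` A.
Proof.
apply/seteqP; split=> w /=; first by move=> [z Az <-]; rewrite addrC addKr.
by move=> Aw; exists (w - v); rewrite // addrC subrK.
Qed.

Lemma translate_bal W (v w : W) m : [set v + u | u in bal m w] = bal m (v + w).
Proof.
rewrite translateE; apply/seteqP; split=> u; rewrite /bal /= opprD addrA;
  by rewrite [u - v]addrC // addrC.
Qed.

Lemma continuous_measurable_vec V W (f : V -> W) :
  (forall m (v : W) (x : V), bal m v (f x) -> exists l, forall y, bal l x y -> bal m v (f y)) ->
  measurable_fun setT (f : borel V -> borel W).
Proof.
move=> hf; apply: (@measurability _ _ (borel V) (borel W) _ _ _ (borel_balls W)).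
move=> _ [_ [->|[m [v ->]]] <-]; first by rewrite preimage_set0 setI0.
rewrite setTI; apply: measurable_open; rewrite openE => x /= /hf[l hl].
by apply/nbhs_bal; exists l.
Qed.

Lemma measurable_translationE W (v : W) : measurable_fun setT ((fun w => w - v) : borel W -> borel W).
Proof.
apply: continuous_measurable_vec => m w x h; exists m => y hy.
by rewrite -(bal_eq h) ![_ - v]addrC; apply/bal_add; exact: hy.
Qed.

Lemma measurable_translate W (v : W) (A : set W) : measurable (A : set (borel W)) ->
  measurable ([set v + w | w in A] : set (borel W)).
Proof.
move=> mA; rewrite translateE.
by have := measurable_translationE v measurableT mA; rewrite setTI.
Qed.

Lemma tinv_bal W (h : {measure set (borel W) -> \bar R}) m (v : W) :
  translation_invariant h -> h (bal m v) = h (bal m 0).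
Proof.
move=> th; rewrite -[in LHS](addr0 v) -translate_bal th//; exact: measurable_bal.
Qed.

(** The cosets of Z through the points of s are disjoint translates of Z. *)
Lemma tinv_cosets W (h : {measure set (borel W) -> \bar R}) (Z : set W) (s : seq W) :
  submod Z -> measurable (Z : set (borel W)) -> translation_invariant h -> uniq s ->
  (forall x y, x \in s -> y \in s -> Z (x - y) -> x = y) ->
  measurable ([set x | exists2 y, y \in s & Z (x - y)] : set (borel W)) /\
  h [set x | exists2 y, y \in s & Z (x - y)] = ((size s)%:R%:E * h Z)%E.
Proof.
move=> sZ mZ th us inj_s.
elim: s us inj_s => [|a s ih] us inj_s.
  rewrite (_ : [set x | _] = set0); first by rewrite measure0 mul0e; split.
  by apply/seteqP; split=> x //= [].
have [|m1 m2] := ih (proj2 (andP us)).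
  by move=> x y xs ys; apply: inj_s; rewrite inE (xs, ys) orbT.
have -> : [set x | exists2 y, y \in a :: s & Z (x - y)] =
    [set a + w | w in Z] `|` [set x | exists2 y, y \in s & Z (x - y)].
  apply/seteqP; split=> x /=.
    move=> [y]; rewrite inE => /orP[/eqP->|ys] h1; last by right; exists y.
    by left; exists (x - a); rewrite // addrC subrK.
  move=> [[w Zw <-]|[y ys h1]]; last by exists y => //; rewrite inE ys orbT.
  by exists a; [rewrite inE eqxx|rewrite addrC addKr].
split; first by apply: measurableU => //; exact: measurable_translate.
rewrite measureU//; last first.
- apply/seteqP; split=> x //= -[[w Zw <-] [y ys h1]].
  have : a = y.
    apply: inj_s; rewrite ?inE ?eqxx ?ys ?orbT//.
    rewrite -(addrK w a) addrAC; apply: submodB => //.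
  by move=> ay; move: us; rewrite /= ay ys.
- exact: measurable_translate.
have h1 := th a Z mZ.
transitivity (h Z + (size s)%:R%:E * h Z)%E; first by congr (_ + _)%E.
by rewrite /= -natr1 addrC EFinD ge0_muleDl ?lee_fin// mul1e.
Qed.

Lemma coset_count W (X Z : set W) : latt X -> latt Z -> Z `<=` X ->
  exists2 p : nat, (0 < p)%N & forall h : {measure set (borel W) -> \bar R},
    translation_invariant h -> h X = (p%:R%:E * h Z)%E.
Proof.
move=> lX lZ ZX; have [s [us sX cs inj_s]] := coset_transversal lX lZ ZX.
have sZ := latt_submod lZ.
exists (size s).
  have [|y ys _] := cs 0; first by case: (latt_submod lX).
  by case: s ys {us sX cs inj_s}.
move=> h th; have [_ <-] := tinv_cosets sZ (measurable_latt lZ) th us inj_s.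
congr (h _); apply/seteqP; split=> x /=.
  by move=> /cs[y ys hy]; exists y.
move=> [y ys hy]; rewrite -(subrK y x); apply: submodD; first exact: latt_submod.
  exact: ZX.
exact: sX.
Qed.

Definition stdh W : {measure set (borel W) -> \bar R} := sval (cid (haar_exists W)).

Lemma stdh_bal W : exists2 N : nat, (0 < N)%N &
  forall m (v : W), stdh W (bal m v) = (N%:R ^- m)%:E.
Proof. by rewrite /stdh; case: cid => h [N [N0 hN]]; exists N. Qed.

Lemma stdh_cLam W : stdh W (@cLam R F W) = 1%E.
Proof. by have [N N0 h] := stdh_bal W; rewrite -bal0 h expr0 invr1. Qed.

Lemma stdh_tinv W : translation_invariant (stdh W).
Proof.
move=> v A mA; have [N N0 hN] := stdh_bal W.
have [h' hh'] := pushforward_measure (stdh W) (measurable_translationE v).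
rewrite translateE -hh'; apply: measure_balls_unique => // [m w|w].
  by rewrite hh' -translateE translate_bal !hN.
by rewrite hh' -translateE translate_bal hN ltry.
Qed.

(** Each of the two measures gives a ball the same fraction of the unit
    lattice, the inverse of the number of cosets, and balls determine the
    measure. *)
Lemma tinv_unique W (h : {measure set (borel W) -> \bar R}) :
  translation_invariant h -> (h (@cLam R F W) < +oo)%E ->
  forall A : set W, measurable (A : set (borel W)) ->
    h A = ((fine (h (@cLam R F W)))%:E * stdh W A)%E.
Proof.
move=> th hfin A mA.
have ge0 : 0 <= fine (h (@cLam R F W)) by rewrite fine_ge0// measure_ge0.
pose h2 : {measure set (borel W) -> \bar R} := mscale (NngNum ge0) (stdh W).
have hE : h (@cLam R F W) = (fine (h (@cLam R F W)))%:E.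
  by rewrite fineK// ge0_fin_numE// measure_ge0.
have -> : ((fine (h (@cLam R F W)))%:E * stdh W A)%E = h2 A by [].
apply: measure_balls_unique => // [m v|v]; last by rewrite tinv_bal// bal0.
have -> : h2 (bal m v) = ((fine (h (@cLam R F W)))%:E * stdh W (bal m v))%E by [].
have L1 : bal m (0 : W) `<=` @cLam R F W by rewrite -bal0; apply: bal_sub; rewrite // bal0; exact: cLam0.
have [p p0 hp] := coset_count (cLam_latt W) (bal0_latt W m) L1.
rewrite !tinv_bal//; try exact: stdh_tinv.
have h1 := hp _ th; have hs := hp _ (@stdh_tinv W).
have pn : p%:R != 0 :> R by rewrite pnatr_eq0 -lt0n.
have [N N0 hN] := stdh_bal W.
rewrite stdh_cLam hN in hs *; rewrite h1.
have fb : h (bal m 0) \is a fin_num.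
  rewrite ge0_fin_numE ?measure_ge0//; apply: le_lt_trans hfin.
  by apply: le_measure => //; rewrite inE; [exact: measurable_bal|exact: measurable_latt (cLam_latt W)].
move: hs; rewrite -EFinM => -[hs].
rewrite -(fineK fb) -!EFinM /=; congr EFin.
by rewrite mulrAC -hs mul1r.
Qed.

End HaarUniqueness.

(** * Relative volumes *)

Definition mklin (K : fieldType) (V W : vectType K) (f : V -> W) (lf : linear f) :
  'Hom(V, W) := linfun (HB.pack f (GRing.isLinear.Build K V W _ f lf) : {linear V -> W}).

Lemma mklinE (K : fieldType) (V W : vectType K) (f : V -> W) (lf : linear f) x :
  mklin lf x = f x.
Proof. by rewrite lfunE. Qed.

Section Volume.
Variables (R : realType) (F : nonArchLocalFieldType R).
Implicit Types (V W : vectType F).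
Local Notation pi_ := (unif F).

Lemma latt_ball W (X : set W) : latt X -> exists m, bal m 0 `<=` X.
Proof.
move=> lX; apply/nbhs_bal; have := latt_open lX; rewrite openE; apply.
by case: (latt_submod lX).
Qed.

Lemma stdh_latt W (X : set W) : latt X -> exists2 r : R, 0 < r & stdh W X = r%:E.
Proof.
move=> lX; have [m mX] := latt_ball lX.
have [p p0 hp] := coset_count lX (bal0_latt W m) mX.
have [N N0 hN] := stdh_bal W.
exists (p%:R * N%:R ^- m).
  by rewrite mulr_gt0 ?ltr0n// invr_gt0 exprn_gt0// ltr0n.
by rewrite (hp _ (@stdh_tinv _ _ W)) hN EFinM.
Qed.

Definition bnd W (A : set W) := exists k, forall x, A x -> cLam (pi_ ^+ k *: x).

Lemma bnd_sub W (A B : set W) : A `<=` B -> bnd B -> bnd A.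
Proof. by move=> AB [k hk]; exists k => x /AB/hk. Qed.

Lemma bnd_latt W (X : set W) : latt X -> bnd X.
Proof.
move=> [_ [a a0 ha] _]; have [k hk] := absv_unifX_small a0.
by exists k => x /ha; apply: submod_scale_le => //; exact: latt_submod (cLam_latt W).
Qed.

Lemma scaled_latt W k : latt [set x : W | cLam (pi_ ^+ k *: x)].
Proof.
rewrite (_ : [set x | _] = [set pi_ ^- k *: x | x in @cLam R F W]).
  by apply: latt_scale (cLam_latt W); rewrite invr_eq0 unifX_neq0.
apply/seteqP; split=> x /=; last by move=> [z hz <-]; rewrite scalerKV ?unifX_neq0.
by move=> hx; exists (pi_ ^+ k *: x); rewrite ?scalerK ?unifX_neq0.
Qed.

(** The relatively compact sets are those contained in a multiple of the unit
    lattice. *)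
Lemma bounded_borelE W (A : set W) :
  bounded_borel A <-> measurable (A : set (borel W)) /\ bnd A.
Proof.
split=> -[mA]; split=> //.
  have [U AU [cU _]] := b; have [k hk] := compact_in_multiple cU.
  by exists k => x Ax; apply: hk; exact: AU.
have [k hk] := b; exists [set x : W | cLam (pi_ ^+ k *: x)]; first by move=> x /hk.
by split; [apply: latt_compact|apply: latt_closed]; exact: scaled_latt.
Qed.

Lemma bounded_borel_latt W (X : set W) : latt X -> bounded_borel X.
Proof. by move=> lX; apply/bounded_borelE; split; [exact: measurable_latt|exact: bnd_latt]. Qed.

(** Like the elements of D(W), this function is 0 by convention on the sets
    that are not relatively compact Borel sets. *)
Definition vol0 W (A : set W) : R :=
  if `[< bounded_borel A >] then fine (stdh W A) else 0.

Lemma vol0_ge0 W (A : set W) : 0 <= vol0 A.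
Proof. by rewrite /vol0; case: ifP => // _; rewrite fine_ge0// measure_ge0. Qed.

Lemma stdh_vol0 W (A : set W) : bounded_borel A -> stdh W A = (vol0 A)%:E.
Proof.
move=> bA; rewrite /vol0 asboolT// fineK//.
have /bounded_borelE[mA [k hk]] := bA.
have [r r0 hr] := stdh_latt (scaled_latt W k).
rewrite ge0_fin_numE ?measure_ge0//; apply: (@le_lt_trans _ _ r%:E); last exact: ltry.
rewrite -hr; apply: le_measure; rewrite ?inE//.
by apply: measurable_latt; exact: scaled_latt.
Qed.

Lemma vol0_latt W (X : set W) : latt X -> 0 < vol0 X.
Proof.
move=> lX; have [r r0 hr] := stdh_latt lX.
by have := stdh_vol0 (bounded_borel_latt lX); rewrite hr => -[<-].
Qed.

Lemma is_haar_stdh W : is_haar (stdh W).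
Proof.
split; first exact: stdh_tinv.
- move=> K cK; have [k hk] := compact_in_multiple cK.
  have [r r0 hr] := stdh_latt (scaled_latt W k).
  apply: (@le_lt_trans _ _ r%:E); last exact: ltry.
  rewrite -hr; apply: le_measure; rewrite ?inE//; first exact: measurable_compact.
  by apply: measurable_latt; exact: scaled_latt.
- apply/eqP => h0.
  have : (stdh W (@cLam R F W) <= stdh W setT)%E.
    apply: le_measure; rewrite ?inE//; exact: measurable_latt (cLam_latt W).
  by rewrite h0 stdh_cLam lee_fin ler10.
Qed.

Lemma is_haar_unique W (h : {measure set (borel W) -> \bar R}) : is_haar h ->
  exists2 c : R, 0 < c & forall A : set W, measurable (A : set (borel W)) ->
    h A = (c%:E * stdh W A)%E.
Proof.
move=> [th fh h0].
have hf : (h (@cLam R F W) < +oo)%E by apply: fh; exact: cLam_compact.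
have hu := tinv_unique th hf.
exists (fine (h (@cLam R F W))) => //.
rewrite lt_neqAle fine_ge0 ?measure_ge0// andbT; apply/eqP => c0.
move/eqP: h0; apply; apply/eqP; rewrite hu; last exact: measurableT.
by rewrite -c0 mul0e.
Qed.

(** Uniqueness of Haar measure makes D(W) the line spanned by vol0. *)
Lemma haar_spaceE W (mu : set W -> R[i]) :
  haar_space mu <-> exists c : R[i], forall A, mu A = c * (vol0 A)%:C.
Proof.
split=> [[c [h [hh hmu]]]|[c hc]].
  have [d d0 hd] := is_haar_unique hh.
  exists (c * d%:C) => A; rewrite hmu.
  case: asboolP => bA; last by rewrite /vol0 asboolF// mulr0.
  have mA : measurable (A : set (borel W)) by case: bA.
  by rewrite hd// stdh_vol0// -EFinM /= rmorphM mulrA.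
exists c, (stdh W); split=> [|A]; first exact: is_haar_stdh.
by rewrite hc /vol0; case: asboolP => // _; rewrite mulr0.
Qed.

(** The volume of A for the Haar measure that gives X the volume 1. *)
Definition vol W (X A : set W) : R := vol0 A / vol0 X.

Lemma haar1E W (X A : set W) : latt X -> haar1 X A = (vol X A)%:C.
Proof.
move=> lX; have X0 := vol0_latt lX.
have X0C : (vol0 X)%:C != 0 :> R[i] by rewrite fmorph_eq0 gt_eqF.
have ex : [set mu | haar_space mu /\ mu X = 1] (fun A => (vol X A)%:C).
  split; first by apply/haar_spaceE; exists (vol0 X)%:C^-1 => B; rewrite /vol rmorphM fmorphV mulrC.
  by rewrite /vol divff// gt_eqF.
have [/haar_spaceE[c hc] h1] := @xgetPex _ (fun=> 0) [set mu | haar_space mu /\ mu X = 1] (ex_intro _ _ ex).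
rewrite /haar1 hc /vol rmorphM fmorphV mulrC; congr (_ * _).
by apply: (mulIf X0C); rewrite mulVf// -hc.
Qed.

Lemma vol_ge0 W (X A : set W) : 0 <= vol X A.
Proof. by rewrite divr_ge0 ?vol0_ge0. Qed.

Lemma vol_self W (X : set W) : latt X -> vol X X = 1.
Proof. by move=> lX; rewrite /vol divff// gt_eqF// vol0_latt. Qed.

Lemma vol_trans W (X Y A : set W) : latt Y -> vol X A = vol X Y * vol Y A.
Proof. by move=> lY; rewrite /vol [RHS]mulrC mulrA mulfVK// gt_eqF// vol0_latt. Qed.

Lemma vol_gt0 W (X Y : set W) : latt X -> latt Y -> 0 < vol X Y.
Proof. by move=> lX lY; rewrite divr_gt0 ?vol0_latt. Qed.

Lemma vol0_le W (A B : set W) : bounded_borel B -> A `<=` B -> vol0 A <= vol0 B.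
Proof.
move=> bB AB; rewrite /vol0 (asboolT bB).
case: asboolP => bA; last by rewrite fine_ge0// measure_ge0.
have h : (stdh W A <= stdh W B)%E.
  by have [mA _] := bA; have [mB _] := bB; apply: le_measure; rewrite ?inE.
by move: h; rewrite !stdh_vol0.
Qed.

Lemma vol_le W (X A B : set W) : latt B -> A `<=` B -> vol X A <= vol X B.
Proof.
move=> lB AB; rewrite /vol ler_wpM2r ?invr_ge0 ?vol0_ge0// vol0_le//.
exact: bounded_borel_latt.
Qed.

Lemma vol_le1 W (X A : set W) : latt X -> A `<=` X -> vol X A <= 1.
Proof. by move=> lX AX; rewrite -(vol_self lX); exact: vol_le. Qed.

Lemma measurable_lin V W (T : 'Hom(V, W)) : measurable_fun setT (T : borel V -> borel W).
Proof.
apply: continuous_measurable_vec => m v x h.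
have [a a0 ha] := lin_bounded T.
have b0 : pi_ ^+ m * a != 0 by rewrite mulf_neq0 ?unifX_neq0.
have [l hl] := absv_unifX_small b0.
exists l => y hy; rewrite -(bal_eq h).
move: hy; rewrite /bal /= -linearB => hy.
have : cLam (a *: T (pi_ ^- l *: (y - x))) by exact: ha.
rewrite linearZ /= scalerA; apply: submod_scale_le; first exact: latt_submod (cLam_latt W).
rewrite absvM !absvV ler_pdivlMr ?absv_gt0 ?unifX_neq0//.
rewrite ler_pdivrMl ?absv_gt0 ?unifX_neq0//.
by move: hl; rewrite absvM.
Qed.

Lemma bnd_lin V W (T : 'Hom(V, W)) (A : set V) : bnd A -> bnd (T @` A).
Proof.
move=> [k hk]; have [a a0 ha] := latt_lin T (scaled_latt V k) (cLam_latt W).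
have [l hl] := absv_unifX_small a0.
exists l => _ [x Ax <-]; have := ha x (hk x Ax).
by apply: submod_scale_le => //; exact: latt_submod (cLam_latt W).
Qed.

Lemma image_iso V W (T : 'Hom(V, W)) (A : set V) : lker T == 0%VS -> limg T = fullv ->
  T @` A = (T^-1)%VF @^-1` A.
Proof.
move=> iT sT; apply/seteqP; split=> x /=.
  by move=> [y Ay <-]; rewrite lker0_lfunK.
by move=> Ax; exists ((T^-1)%VF x); rewrite // limg_lfunVK// sT memvf.
Qed.

Lemma bounded_borel_iso V W (T : 'Hom(V, W)) (A : set V) : lker T == 0%VS ->
  limg T = fullv -> bounded_borel (T @` A) <-> bounded_borel A.
Proof.
move=> iT sT; rewrite !bounded_borelE; split=> -[mA bA]; split.
- rewrite (_ : A = T @^-1` (T @` A)).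
    by have := measurable_lin T measurableT mA; rewrite setTI.
  apply/seteqP; split=> x /=; first by exists x.
  by move=> [y Ay /(lker0P iT) <-].
- apply: bnd_sub (bnd_lin (T^-1)%VF bA) => x Ax.
  by exists (T x); [exists x|rewrite lker0_lfunK].
- rewrite image_iso//.
  by have := measurable_lin (T^-1)%VF measurableT mA; rewrite setTI.
- exact: bnd_lin.
Qed.

(** The measure of T(A) is translation invariant in A. *)
Lemma vol0_iso V W (T : 'Hom(V, W)) : lker T == 0%VS -> limg T = fullv ->
  exists2 c : R, 0 < c & forall A, vol0 (T @` A) = c * vol0 A.
Proof.
move=> iT sT.
have [h hh] := pushforward_measure (stdh W) (measurable_lin (T^-1)%VF).
have hE (A : set V) : h A = stdh W (T @` A) by rewrite hh image_iso.
have lT : latt (T @` @cLam R F V) by apply: latt_img => //; exact: cLam_latt.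
have th : translation_invariant h.
  move=> v A mA; rewrite !hE.
  have -> : T @` [set v + w | w in A] = [set T v + w | w in T @` A].
    apply/seteqP; split=> x /=.
      by move=> [_ [y Ay <-] <-]; exists (T y); [exists y|rewrite linearD].
    by move=> [_ [y Ay <-] <-]; exists (v + y); [exists y|rewrite linearD].
  apply: stdh_tinv; rewrite image_iso//.
  by have := measurable_lin (T^-1)%VF measurableT mA; rewrite setTI.
have [r r0 hr] := stdh_latt lT.
have hf : (h (@cLam R F V) < +oo)%E by rewrite hE hr ltry.
exists r => // A; rewrite {1}/vol0.
case: asboolP => bA; last first.
  by rewrite /vol0 asboolF ?mulr0// -(bounded_borel_iso A iT sT).
move/(bounded_borel_iso A iT sT): bA => bA.
rewrite -hE (tinv_unique th hf) ?hE ?hr//; last by case: bA.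
by rewrite stdh_vol0.
Qed.

Lemma vol_iso V W (T : 'Hom(V, W)) (X A : set V) : lker T == 0%VS -> limg T = fullv ->
  vol (T @` X) (T @` A) = vol X A.
Proof.
move=> iT sT; have [c c0 hc] := vol0_iso iT sT.
by rewrite /vol !hc invfM mulrACA divff ?mul1r// gt_eqF.
Qed.

End Volume.

(** * Volumes in a product *)

Section ProductVolume.
Variables (R : realType) (F : nonArchLocalFieldType R).
Variables (W1 W2 : vectType F).
Local Notation WW := ((W1 * W2)%type : vectType F).

Definition lin_fst : 'Hom(WW, W1) := linfun (fst : WW -> W1).
Definition lin_snd : 'Hom(WW, W2) := linfun (snd : WW -> W2).
Let inl_linear : linear (fun w : W1 => (w, 0) : WW).
Proof. by move=> a u v; congr pair; rewrite /= scaler0 addr0. Qed.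

Let inr_linear : linear (fun w : W2 => (0, w) : WW).
Proof. by move=> a u v; congr pair; rewrite /= scaler0 addr0. Qed.

Definition lin_inl : 'Hom(W1, WW) := mklin inl_linear.
Definition lin_inr : 'Hom(W2, WW) := mklin inr_linear.

Lemma lin_fstE x : lin_fst x = x.1. Proof. by rewrite lfunE. Qed.
Lemma lin_sndE x : lin_snd x = x.2. Proof. by rewrite lfunE. Qed.
Lemma lin_inlE x : lin_inl x = (x, 0). Proof. by rewrite mklinE. Qed.
Lemma lin_inrE x : lin_inr x = (0, x). Proof. by rewrite mklinE. Qed.

Lemma latt_prod (X : set W1) (Y : set W2) : latt X -> latt Y -> latt (X `*` Y : set WW).
Proof.
move=> lX lY; have sX := latt_submod lX; have sY := latt_submod lY.
have [X0 XD XZ] := sX; have [Y0 YD YZ] := sY; split.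
- split; first by split.
  + by move=> u v [/= Xu Yu] [/= Xv Yv]; split => /=; [exact: XD|exact: YD].
  + by move=> a u ha [/= Xu Yu]; split => /=; [exact: XZ|exact: YZ].
- have [a a0 ha] := latt_lin lin_inl lX (cLam_latt WW).
  have [b b0 hb] := latt_lin lin_inr lY (cLam_latt WW).
  have sc := latt_submod (cLam_latt WW).
  have ab : exists2 c : F, c != 0 & absv c <= absv a /\ absv c <= absv b.
    have [|ba] := leP (absv a) (absv b); first by exists a.
    by exists b => //; rewrite lexx ltW.
  have [c c0 [ca cb]] := ab.
  exists c => // -[x y] [/= Xx Yy].
  have -> : c *: ((x, y) : WW) = c *: lin_inl x + c *: lin_inr y.
    rewrite lin_inlE lin_inrE -scalerDr; congr (_ *: _).
    by congr pair; rewrite /= ?addr0 ?add0r.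
  by apply: (submodD sc); [apply: submod_scale_le (ha x Xx)|apply: submod_scale_le (hb y Yy)].
- have [a a0 ha] := latt_lin lin_fst (cLam_latt WW) lX.
  have [b b0 hb] := latt_lin lin_snd (cLam_latt WW) lY.
  have ab : exists2 c : F, c != 0 & absv c <= absv a /\ absv c <= absv b.
    have [|ba] := leP (absv a) (absv b); first by exists a.
    by exists b => //; rewrite lexx ltW.
  have [c c0 [ca cb]] := ab.
  exists c => // x hx; have hX := ha x hx; have hY := hb x hx.
  rewrite lin_fstE in hX; rewrite lin_sndE in hY.
  by split => /=; [apply: submod_scale_le hX|apply: submod_scale_le hY].
Qed.

Lemma measurable_setX_borel (A : set W1) (B : set W2) :
  measurable (A : set (borel W1)) -> measurable (B : set (borel W2)) ->
  measurable (A `*` B : set (borel WW)).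
Proof.
move=> mA mB; rewrite (_ : A `*` B = (lin_fst @^-1` A) `&` (lin_snd @^-1` B)); last first.
  by apply/seteqP; split=> -[x y]; rewrite /= lin_fstE lin_sndE.
apply: measurableI.
  by have := measurable_lin lin_fst measurableT mA; rewrite setTI.
by have := measurable_lin lin_snd measurableT mB; rewrite setTI.
Qed.

Lemma bounded_borel_setX (A : set W1) (B : set W2) :
  bounded_borel A -> bounded_borel B -> bounded_borel (A `*` B : set WW).
Proof.
move=> /bounded_borelE[mA [k hk]] /bounded_borelE[mB [l hl]].
apply/bounded_borelE; split; first exact: measurable_setX_borel.
apply: bnd_sub (bnd_latt (latt_prod (scaled_latt W1 k) (scaled_latt W2 l))).
by move=> [x y] [/= /hk ? /hl ?].
Qed.

(** With one factor fixed, the measure of a box is translation invariant in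
    the other. *)
Lemma vol0_setX : exists2 c : R, 0 < c & forall (A : set W1) (B : set W2),
  bounded_borel A -> bounded_borel B -> vol0 (A `*` B : set WW) = c * (vol0 A * vol0 B).
Proof.
have mT1 : measurable (setT : set (borel W1)) by exact: measurableT.
have mT2 : measurable (setT : set (borel W2)) by exact: measurableT.
have bL1 := bounded_borel_latt (cLam_latt W1).
have bL2 := bounded_borel_latt (cLam_latt W2).
have v1 : vol0 (@cLam R F W1) = 1 by have := stdh_vol0 bL1; rewrite stdh_cLam => -[].
have v2 : vol0 (@cLam R F W2) = 1 by have := stdh_vol0 bL2; rewrite stdh_cLam => -[].
have step1 (A : set W1) (B : set W2) : bounded_borel A -> bounded_borel B ->
    vol0 (A `*` B : set WW) = vol0 (@cLam R F W1 `*` B : set WW) * vol0 A.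
  move=> bA bB; have [mA _] := bA; have [mB _] := bB.
  have mD : measurable (setT `*` B : set (borel WW)) by exact: measurable_setX_borel.
  have [h hh] := pushforward_measure (mrestr (stdh WW) mD) (measurable_lin lin_fst).
  have hE (C : set W1) : h C = stdh WW (C `*` B).
    rewrite hh; congr (stdh WW _); apply/seteqP; split=> -[x y] /=; rewrite lin_fstE /=.
      by move=> [Cx [_ By]].
    by move=> [Cx By].
  have th : translation_invariant h.
    move=> v C mC; rewrite !hE.
    have -> : [set v + w | w in C] `*` B = [set ((v, 0) : WW) + w | w in C `*` B].
      apply/seteqP; split=> -[x y] /=.
        by move=> [[w Cw <-] By]; exists (w, y) => //; congr pair; rewrite add0r.
      by move=> [[w z] [/= Cw Bz] [<- <-]]; split=> /=; [exists w|rewrite add0r].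
    by apply: stdh_tinv; exact: measurable_setX_borel.
  have bLB := bounded_borel_setX bL1 bB.
  have hf : (h (@cLam R F W1) < +oo)%E by rewrite hE stdh_vol0// ltry.
  have := tinv_unique th hf mA; rewrite !hE !stdh_vol0//; last exact: bounded_borel_setX.
  by move=> -[].
have step2 (B : set W2) : bounded_borel B ->
    vol0 (@cLam R F W1 `*` B : set WW) = vol0 (@cLam R F W1 `*` @cLam R F W2 : set WW) * vol0 B.
  move=> bB; have [mB _] := bB; have [mA _] := bL1.
  have mD : measurable (@cLam R F W1 `*` setT : set (borel WW)) by exact: measurable_setX_borel.
  have [h hh] := pushforward_measure (mrestr (stdh WW) mD) (measurable_lin lin_snd).
  have hE (C : set W2) : h C = stdh WW (@cLam R F W1 `*` C).
    rewrite hh; congr (stdh WW _); apply/seteqP; split=> -[x y] /=; rewrite lin_sndE /=.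
      by move=> [Cx [By _]].
    by move=> [Cx By].
  have th : translation_invariant h.
    move=> v C mC; rewrite !hE.
    have -> : @cLam R F W1 `*` [set v + w | w in C] =
        [set ((0, v) : WW) + w | w in @cLam R F W1 `*` C].
      apply/seteqP; split=> -[x y] /=.
        by move=> [Lx [w Cw <-]]; exists (x, w) => //; congr pair; rewrite add0r.
      by move=> [[w z] [/= Cw Bz] [<- <-]]; split=> /=; [rewrite add0r|exists z].
    by apply: stdh_tinv; exact: measurable_setX_borel.
  have bLB := bounded_borel_setX bL1 bL2.
  have hf : (h (@cLam R F W2) < +oo)%E by rewrite hE stdh_vol0// ltry.
  have := tinv_unique th hf mB; rewrite !hE !stdh_vol0//; last exact: bounded_borel_setX.
  by move=> -[].
exists (vol0 (@cLam R F W1 `*` @cLam R F W2 : set WW)).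
  by apply: vol0_latt; apply: latt_prod; exact: cLam_latt.
by move=> A B bA bB; rewrite step1// step2// -mulrA [vol0 B * _]mulrC.
Qed.

Lemma vol_setX (X : set W1) (Y : set W2) (A : set W1) (B : set W2) :
  latt X -> latt Y -> bounded_borel A -> bounded_borel B ->
  vol (X `*` Y : set WW) (A `*` B) = vol X A * vol Y B.
Proof.
move=> lX lY bA bB; have [c c0 hc] := vol0_setX.
rewrite /vol !hc//; try exact: bounded_borel_latt.
by rewrite invfM mulrACA divff ?mul1r ?gt_eqF// invfM mulrACA.
Qed.

(** The Haar measures of the product are proportional, so the value on the box
    of X and Y determines the product measure. *)
Lemma box_measureE (X : set W1) (Y : set W2) : latt X -> latt Y ->
  box_measure (haar1 X) (haar1 Y) = (fun A => (vol (X `*` Y : set WW) A)%:C).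
Proof.
move=> lX lY; have lXY := latt_prod lX lY.
pose P := [set rho : set (W1 * W2)%type -> R[i] | haar_space rho /\
    forall A B, bounded_borel A -> bounded_borel B ->
      rho (A `*` B) = haar1 X A * haar1 Y B].
have ex : P (fun A => (vol (X `*` Y : set WW) A)%:C).
  split; first by apply/haar_spaceE; exists (vol0 (X `*` Y : set WW))%:C^-1 => B; rewrite /vol rmorphM fmorphV mulrC.
  by move=> A B bA bB; rewrite !haar1E// -rmorphM vol_setX.
have [/haar_spaceE[c hc] h1] := @xgetPex _ (fun=> 0) P (ex_intro _ _ ex).
apply/funext => A; rewrite /box_measure -/P hc.
have := h1 _ _ (bounded_borel_latt lX) (bounded_borel_latt lY).
rewrite hc !haar1E// !vol_self// mulr1 => h2.
have X0 := vol0_latt lXY.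
have X0C : (vol0 (X `*` Y : set WW))%:C != 0 :> R[i] by rewrite fmorph_eq0 gt_eqF.
rewrite /vol rmorphM fmorphV mulrC; congr (_ * _).
by apply: (mulIf X0C); rewrite mulVf.
Qed.

(** Representatives of the first projection of Z modulo the vectors w with (w,
    0) in Z lift to representatives of Z modulo the product of its two fibres.
    So both sides count the same cosets. *)
Lemma vol_fibration (X : set W1) (Y : set W2) (Z : set WW) :
  latt X -> latt Y -> latt Z ->
  vol (X `*` Y : set WW) Z = vol X (fst @` Z) * vol Y [set w | Z (0, w)].
Proof.
move=> lX lY lZ; have sZ := latt_submod lZ.
have fT : limg lin_fst = fullv.
  apply/eqP; rewrite eqEsubv subvf /=; apply/subvP => x _; apply/memv_imgP.
  by exists (x, 0); rewrite ?memvf// lin_fstE.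
have lZ1 : latt (fst @` Z : set W1).
  rewrite (_ : fst @` Z = lin_fst @` Z); first exact: latt_img.
  by apply: eq_imagel => x _; rewrite lin_fstE.
have lZ2 : latt ([set w | Z (0, w)] : set W2).
  rewrite (_ : [set w | Z (0, w)] = lin_inr @^-1` Z).
    apply: latt_preim => //; apply/lker0P => u v; rewrite !lin_inrE => -[] //.
  by apply/seteqP; split=> x /=; rewrite lin_inrE.
have lZ3 : latt ([set w | Z (w, 0)] : set W1).
  rewrite (_ : [set w | Z (w, 0)] = lin_inl @^-1` Z).
    apply: latt_preim => //; apply/lker0P => u v; rewrite !lin_inlE => -[] //.
  by apply/seteqP; split=> x /=; rewrite lin_inlE.
set A0 : set W1 := [set w | Z (w, 0)] in lZ3; set Z2 := [set w | Z (0, w)] in lZ2 *.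
have A0Z : A0 `<=` fst @` Z by move=> w Zw; exists (w, 0).
have [s [us sX cs inj_s]] := coset_transversal lZ1 lZ3 A0Z.
have sA := latt_submod lZ3; have sZ2 := latt_submod lZ2.
pose lift (y : W1) : W2 := xget 0 [set z : W2 | Z (y, z)].
have liftP y : y \in s -> Z (y, lift y).
  move=> /sX[[y1 y2] Zy /= <-].
  by have := @xgetPex _ 0 [set z : W2 | Z (y1, z)] (ex_intro _ y2 Zy).
have lAZ := latt_prod lZ3 lZ2.
have AZ : A0 `*` Z2 `<=` Z.
  move=> [x y] [/= h1 h2]; have -> : (x, y) = (x, 0) + (0, y) :> WW.
    by congr pair; rewrite /= ?addr0 ?add0r.
  exact: submodD.
pose t := [seq (y, lift y) : WW | y <- s].
have ut : uniq t by rewrite map_inj_uniq// => x y [].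
have inj_t x y : x \in t -> y \in t -> (A0 `*` Z2) (x - y) -> x = y.
  move=> /mapP[x' xs ->] /mapP[y' ys ->] [/= h1 _].
  by rewrite (inj_s x' y').
have cosZ : [set x | exists2 y, y \in t & (A0 `*` Z2) (x - y)] = Z.
  apply/seteqP; split=> x /=.
    move=> [_ /mapP[y ys ->] hh].
    have h := AZ (x - ((y, lift y) : WW)) hh.
    by rewrite -(subrK ((y, lift y) : WW) x); apply: submodD => //; exact: liftP.
  move=> Zx; have [|y ys h] := cs x.1; first by exists x.
  exists (y, lift y); first by apply/mapP; exists y.
  split=> //=; rewrite /Z2 /=.
  have -> : (0, x.2 - lift y) = (x - (y, lift y)) - (x.1 - y, 0) :> WW.
    by congr pair; rewrite /= ?subrr ?subr0.
  by apply: submodB => //; apply: submodB => //; exact: liftP.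
have cosZ1 : [set x | exists2 y, y \in s & A0 (x - y)] = fst @` Z.
  apply/seteqP; split=> x /=; last by move=> /cs.
  move=> [y ys h]; rewrite -(subrK y x).
  apply: (submodD (latt_submod lZ1)); [exact: A0Z|exact: sX].
have [_] := tinv_cosets (latt_submod lAZ) (measurable_latt lAZ) (@stdh_tinv _ _ WW) ut inj_t.
rewrite cosZ !stdh_vol0; try exact: bounded_borel_latt.
move=> -[e1].
have [_] := tinv_cosets sA (measurable_latt lZ3) (@stdh_tinv _ _ W1) us inj_s.
rewrite cosZ1 !stdh_vol0; try exact: bounded_borel_latt.
move=> -[e2].
have e3 := vol_setX lX lY (bounded_borel_latt lZ3) (bounded_borel_latt lZ2).
have -> : vol (X `*` Y : set WW) Z = (size s)%:R * vol (X `*` Y : set WW) (A0 `*` Z2).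
  by rewrite /vol e1 size_map mulrA.
have -> : vol X (fst @` Z) = (size s)%:R * vol X A0 by rewrite /vol e2 mulrA.
by rewrite e3 mulrA.
Qed.

End ProductVolume.

(** * Volumes of submodules *)

Section SmallSubmodules.
Variables (R : realType) (F : nonArchLocalFieldType R) (W : vectType F).
Local Notation pi_ := (unif F).
Implicit Types (X Y : set W).

(** A submodule of Y missing pi^M y has the disjoint translates by the
    pi^i y with i at most M. *)
Lemma vol_small X Y M y : submod X -> latt Y -> X `<=` Y -> Y y ->
  ~ X (pi_ ^+ M *: y) -> vol Y X <= (M.+1)%:R^-1.
Proof.
move=> sX lY XY Yy nX; have sY := latt_submod lY.
have Y0 := vol0_latt lY.
rewrite /vol ler_pdivrMr// mulrC ler_pdivlMr ?ltr0n//.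
rewrite {1}/vol0; case: asboolP => bX; last by rewrite mul0r vol0_ge0.
rewrite -[fine _]/(fine (stdh W X)) stdh_vol0//=.
have [mX _] := bX.
have key i j : (i <= M)%N -> (j <= M)%N -> X (pi_ ^+ i *: y - pi_ ^+ j *: y) -> i = j.
  wlog ij : i j / (i <= j)%N.
    move=> hw iM jM h; have [ij|/ltnW ji] := leqP i j; first exact: hw.
    by apply/esym/hw => //; rewrite -opprB; exact: submodN.
  move=> iM jM h; apply/eqP/negPn/negP => nij.
  have lij : (i < j)%N by rewrite ltn_neqAle nij.
  apply: nX.
  have u1 : absv (1 - pi_ ^+ (j - i)) = 1.
    apply: absv_near1; rewrite addrC addKr absvN -(prednK (_ : 0 < j - i)%N) ?subn_gt0//.
    rewrite exprS absvM (le_lt_trans _ (unif_lt1 F))// ler_piMr ?absv_ge0 ?absv_unif_le1//.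
  have u0 : 1 - pi_ ^+ (j - i) != 0 by rewrite -absv_gt0 u1.
  have Xi : X (pi_ ^+ i *: y).
    rewrite -(scalerK u0 (pi_ ^+ i *: y)); apply: submodZ => //.
      by rewrite absvV u1 invr1.
    by rewrite scalerBl scale1r scalerA -exprD subnK.
  rewrite -(subnK iM) exprD -scalerA; apply: submodZ => //.
  exact: absv_unif_le1.
have inj : {in iota 0 M.+1 &, injective (fun i => pi_ ^+ i *: y)}.
  move=> i j; rewrite !mem_iota !add0n !ltnS => iM jM h.
  by apply: key => //; rewrite h subrr; case: sX.
pose s := [seq pi_ ^+ i *: y | i <- iota 0 M.+1].
have us : uniq s by rewrite map_inj_in_uniq// iota_uniq.
have inj_s x z : x \in s -> z \in s -> X (x - z) -> x = z.
  move=> /mapP[i + ->] /mapP[j + ->]; rewrite !mem_iota !add0n !ltnS => iM jM h.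
  by rewrite (key i j).
have [mU hU] := tinv_cosets sX mX (@stdh_tinv _ _ W) us inj_s.
have : (stdh W [set x : W | exists2 z, z \in s & X (x - z)%R] <= stdh W Y)%E.
  apply: le_measure; rewrite ?inE//; first exact: measurable_latt.
  move=> x [_ /mapP[i _ ->] h]; rewrite -(subrK (pi_ ^+ i *: y) x).
  apply: submodD => //; first exact: XY.
  by apply: submodZ => //; exact: absv_unif_le1.
rewrite hU size_map size_iota !stdh_vol0//; last exact: bounded_borel_latt.
by rewrite -EFinM lee_fin mulrC.
Qed.

(** A proper subspace contains no multiple pi^M y of a vector y outside it, so
    vol_small applies for every M. *)
Lemma vol_subspace0 X Y (U : {vspace W}) : submod X -> latt Y -> X `<=` Y ->
  (forall x, X x -> x \in U) -> U != fullv -> vol Y X = 0.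
Proof.
move=> sX lY XY XU Unf.
have [w wU] : exists w, w \notin U.
  apply: contrapT => h; move/eqP: Unf; apply; apply/eqP; rewrite eqEsubv subvf /=.
  by apply/subvP => w _; apply: contrapT => /negP wU; apply: h; exists w.
have [a a0 ha] := latt_absorb w lY.
have small M : vol Y X <= (M.+1)%:R^-1.
  apply: (@vol_small X Y M (a *: w)) => //.
  move=> /XU h; move/negP: wU; apply.
  rewrite -(scalerK a0 w) -(scalerK (unifX_neq0 F M) (a *: w)).
  by rewrite memvZ// memvZ.
apply/eqP; rewrite eq_le vol_ge0 andbT leNgt; apply/negP => h.
have := small (Num.truncn (vol Y X)^-1).
rewrite leNgt -[ltRHS]invrK ltf_pV2 ?posrE ?invr_gt0 ?ltr0n//.
by rewrite truncnS_gt.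
Qed.

Lemma basis_map (V : vectType F) (b : seq V) (f : nat -> W) : basis_of fullv b ->
  exists t : 'Hom(V, W), forall i, (i < size b)%N -> t b`_i = f i.
Proof.
move=> hb; pose g (v : V) : W := \sum_(i < size b) coord (in_tuple b) i v *: f i.
have lg : linear g.
  move=> a u v; rewrite /g scaler_sumr -big_split /=; apply: eq_bigr => i _.
  by rewrite linearP scalerDl scalerA.
exists (mklin lg) => i ib; rewrite mklinE /g (bigD1 (Ordinal ib)) //= big1 => [|j jn].
  have -> : b`_i = (in_tuple b)`_(Ordinal ib) by [].
  by rewrite coord_free ?(basis_free hb)// eqxx scale1r addr0.
have -> : b`_i = (in_tuple b)`_(Ordinal ib) by [].
by rewrite coord_free ?(basis_free hb)// eq_sym (negbTE jn) scale0r.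
Qed.

Lemma obasis_coord X (b : seq W) : obasis X fullv b ->
  forall x, X x -> exists2 c : nat -> F, (forall i, (i < size b)%N -> absv (c i) <= 1) &
    x = \sum_(i < size b) c i *: b`_i.
Proof.
move=> [hb hX] x Xx.
have xE : x = \sum_(i < size b) coord (in_tuple b) i x *: b`_i.
  by rewrite {1}(@coord_basis _ _ _ _ (in_tuple b) x hb) ?memvf.
pose c i := if insub i is Some i' then coord (in_tuple b) i' x else 0.
have cE : \sum_(i < size b) c i *: b`_i = x.
  by rewrite [RHS]xE; apply: eq_bigr => i _; rewrite /c valK.
by exists c; rewrite ?cE//; apply/hX; rewrite cE.
Qed.

(** Nakayama: the endomorphism that sends an orthonormal basis of X to
    approximations of its vectors in X' is the identity modulo pi X, hence
    maps X onto itself. *)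
Lemma submod_nakayama X X' : latt X -> submod X' -> X' `<=` X ->
  (forall x, X x -> exists2 x', X' x' & exists2 z, X z & x = x' + pi_ *: z) -> X = X'.
Proof.
move=> lX sX' X'X hX; have sX := latt_submod lX.
apply/seteqP; split=> //; have [b [bE hb]] := obasis_exists lX fullv.
have bX i : (i < size b)%N -> X b`_i.
  move=> ib; have : X (\sum_(j < size b) (if (j : nat) == i then 1 else 0) *: b`_j).
    apply: (hb (fun j => if j == i then 1 else 0)).2 => j jb.
    by case: ifP => _; rewrite ?absv1 ?absv0.
  rewrite (bigD1 (Ordinal ib)) //= eqxx scale1r big1 ?addr0// => j jn.
  by rewrite ifN ?scale0r.
have [f hf] : exists f : nat -> W, forall i, (i < size b)%N ->
    X' (f i) /\ exists2 z, X z & b`_i = f i + pi_ *: z.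
  have hf' i : exists x', (i < size b)%N -> X' x' /\ exists2 z, X z & b`_i = x' + pi_ *: z.
    have [ib|] := boolP (i < size b)%N; last by exists 0.
    by have [x' Xx' h] := hX _ (bX i ib); exists x'.
  by have [f hf] := choice hf'; exists f.
have [t ht] := basis_map f bE.
have tX' x : X x -> X' (t x).
  move=> /(obasis_coord (conj bE hb))[c hc ->]; rewrite linear_sum; apply: submod_sum => // i _.
  by rewrite linearZ /= ht//; apply: submodZ; [|exact: hc|exact: (hf _ _).1].
have [_ tX] : lker t == 0%VS /\ t @` X = X.
  apply: near1_stab => // x /(obasis_coord (conj bE hb))[c hc ->].
  have hz i : exists z, (i < size b)%N -> X z /\ b`_i = f i + pi_ *: z.
    have [ib|] := boolP (i < size b)%N; last by exists 0.
    by have [_ [z Xz ->]] := hf i ib; exists z.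
  have [z hz'] := choice hz.
  exists (- \sum_(i < size b) c i *: z i).
    apply: submodN => //; apply: submod_sum => // i _.
    by apply: submodZ => //; [exact: hc|exact: (hz' _ _).1].
  rewrite linear_sum -sumrN scaler_sumr -big_split /=; apply: eq_bigr => i _.
  have [_ bi] := hz' i (ltn_ord i).
  rewrite linearZ /= ht// scalerN scalerA [pi_ * _]mulrC -scalerA -scalerBr bi.
  by rewrite addrK.
by move=> x; rewrite -tX => -[y Xy <-]; exact: tX'.
Qed.

(** If one of the two contains pi^M Y then they are equal by Nakayama;
    otherwise both are small by vol_small. *)
Lemma vol_close X X' Y M : submod X -> submod X' -> latt Y -> X `<=` Y -> X' `<=` Y ->
  (forall x, X x -> exists2 x', X' x' & exists2 y, Y y & x = x' + pi_ ^+ M.+1 *: y) ->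
  (forall x, X' x -> exists2 x', X x' & exists2 y, Y y & x = x' + pi_ ^+ M.+1 *: y) ->
  `|vol Y X - vol Y X'| <= (M.+1)%:R^-1.
Proof.
move=> sX sX' lY XY X'Y h1 h2.
have M0 : 0 <= (M.+1)%:R^-1 :> R by rewrite invr_ge0.
have full (Z Z' : set W) : submod Z -> submod Z' -> Z `<=` Y -> Z' `<=` Y ->
  (forall x, Z x -> exists2 x', Z' x' & exists2 y, Y y & x = x' + pi_ ^+ M.+1 *: y) ->
  (forall x, Z' x -> exists2 x', Z x' & exists2 y, Y y & x = x' + pi_ ^+ M.+1 *: y) ->
  (forall y, Y y -> Z (pi_ ^+ M *: y)) -> Z = Z'.
  move=> sZ sZ' ZY Z'Y k1 k2 YZ.
  have lZ : latt Z.
    split=> //.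
      by have [_ [a a0 ha] _] := lY; exists a => // x /ZY/ha.
    have [_ _ [a a0 ha]] := lY; exists (pi_ ^+ M * a); rewrite ?mulf_neq0 ?unifX_neq0//.
    by move=> x hx; rewrite -scalerA; apply/YZ/ha.
  apply: submod_nakayama => //.
    move=> x /k2[x' Zx' [y Yy ->]]; apply: submodD => //.
    by rewrite exprS -scalerA; apply: submodZ => //; [exact/ltW/unif_lt1|exact: YZ].
  move=> x /k1[x' Zx' [y Yy ->]]; exists x' => //.
  by exists (pi_ ^+ M *: y); [exact: YZ|rewrite scalerA -exprS].
have [YX|nYX] := pselect (forall y, Y y -> X (pi_ ^+ M *: y)).
  by rewrite (full X X') ?subrr ?normr0.
have [YX'|nYX'] := pselect (forall y, Y y -> X' (pi_ ^+ M *: y)).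
  by rewrite (full X' X) ?subrr ?normr0.
have small (Z : set W) : submod Z -> Z `<=` Y -> ~ (forall y, Y y -> Z (pi_ ^+ M *: y)) ->
    vol Y Z <= (M.+1)%:R^-1.
  move=> sZ ZY hn.
  have [y [Yy Zy]] : exists y, Y y /\ ~ Z (pi_ ^+ M *: y).
    apply: contrapT => h; apply: hn => y Yy; apply: contrapT => hy; apply: h.
    by exists y.
  exact: vol_small Yy Zy.
have gen (a b e : R) : 0 <= a -> 0 <= b -> a <= e -> b <= e -> `|a - b| <= e.
  by move=> *; rewrite ler_norml; apply/andP; split; lra.
by apply: gen; rewrite ?vol_ge0//; exact: small.
Qed.

End SmallSubmodules.

(** * The group of a lattice and its congruence subgroups *)

Section CongruenceSubgroups.
Variables (R : realType) (F : nonArchLocalFieldType R) (V : vectType F).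
Variables (Lam : set V) (lL : latt Lam).
Local Notation pi_ := (unif F).
Implicit Types (g h k : 'End(V)) (E : {vspace V}).
Let sL : submod Lam := latt_submod lL.

(** Exponents start at 1, so that these maps are invertible by near1_stab. *)
Definition congr_grp m : set 'End(V) := [set g |
  forall x, Lam x -> exists2 y, Lam y & g x = x + pi_ ^+ m.+1 *: y].
Local Notation G := congr_grp.
Local Notation K := (GLlat Lam).

Lemma congr_GL m g : G m g -> K g.
Proof.
move=> hg; rewrite /GLlat /GLV /=; apply: near1_stab lL _ => x /hg[y Ly ->].
exists (pi_ ^+ m *: y); last by rewrite scalerA -exprS.
by apply: submodZ => //; exact: absv_unif_le1.
Qed.

Lemma GL_ker g : K g -> lker g == 0%VS. Proof. by case. Qed.

Lemma GL_mem g x : K g -> Lam x -> Lam (g x).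
Proof. by move=> [_ e] Lx; rewrite -e; exists x. Qed.

Lemma GL_memV g x : K g -> Lam (g x) -> Lam x.
Proof. by move=> [/lker0P ig e] h; move: h; rewrite -{1}e => -[y Ly /ig <-]. Qed.

Lemma GLP g : lker g == 0%VS -> (forall x, Lam x <-> Lam (g x)) -> K g.
Proof.
move=> ig h; split=> //; apply/seteqP; split=> [_ [x Lx <-]|x Lx]; first exact: (h x).1.
by exists (g^-1%VF x); [apply: (h _).2|]; rewrite lker0_lfunVK.
Qed.

Lemma lker0_inv (g : 'End(V)) : lker g == 0%VS -> lker g^-1%VF == 0%VS.
Proof. by move=> ig; apply/lker0P => u v h; rewrite -(lker0_lfunVK ig u) h lker0_lfunVK. Qed.

Lemma lker0_comp (g h : 'End(V)) : lker g == 0%VS -> lker h == 0%VS -> lker (g \o h)%VF == 0%VS.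
Proof.
by move=> /lker0P ig /lker0P ih; apply/lker0P => u v; rewrite !comp_lfunE => /ig/ih.
Qed.

Lemma GL1 : K \1%VF.
Proof. by apply: GLP => [|x]; [apply/lker0P => u v; rewrite !id_lfunE|rewrite id_lfunE]. Qed.

Lemma GLM g h : K g -> K h -> K (g \o h)%VF.
Proof.
move=> kg kh; apply: GLP => [|x]; first exact: lker0_comp (GL_ker kg) (GL_ker kh).
rewrite comp_lfunE; split=> [Lx|/(GL_memV kg)/(GL_memV kh)//].
by apply: GL_mem => //; exact: GL_mem.
Qed.

Lemma GL_inv g : K g -> K g^-1%VF.
Proof.
move=> kg; apply: GLP => [|x]; first exact: lker0_inv (GL_ker kg).
split=> [Lx|/(GL_mem kg)]; last by rewrite lker0_lfunVK ?GL_ker.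
by apply: (GL_memV kg); rewrite lker0_lfunVK ?GL_ker.
Qed.

Lemma congr_grp1 m : G m \1%VF.
Proof. by move=> x Lx; exists 0; [case: sL|rewrite id_lfunE scaler0 addr0]. Qed.

Lemma congr_grpM m g h : G m g -> G m h -> G m (g \o h)%VF.
Proof.
move=> hg hh x Lx; have [y Ly hy] := hh x Lx.
have [z Lz hz] := hg _ (GL_mem (congr_GL hh) Lx).
by exists (y + z); [exact: submodD|rewrite comp_lfunE hz hy scalerDr addrA].
Qed.

Lemma congr_grpV m g : G m g -> G m g^-1%VF.
Proof.
move=> hg x Lx; have kg := congr_GL hg; have kv := GL_inv kg.
have [y Ly] := hg _ (GL_mem kv Lx); rewrite lker0_lfunVK ?GL_ker// => hy.
by exists (- y); [exact: submodN|rewrite scalerN {2}hy addrK].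
Qed.

Lemma congr_grpJ m k g : K k -> G m g -> G m (k \o g \o k^-1)%VF.
Proof.
move=> kk hg x Lx; have [y Ly hy] := hg _ (GL_mem (GL_inv kk) Lx).
exists (k y); first exact: GL_mem.
by rewrite !comp_lfunE hy linearD linearZ /= lker0_lfunVK ?GL_ker.
Qed.

Lemma congr_grp_le m l g : (l <= m)%N -> G m g -> G l g.
Proof.
move=> lm hg x /hg[y Ly ->]; exists (pi_ ^+ (m - l) *: y).
  by apply: submodZ => //; exact: absv_unif_le1.
by rewrite scalerA -exprD addSn subnKC.
Qed.

Lemma GL_dim g (E : {vspace V}) : lker g == 0%VS -> \dim (g @: E) = \dim E.
Proof. by move=> /eqP kg; rewrite limg_dim_eq// kg capv0. Qed.

Lemma limgK g (E : {vspace V}) : lker g == 0%VS -> (g^-1 @: (g @: E) = E)%VS.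
Proof. by move=> kg; rewrite -limg_comp lker0_compVf// lim1g. Qed.

Lemma limgVK g (E : {vspace V}) : lker g == 0%VS -> (g @: (g^-1 @: E) = E)%VS.
Proof. by move=> kg; rewrite -limg_comp lker0_compfV// lim1g. Qed.

Lemma memv_limgE g (E : {vspace V}) v : lker g == 0%VS -> (g v \in (g @: E)%VS) = (v \in E).
Proof.
move=> kg; apply/idP/idP => [/memv_imgP[u uE /(lker0P kg) ->]//|vE].
exact: memv_img.
Qed.

(** The orbits of the congruence subgroups are the basic neighbourhoods in the
    Grassmannian; since these are subgroups, closeness at level m is an
    equivalence relation. *)
Definition lev m (E E' : {vspace V}) := exists2 g, G m g & E' = (g @: E)%VS.

Lemma lev_refl m E : lev m E E.
Proof. by exists \1%VF; [exact: congr_grp1|rewrite lim1g]. Qed.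

Lemma lev_sym m E E' : lev m E E' -> lev m E' E.
Proof.
move=> [g gG ->]; exists g^-1%VF; first exact: congr_grpV.
by rewrite limgK// GL_ker//; exact: congr_GL gG.
Qed.

Lemma lev_trans m E1 E2 E3 : lev m E1 E2 -> lev m E2 E3 -> lev m E1 E3.
Proof.
move=> [g gG ->] [h hG ->]; exists (h \o g)%VF; first exact: congr_grpM.
by rewrite limg_comp.
Qed.

Lemma lev_le m l E E' : (l <= m)%N -> lev m E E' -> lev l E E'.
Proof. by move=> lm [g gG ->]; exists g => //; exact: congr_grp_le gG. Qed.

Lemma lev_dim m E E' : lev m E E' -> \dim E' = \dim E.
Proof. by move=> [g /congr_GL/GL_ker gG ->]; rewrite GL_dim. Qed.

Lemma lev_GL m k E E' : K k -> lev m E E' -> lev m (k @: E)%VS (k @: E')%VS.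
Proof.
move=> kk [g gG ->]; exists (k \o g \o k^-1)%VF; first exact: congr_grpJ.
by rewrite !limg_comp limgK// GL_ker.
Qed.

Lemma lev_near m E E' x : lev m E E' -> x \in E -> Lam x ->
  exists x', [/\ x' \in E', Lam x' & exists2 y, Lam y & x = x' + pi_ ^+ m.+1 *: y].
Proof.
move=> [g gG ->] xE Lx; have [y Ly hy] := gG x Lx.
exists (g x); split; first exact: memv_img.
  exact: GL_mem (congr_GL gG) Lx.
by exists (- y); [exact: submodN|rewrite hy scalerN addrK].
Qed.

Lemma obasis_mem E b i : obasis Lam E b -> (i < size b)%N -> Lam b`_i /\ b`_i \in E.
Proof.
move=> [bE hb] ib; split; last by rewrite (basis_mem bE)// mem_nth.
have : Lam (\sum_(j < size b) (if (j : nat) == i then 1 else 0) *: b`_j).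
  apply: (hb (fun j => if j == i then 1 else 0)).2 => j jb.
  by case: ifP => _; rewrite ?absv1 ?absv0.
rewrite (bigD1 (Ordinal ib)) //= eqxx scale1r big1 ?addr0// => j jn.
by rewrite ifN ?scale0r.
Qed.

Lemma obasis_dim E b : obasis Lam E b -> size b = \dim E.
Proof. by move=> [bE _]; apply/esym; exact: (@size_basis _ _ _ _ (in_tuple b)). Qed.

(** Complete an orthonormal basis of E to one of V and move its first vectors
    to nearby vectors of E'. The resulting map lies in the congruence subgroup
    and sends E into E'. *)
Lemma near_lev m E E' : \dim E = \dim E' ->
  (forall x, x \in E -> Lam x -> exists x', [/\ x' \in E', Lam x' &
     exists2 y, Lam y & x = x' + pi_ ^+ m.+1 *: y]) -> lev m E E'.
Proof.
move=> dE hE; have [b [b' [hb hbb]]] := obasis_adapted lL E.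
have hf' i : exists x', [/\ Lam (x' : V), (i < size b)%N -> x' \in E' &
    (i < size (b ++ b'))%N -> exists2 y, Lam y & x' = (b ++ b')`_i + pi_ ^+ m.+1 *: y].
  have [ib|ib] := ltnP i (size b).
    have [Lb bE] := obasis_mem hb ib.
    have [x' [x'E Lx' [y Ly h]]] := hE _ bE Lb; exists x'; split=> // _.
    by exists (- y); [exact: submodN|rewrite nth_cat ib h scalerN addrK].
  have [ibb|ibb] := ltnP i (size (b ++ b')).
    exists (b ++ b')`_i; split=> //; first exact: (obasis_mem hbb ibb).1.
    by move=> _; exists 0; [case: sL|rewrite scaler0 addr0].
  by exists 0; split=> //; case: sL.
have [f hf] := choice hf'.
have [t ht] := basis_map f hbb.1.
have tG : G m t.
  move=> x /(obasis_coord hbb)[c hc ->].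
  have hz' i : exists y : V, (i < size (b ++ b'))%N -> Lam y /\
      f i = (b ++ b')`_i + pi_ ^+ m.+1 *: y.
    have [_ _ h] := hf i; have [ib|] := boolP (i < size (b ++ b'))%N; last by exists 0.
    by have [y Ly e] := h ib; exists y.
  have [z hz] := choice hz'.
  exists (\sum_(i < size (b ++ b')) c i *: z i).
    by apply: submod_sum => // i _; apply: submodZ => //; [exact: hc|exact: (hz _ _).1].
  rewrite linear_sum scaler_sumr -big_split /=; apply: eq_bigr => i _.
  have [_ fi] := hz i (ltn_ord i).
  by rewrite linearZ /= ht// fi scalerDr !scalerA [_ * c i]mulrC.
exists t => //; apply/eqP; rewrite eq_sym eqEdim GL_dim ?dE ?leqnn ?andbT; last first.
  exact: GL_ker (congr_GL tG).
apply/subvP => _ /memv_imgP[x xE ->].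
have -> : x = \sum_(i < size b) coord (in_tuple b) i x *: b`_i.
  by rewrite {1}(@coord_basis _ _ _ _ (in_tuple b) x hb.1).
rewrite linear_sum; apply: memv_suml => i _; rewrite linearZ memvZ//=.
have -> : b`_i = (b ++ b')`_i by rewrite nth_cat ltn_ord.
rewrite ht; last by rewrite size_cat ltn_addr.
by have [_ h _] := hf i; exact: h.
Qed.

Lemma obasis_iso b1 b2 : obasis Lam fullv b1 -> obasis Lam fullv b2 ->
  exists2 g, K g & forall i, (i < size b1)%N -> g b1`_i = b2`_i.
Proof.
move=> h1 h2; have [g hg] := basis_map (fun i => b2`_i) h1.1.
have s12 : size b1 = size b2 by rewrite (obasis_dim h1) (obasis_dim h2).
have gE (c : nat -> F) : g (\sum_(i < size b1) c i *: b1`_i) = \sum_(i < size b2) c i *: b2`_i.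
  by rewrite -s12 linear_sum; apply: eq_bigr => i _; rewrite linearZ /= hg.
exists g => //; apply: GLP => [|x].
  have kg : \dim (lker g) = 0%N.
    have : limg g = fullv.
      apply/eqP; rewrite eqEsubv subvf /= -(span_basis h2.1); apply/span_subvP => v /(nthP 0)[i ib <-].
      by rewrite -hg ?s12// memv_img// (span_basis h2.1) memvf.
    move=> lg; have := limg_ker_dim g fullv; rewrite lg capfv; lia.
  by rewrite -dimv_eq0 kg.
have xE : x = \sum_(i < size b1) coord (in_tuple b1) i x *: b1`_i.
  by rewrite {1}(@coord_basis _ _ _ _ (in_tuple b1) x h1.1) ?memvf.
pose c i := if insub i is Some i' then coord (in_tuple b1) i' x else 0.
have {}xE : x = \sum_(i < size b1) c i *: b1`_i.
  by rewrite {1}xE; apply: eq_bigr => i _; rewrite /c valK.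
by rewrite xE gE h1.2 h2.2 s12.
Qed.

(** Orthonormal bases adapted to E and to E' correspond under an element of
    the group. *)
Lemma GL_transitive E E' : \dim E = \dim E' -> exists2 g, K g & E' = (g @: E)%VS.
Proof.
move=> dE; have [b1 [b1' [h1 hh1]]] := obasis_adapted lL E.
have [b2 [b2' [h2 hh2]]] := obasis_adapted lL E'.
have s12 : size b1 = size b2 by rewrite (obasis_dim h1) (obasis_dim h2).
have [g kg hg] := obasis_iso hh1 hh2.
exists g => //; apply/eqP; rewrite eq_sym eqEdim GL_dim ?dE ?leqnn ?andbT ?GL_ker//.
rewrite -(span_basis h1.1) limg_span; apply/span_subvP => v /mapP[u /(nthP 0)[i ib <-] ->].
have -> : b1`_i = (b1 ++ b1')`_i by rewrite nth_cat ib.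
rewrite hg ?size_cat ?ltn_addr// nth_cat -s12 ib (basis_mem h2.1)//.
by rewrite mem_nth// -s12.
Qed.

Definition endLam : set 'End(V) := [set g | forall x, Lam x -> Lam (g x)].

Lemma endLam_submod : submod endLam.
Proof.
split=> [x Lx|u v hu hv x Lx|a u ha hu x Lx]; first by rewrite zero_lfunE; case: sL.
  by rewrite add_lfunE; apply: submodD => //; [exact: hu|exact: hv].
by rewrite scale_lfunE; apply: submodZ => //; exact: hu.
Qed.

(** In an orthonormal basis of Lam these are the matrices with integral
    entries. *)
Lemma endLam_latt : latt endLam.
Proof.
have sE := endLam_submod; split=> //; last first.
  have [a a0 ha] : exists2 a : F, a != 0 & forall i : 'I_(\dim {:'End(V)}),
      endLam (a *: (vbasis {:'End(V)})`_i).
    apply: common_scalar => [i a b hab|i]; first exact: submod_scale_le.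
    have [a a0 ha] := latt_lin (vbasis {:'End(V)})`_i lL lL.
    by exists a => // x /ha; rewrite scale_lfunE.
  exists a => // g hg; rewrite (coords_sum g) scaler_sumr.
  apply: submod_sum => // i _; rewrite scalerA mulrC -scalerA.
  by apply: (submodZ sE).
have [b hb] := obasis_exists lL fullv.
have he' (ij : 'I_(size b) * 'I_(size b)) : exists e : 'End(V),
    forall x, e x = coord (in_tuple b) ij.1 x *: b`_ij.2.
  have le : linear (fun x => coord (in_tuple b) ij.1 x *: b`_ij.2).
    by move=> c u v; rewrite linearP scalerDl scalerA.
  by exists (mklin le) => x; rewrite mklinE.
have [e he] := choice he'.
have [a a0 ha] : exists2 a : F, a != 0 & forall ij, cLam (a *: e ij).
  apply: common_scalar => [ij a c hac|ij]; last exact: cLam_absorb.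
  by apply: submod_scale_le => //; exact: latt_submod (cLam_latt _).
exists a => // g hg.
have hc' i : exists c : nat -> F, (i < size b)%N ->
    (forall j, (j < size b)%N -> absv (c j) <= 1) /\ g b`_i = \sum_(j < size b) c j *: b`_j.
  have [ib|] := boolP (i < size b)%N; last by exists (fun=> 0).
  by have [c hc gc] := obasis_coord hb (hg _ (obasis_mem hb ib).1); exists c.
have [c hc] := choice hc'.
have gE : g = \sum_(ij : 'I_(size b) * 'I_(size b)) c ij.1 ij.2 *: e ij.
  apply/lfunP => x; rewrite sum_lfunE.
  under eq_bigr => ij _ do rewrite scale_lfunE he.
  rewrite -(pair_bigA _ (fun i j : 'I_(size b) => c i j *: (coord (in_tuple b) i x *: b`_j))) /=.
  rewrite {1}(@coord_basis _ _ _ _ (in_tuple b) x hb.1) ?memvf// linear_sum.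
  apply: eq_bigr => i _; rewrite linearZ /= (hc i (ltn_ord i)).2 scaler_sumr.
  by apply: eq_bigr => j _; rewrite !scalerA mulrC.
rewrite gE scaler_sumr; apply: submod_sum => [|ij _]; first exact: latt_submod (cLam_latt _).
rewrite scalerA mulrC -scalerA; apply: cLamZ => //.
by apply: (hc _ (ltn_ord ij.1)).1.
Qed.

Lemma congr_grpE m g : G m g <-> exists2 w, endLam w & g = \1%VF + pi_ ^+ m.+1 *: w.
Proof.
split=> [hg|[w hw ->] x Lx]; last first.
  by exists (w x); [exact: hw|rewrite add_lfunE scale_lfunE id_lfunE].
exists (pi_ ^- m.+1 *: (g - \1%VF)) => [x Lx|]; last first.
  by rewrite scalerKV ?unifX_neq0// addrC subrK.
have [y Ly hy] := hg x Lx.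
by rewrite scale_lfunE add_lfunE opp_lfunE id_lfunE hy addrC addKr scalerK ?unifX_neq0.
Qed.

(** The multiples of the lattice endLam are the basic neighbourhoods of 0 in
    End(V). *)
Lemma nbhs_congr_grp (A : set 'End(V)) :
  nbhs (\1%VF : topvec 'End(V)) A <-> exists m, G m `<=` A.
Proof.
rewrite (latt_nbhs _ _ endLam_latt); split=> [[a a0 ha]|[m mA]]; last first.
  exists (pi_ ^+ m.+1); first exact: unifX_neq0.
  by move=> w hw; apply: mA; apply/congr_grpE; exists w.
have [m hm] := absv_unifX_small a0; exists m => g /congr_grpE[w hw ->].
have := ha ((a^-1 * pi_ ^+ m.+1) *: w); rewrite scalerA mulrA mulfV// mul1r; apply.
apply: (submodZ endLam_submod) => //.
rewrite absvM absvV mulrC ler_pdivrMr ?absv_gt0// mul1r (le_trans _ hm)//.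
by rewrite exprS absvM ler_piMl ?absv_ge0 ?ltW ?unif_lt1.
Qed.

(** The group lies in endLam, which has finitely many cosets modulo pi^(m+1)
    endLam. *)
Lemma GL_finite_index m : exists ks : seq 'End(V), (forall k, k \in ks -> K k) /\
  forall g, K g -> exists2 k, k \in ks & exists2 u, G m u & g = (u \o k)%VF.
Proof.
have lE := endLam_latt; have sE := endLam_submod.
have lZ := latt_scale (unifX_neq0 F m.+1) lE.
have ZE : [set pi_ ^+ m.+1 *: x | x in endLam] `<=` endLam.
  by move=> _ [x hx <-]; apply: (submodZ sE) => //; exact: absv_unif_le1.
have [s [_ _ cs _]] := coset_transversal lE lZ ZE.
have sZ := latt_submod lZ.
pose f y : 'End(V) := xget \1%VF [set k | K k /\ [set pi_ ^+ m.+1 *: x | x in endLam] (k - y)].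
exists (map f s); split=> [_ /mapP[y _ ->]|g kg].
  rewrite /f; case: xgetP => [k _ []//|_]; exact: GL1.
have gE : endLam g by move=> x Lx; exact: GL_mem.
have [y ys gy] := cs g gE.
have [kf fy] := @xgetPex _ \1%VF
  [set k | K k /\ [set pi_ ^+ m.+1 *: x | x in endLam] (k - y)] (ex_intro _ g (conj kg gy)).
rewrite -/(f y) in kf fy.
exists (f y); first by apply/mapP; exists y.
have [w hw wE] : [set pi_ ^+ m.+1 *: x | x in endLam] (g - f y).
  by rewrite -(subrKA y) -[y - _]opprB; exact: submodB.
exists (g \o (f y)^-1)%VF; last by rewrite -comp_lfunA lker0_compVf ?comp_lfun1r ?GL_ker.
apply/congr_grpE; exists (w \o (f y)^-1)%VF.
  by move=> x Lx; rewrite comp_lfunE; apply: hw; exact: GL_mem (GL_inv kf) Lx.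
apply/lfunP => x; rewrite add_lfunE id_lfunE scale_lfunE !comp_lfunE.
have e := congr1 (fun h : 'End(V) => h ((f y)^-1%VF x)) wE.
rewrite scale_lfunE add_lfunE opp_lfunE lker0_lfunVK ?GL_ker// in e.
by rewrite e addrC subrK.
Qed.

(** The images of a single subspace under representatives of the cosets meet
    all classes, by transitivity. *)
Lemma gr_reps m (k : nat) : exists xs : seq {vspace V}, [/\ uniq xs,
  (forall x, x \in xs -> \dim x = k),
  (forall E, \dim E = k -> exists2 x, x \in xs & lev m x E) &
  (forall x y, x \in xs -> y \in xs -> lev m x y -> x = y)].
Proof.
have [[E0 dE0]|n] := pselect (exists E : {vspace V}, \dim E = k); last first.
  by exists [::]; split=> // E dE; exfalso; apply: n; exists E.
have [ks [hk cks]] := GL_finite_index m.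
have [|||xs [u s c i]] := @transversal_exists _ [seq (g @: E0)%VS | g <- ks] (lev m).
- by move=> x y; exact: lev_sym.
- by move=> x y z; exact: lev_trans.
- by move=> x _; exact: lev_refl.
exists xs; split=> // [x /s/mapP[g /hk/GL_ker gk ->]|E dE]; first by rewrite GL_dim.
have [g kg ->] : exists2 g, K g & E = (g @: E0)%VS by apply: GL_transitive; rewrite dE0.
have [h hk' [v vG ->]] := cks g kg.
have [x xs' hx] := c (h @: E0)%VS (map_f _ hk').
exists x => //; apply: lev_trans (lev_sym hx) _.
by exists v; rewrite // limg_comp.
Qed.

End CongruenceSubgroups.

(** * Invariant integration on Grassmannians *)

Section GrassmannianMeasure.
Variables (R : realType) (F : nonArchLocalFieldType R) (V : vectType F).
Variables (Lam : set V) (lL : latt Lam).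
Local Notation pi_ := (unif F).
Implicit Types (g h : 'End(V)) (E : {vspace V}).
Local Notation G := (congr_grp Lam).
Local Notation K := (GLlat Lam).

Lemma GL_congr_nbhs m g : K g -> exists l, forall h, bal l g h -> exists2 u, G m u & h = (u \o g)%VF.
Proof.
move=> kg; have lE := endLam_latt lL.
have lZ := latt_scale (unifX_neq0 F m.+1) lE.
have [l hl] := latt_ball lZ; exists l => h gh.
have [w hw wE] : [set pi_ ^+ m.+1 *: x | x in endLam Lam] (h - g).
  by apply: hl; move: gh; rewrite /bal /= subr0.
exists (h \o g^-1)%VF; last by rewrite -comp_lfunA lker0_compVf ?comp_lfun1r ?(GL_ker kg).
move=> x Lx; exists (w (g^-1%VF x)).
  by apply: hw; exact: GL_mem (GL_inv kg) Lx.
have e := congr1 (fun h : 'End(V) => h (g^-1%VF x)) wE.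
rewrite scale_lfunE add_lfunE opp_lfunE lker0_lfunVK ?(GL_ker kg)// in e.
by rewrite e comp_lfunE addrC subrK.
Qed.

Lemma gr_openP (U : set {vspace V}) : open (U : set (Gr V)) <->
  forall E, U E -> exists m, forall g, G m g -> U (g @: E)%VS.
Proof.
split=> [oU E UE|h].
  have /(nbhs_congr_grp lL)[m hm] := oU E UE.
  exists m => g gG; apply: hm => //.
  by have := GL_ker (congr_GL lL gG).
change (gr_open U) => E UE.
apply/(nbhs_congr_grp lL); have [m hm] := h E UE.
by exists m => g gG _; exact: hm.
Qed.

Lemma gr_class_open m E : open ([set E' | lev Lam m E E'] : set (Gr V)).
Proof.
apply/gr_openP => E' /= h; exists m => g gG.
by apply: (lev_trans lL h); exists g.
Qed.

Lemma gr_nbhs E (U : set {vspace V}) : nbhs (E : Gr V) U <->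
  exists m, forall E', lev Lam m E E' -> U E'.
Proof.
split=> [|[m hm]].
  rewrite nbhsE => -[B [oB BE] BU].
  have [m hm] := (gr_openP B).1 oB E BE.
  by exists m => E' [g gG ->]; apply: BU; exact: hm.
rewrite nbhsE; exists [set E' | lev Lam m E E']; last by move=> E' /= /hm.
by split; [exact: gr_class_open|exact: lev_refl].
Qed.

Lemma grass_open k : open (@grass R F V k : set (Gr V)).
Proof.
apply/gr_openP => E dE; exists 0%N => g gG.
by rewrite /grass /= (GL_dim _ (GL_ker (congr_GL lL gG))).
Qed.

Lemma measurable_gr_open (U : set {vspace V}) : open (U : set (Gr V)) ->
  measurable (U : set (borelGr V)).
Proof. exact: sub_sigma_algebra. Qed.

Lemma measurable_grass k : measurable (@grass R F V k : set (borelGr V)).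
Proof. by apply: measurable_gr_open; exact: grass_open. Qed.

Lemma measurable_gr_class m E : measurable ([set E' | lev Lam m E E'] : set (borelGr V)).
Proof. by apply: measurable_gr_open; exact: gr_class_open. Qed.

Lemma measurable_GL : measurable (K : set (borel 'End(V))).
Proof.
apply: measurable_open; rewrite openE => g kg.
have [l hl] := GL_congr_nbhs 0 kg; apply/nbhs_bal; exists l => h /hl[u uG ->].
by apply: GLM kg; exact: congr_GL uG.
Qed.

(** The orbit map of a subspace carries the restriction of the additive Haar
    measure of End(V) to the group of the lattice, which is invariant under
    left multiplication, to an invariant measure on the Grassmannian. *)
Lemma gr_prob_exists k : (k <= \dim {:V})%N -> exists P : probability (borelGr V) R,
  P (@grass R F V k) = 1%E /\
  forall g (A : set {vspace V}), GLlat Lam g ->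
    measurable (A : set (borelGr V)) -> P [set (g @: E)%VS | E in A] = P A.
Proof.
move=> kV.
have [E0 dE0] : exists E0 : {vspace V}, \dim E0 = k.
  have [b hb] := obasis_exists lL fullv.
  have sb : size b = \dim {:V} := obasis_dim hb.
  exists <<take k b>>%VS; have : free (take k b).
    by have := basis_free hb.1; rewrite -{1}(cat_take_drop k b); exact: catl_free.
  by move=> /eqP ->; rewrite size_takel// sb.
pose f (g : 'End(V)) : {vspace V} := if `[< K g >] then (g @: E0)%VS else 0%VS.
have lE := endLam_latt lL.
have mf : measurable_fun setT (f : borel 'End(V) -> borelGr V).
  apply: (@measurability _ _ (borel 'End(V)) (borelGr V) _ _ (@open (Gr V)) erefl).
  move=> _ [U oU <-]; rewrite setTI.
  have -> : f @^-1` U = (K `&` [set g | U (g @: E0)%VS]) `|` (~` K `&` [set g : 'End(V) | U 0%VS]).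
    apply/seteqP; split=> g; rewrite /f /=; case: asboolP => kg; by [left|right|case=> -[]].
  apply: measurableU; last first.
    apply: measurableI; first by apply: measurableC; exact: measurable_GL.
    have [U0|U0] := pselect (U 0%VS).
      by rewrite (_ : [set g | _] = setT)//; apply/seteqP; split.
    by rewrite (_ : [set g | _] = set0)//; apply/seteqP; split.
  apply: measurable_open; rewrite openE => g [kg /= Ug].
  have [m hm] := (gr_openP U).1 oU _ Ug.
  have [l hl] := GL_congr_nbhs m kg; apply/nbhs_bal; exists l => h /hl[u uG ->].
  split; first by apply: GLM kg; exact: congr_GL uG.
  by rewrite /= limg_comp; exact: hm.
have mK := measurable_GL.
have [P0 hP0] := pushforward_measure (mrestr (stdh 'End(V)) mK) mf.
have P0E (A : set {vspace V}) : P0 A = stdh 'End(V) (K `&` [set g | A (g @: E0)%VS]).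
  rewrite hP0; congr (stdh _ _); apply/seteqP; split=> g; rewrite /f /=.
    by move=> [+ kg]; rewrite asboolT.
  by move=> [kg]; rewrite asboolT.
have KE : K `<=` endLam Lam by move=> g kg x Lx; exact: GL_mem.
have bK (A : set {vspace V}) : measurable (A : set (borelGr V)) ->
    bounded_borel (K `&` [set g : 'End(V) | A (g @: E0)%VS]).
  move=> mA; apply/bounded_borelE; split; last first.
    by apply: bnd_sub (bnd_latt lE) => g [/KE].
  have := mf measurableT A mA; rewrite setTI => mfA.
  rewrite (_ : K `&` _ = K `&` f @^-1` A); first exact: measurableI.
  by apply/seteqP; split=> g; rewrite /f /= => -[kg]; rewrite asboolT.
have inv0 g (A : set {vspace V}) : K g -> measurable (A : set (borelGr V)) ->
    P0 [set (g @: E)%VS | E in A] = P0 A.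
  move=> kg mA; rewrite !P0E.
  have lT : linear (fun h : 'End(V) => (g \o h)%VF).
    by move=> a u v; rewrite comp_lfunDr comp_lfunZr.
  pose T := mklin lT.
  have iT : lker T == 0%VS.
    apply/lker0P => u v; rewrite !mklinE => e.
    by rewrite -(lker0_compKf (GL_ker kg) u) e (lker0_compKf (GL_ker kg)).
  have sT : limg T = fullv by exact: lker0_limgf.
  (* The factor by which left multiplication changes volumes is read off on
     endLam, which it preserves. *)
  have TL : T @` endLam Lam = endLam Lam.
    apply/seteqP; split=> [_ [h hh <-] x Lx|h hh].
      by rewrite mklinE comp_lfunE; apply: (GL_mem kg); exact: hh.
    exists (g^-1 \o h)%VF; last by rewrite mklinE lker0_compVKf ?(GL_ker kg).
    by move=> x Lx; rewrite comp_lfunE; apply: GL_mem (GL_inv kg) _; exact: hh.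
  have [c c0 hc] := vol0_iso iT sT.
  have c1 : c = 1.
    have := hc (endLam Lam); rewrite TL => /esym/eqP; rewrite -subr_eq0 -{2}[vol0 _]mul1r -mulrBl.
    by rewrite mulf_eq0 subr_eq0 (gt_eqF (vol0_latt lE)) orbF => /eqP.
  have -> : K `&` [set h | [set (g @: E)%VS | E in A] (h @: E0)%VS] =
      T @` (K `&` [set h | A (h @: E0)%VS]).
    apply/seteqP; split=> h /=.
      move=> [kh [E AE hE]]; exists (g^-1 \o h)%VF; last by rewrite mklinE lker0_compVKf ?(GL_ker kg).
      split; first exact: GLM (GL_inv kg) kh.
      by rewrite /= limg_comp -hE limgK ?(GL_ker kg).
    move=> [h' [kh' Ah'] <-]; rewrite mklinE; split; first exact: GLM.
    by exists (h' @: E0)%VS; rewrite // limg_comp.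
  have bA := bK A mA.
  by rewrite !stdh_vol0// ?hc ?c1 ?mul1r//; apply/bounded_borel_iso.
have mT : measurable (setT : set (borelGr V)) by exact: measurableT.
have P0T : P0 setT = stdh 'End(V) K by rewrite P0E; congr (stdh _ _); apply/seteqP; split=> g //= [].
have bKT : bounded_borel K.
  have := bK setT mT; rewrite (_ : K `&` _ = K)//.
  by apply/seteqP; split=> g //= [].
(* The group contains the coset 1 + pi endLam. *)
have P0pos : 0 < vol0 K.
  have l1 : latt [set pi_ ^+ 1 *: x | x in endLam Lam] by apply: latt_scale lE; exact: unifX_neq0.
  have h1 : stdh 'End(V) [set (\1%VF : 'End(V)) + w | w in [set pi_ ^+ 1 *: x | x in endLam Lam]]
      = stdh 'End(V) [set pi_ ^+ 1 *: x | x in endLam Lam].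
    by apply: stdh_tinv; exact: measurable_latt.
  apply: lt_le_trans (vol0_latt l1) _; rewrite -lee_fin -!stdh_vol0//; last first.
    exact: bounded_borel_latt.
  rewrite -h1; apply: le_measure; rewrite ?inE//.
    by apply: measurable_translate; exact: measurable_latt.
  move=> _ [_ [w hw <-] <-]; apply: (@congr_GL _ _ _ _ lL 0).
  by apply/congr_grpE; exists w.
pose P : probability (borelGr V) R := mnormalize P0 (dirac (0%VS : borelGr V)).
have PE A : P A = (P0 A * ((vol0 K)^-1)%:E)%E.
  by rewrite /P /= /mnormalize P0T stdh_vol0// eqe (gt_eqF P0pos).
exists P; split.
  rewrite PE P0E (_ : K `&` _ = K).
    by rewrite stdh_vol0// -EFinM divff ?gt_eqF.
  apply/seteqP; split=> g /=; first by case.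
  by move=> kg; split=> //; rewrite /grass /= (GL_dim _ (GL_ker kg)).
by move=> g A kg mA; rewrite !PE inv0.
Qed.

End GrassmannianMeasure.

(** * Means of uniformly continuous functions *)

Section UniformContinuity.
Variables (R : realType) (T : eqType) (dom : T -> Prop) (lev : nat -> T -> T -> Prop).

Definition osc m (e : R) (F : T -> R) :=
  forall x y, dom x -> lev m x y -> `|F x - F y| <= e.

Definition ucont (F : T -> R) := forall e : R, 0 < e -> exists m, osc m e F.

End UniformContinuity.

Definition avg (R : realType) (T : eqType) (xs : seq T) (F : T -> R) : R :=
  (size xs)%:R^-1 * \sum_(x <- xs) F x.

(** A functional that is a limit of averages over finite sets representing the
    classes of finer and finer equivalence relations.  Linearity, positivity
    and the Fubini theorem follow from the corresponding facts on finite sums. *)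
Record mean (R : realType) := Mean {
  mpt : eqType;
  mdom : mpt -> Prop;
  mlev : nat -> mpt -> mpt -> Prop;
  mint : (mpt -> R) -> R;
  mlev_refl : forall m x, mlev m x x;
  mlev_sym : forall m x y, mlev m x y -> mlev m y x;
  mlev_trans : forall m x y z, mlev m x y -> mlev m y z -> mlev m x z;
  mlev_le : forall l m x y, (l <= m)%N -> mlev m x y -> mlev l x y;
  mlev_dom : forall m x y, mdom x -> mlev m x y -> mdom y;
  mconst : R;
  mconst_ge0 : 0 <= mconst;
  mean_approx : forall m, exists xs, [/\ xs != [::], (forall x, x \in xs -> mdom x),
    (forall x, mdom x -> exists2 y, y \in xs & mlev m y x) &
    forall F e, ucont mdom mlev F -> osc mdom mlev m e F ->
      `|mint F - avg xs F| <= mconst * e]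
}.

Arguments mint {R} _ _.

Section MeanTheory.
Variable R : realType.
Implicit Types M N : mean R.

Definition uc M (F : mpt M -> R) := ucont (@mdom R M) (@mlev R M) F.
Definition os M m e (F : mpt M -> R) := osc (@mdom R M) (@mlev R M) m e F.

Lemma avg_lin (T : eqType) (xs : seq T) (a : R) F G :
  avg xs (fun x => a * F x + G x) = a * avg xs F + avg xs G.
Proof. by rewrite /avg big_split /= -mulr_sumr mulrDr mulrCA. Qed.

Lemma avg_const (T : eqType) (xs : seq T) (c : R) : xs != [::] -> avg xs (fun=> c) = c.
Proof.
move=> xs0; rewrite /avg big_const_seq count_predT iter_addr_0 -[c *+ _]mulr_natl mulKf//.
by rewrite pnatr_eq0 size_eq0.
Qed.

Lemma avg_le (T : eqType) (xs : seq T) (F G : T -> R) :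
  (forall x, x \in xs -> F x <= G x) -> avg xs F <= avg xs G.
Proof.
move=> h; rewrite /avg ler_wpM2l ?invr_ge0//.
by rewrite big_seq [leRHS]big_seq ler_sum.
Qed.

Lemma avg_near (T : eqType) (xs : seq T) (F G : T -> R) e : xs != [::] ->
  (forall x, x \in xs -> `|F x - G x| <= e) -> `|avg xs F - avg xs G| <= e.
Proof.
move=> xs0 h; have -> : avg xs F - avg xs G = avg xs (fun x => F x - G x).
  by rewrite /avg sumrB mulrBr.
rewrite ler_norml -(avg_const (- e) xs0) -{2}(avg_const e xs0).
by apply/andP; split; apply: avg_le => x /h; rewrite ler_norml => /andP[].
Qed.

Lemma osc_le M m l (e : R) F : (m <= l)%N -> os (M:=M) m e F -> os (M:=M) l e F.
Proof. by move=> ml h x y dx /(mlev_le ml); exact: h. Qed.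

Lemma small_le0 (a C : R) : 0 <= C -> (forall e, 0 < e -> a <= C * e) -> a <= 0.
Proof.
move=> C0 h; rewrite leNgt; apply/negP => a0.
have C1 : 0 < C + 1 by rewrite ltr_wpDl.
have := h _ (divr_gt0 a0 C1); rewrite mulrA ler_pdivlMr// mulrDr mulr1 mulrC.
by rewrite gerDl leNgt a0.
Qed.

Lemma eq_small (a b C : R) : 0 <= C -> (forall e, 0 < e -> `|a - b| <= C * e) -> a = b.
Proof.
move=> C0 h; apply/eqP; rewrite -subr_eq0 -normr_le0; exact: small_le0 h.
Qed.

Lemma uc_ext M F G : uc (M:=M) F -> (forall x, mdom x -> F x = G x) -> uc (M:=M) G.
Proof.
move=> uF FG e /uF[m h]; exists m => x y dx xy.
by rewrite -!FG//; [exact: h|exact: mlev_dom xy].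
Qed.

Lemma uc_const M c : uc (M:=M) (fun=> c).
Proof. by move=> e e0; exists 0%N => x y _ _; rewrite subrr normr0 ltW. Qed.

Lemma uc_lc M m F : (forall x y, mdom x -> mlev m x y -> F x = F y) -> uc (M:=M) F.
Proof. by move=> h e e0; exists m => x y dx xy; rewrite (h x y)// subrr normr0 ltW. Qed.

Lemma uc_lin M a F G : uc (M:=M) F -> uc (M:=M) G -> uc (M:=M) (fun x => a * F x + G x).
Proof.
move=> uF uG e e0; have e2 : 0 < e / 2 / (`|a| + 1) by rewrite !divr_gt0// ltr_wpDl.
have [m hm] := uF _ e2; have [l hl] := uG _ (divr_gt0 e0 (ltr0n R 2)).
exists (maxn m l) => x y dx xy.
have := hm x y dx (mlev_le (leq_maxl m l) xy).
have := hl x y dx (mlev_le (leq_maxr m l) xy).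
move=> h1 h2; move: h2; rewrite ler_pdivlMr ?ltr_wpDl// => h2.
have -> : a * F x + G x - (a * F y + G y) = a * (F x - F y) + (G x - G y) by ring.
rewrite (le_trans (ler_normD _ _))// normrM.
have : `|a| * `|F x - F y| <= e / 2.
  by have := normr_ge0 (F x - F y); nra.
by lra.
Qed.

Lemma uc_bounded M F : uc (M:=M) F -> exists2 C, 0 <= C & forall x, mdom x -> `|F x| <= C.
Proof.
move=> uF; have [m hm] := uF 1 ltr01.
have [xs [_ dxs cxs _]] := mean_approx M m.
exists (1 + \sum_(y <- xs) `|F y|); first by rewrite addr_ge0// sumr_ge0.
move=> x dx; have [y ys yx] := cxs x dx.
rewrite -(subrK (F y) (F x)) (le_trans (ler_normD _ _))// lerD//.
  by rewrite distrC; apply: hm => //; exact: dxs.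
rewrite (big_rem y)//= lerDl sumr_ge0//.
Qed.

Lemma uc_mul M F G : uc (M:=M) F -> uc (M:=M) G -> uc (M:=M) (fun x => F x * G x).
Proof.
move=> uF uG; have [C C0 hC] := uc_bounded uF; have [D D0 hD] := uc_bounded uG.
move=> e e0; have C1 : 0 < C + 1 by rewrite ltr_wpDl.
have D1 : 0 < D + 1 by rewrite ltr_wpDl.
have e2 : 0 < e / 2 by rewrite divr_gt0.
have [m hm] := uF _ (divr_gt0 e2 D1); have [l hl] := uG _ (divr_gt0 e2 C1).
exists (maxn m l) => x y dx xy.
have := hm x y dx (mlev_le (leq_maxl m l) xy).
have := hl x y dx (mlev_le (leq_maxr m l) xy).
rewrite !ler_pdivlMr// => h1 h2.
have -> : F x * G x - F y * G y = F x * (G x - G y) + (F x - F y) * G y by ring.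
rewrite (le_trans (ler_normD _ _))// !normrM.
have hx := hC x dx; have hy := hD y (mlev_dom dx xy).
have a1 : `|F x| * `|G x - G y| <= e / 2.
  by have := ler_wpM2r (normr_ge0 (G x - G y)) hx; have := normr_ge0 (G x - G y); nra.
have a2 : `|F x - F y| * `|G y| <= e / 2.
  by have := ler_wpM2l (normr_ge0 (F x - F y)) hy; have := normr_ge0 (F x - F y); nra.
by lra.
Qed.

Lemma uc_sum M (I : Type) (s : seq I) (P : pred I) (F : I -> _ -> R) :
  (forall i, uc (M:=M) (F i)) -> uc (M:=M) (fun x => \sum_(i <- s | P i) F i x).
Proof.
move=> uF; elim: s => [|i s ih].
  by apply: uc_ext (uc_const M 0) _ => x _; rewrite big_nil.
have [Pi|nPi] := boolP (P i).
  apply: uc_ext (uc_lin 1 (uF i) ih) _ => x _.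
  by rewrite big_cons Pi mul1r.
by apply: uc_ext ih _ => x _; rewrite big_cons (negbTE nPi).
Qed.

Lemma mean_approx2 M (e : R) F G : 0 < e -> uc (M:=M) F -> uc (M:=M) G ->
  exists xs, [/\ xs != [::], (forall x, x \in xs -> @mdom R M x),
    `|mint M F - avg xs F| <= mconst M * e & `|mint M G - avg xs G| <= mconst M * e].
Proof.
move=> e0 uF uG; have [m hm] := uF e e0; have [l hl] := uG e e0.
have [xs [x0 dx _ h]] := mean_approx M (maxn m l).
exists xs; split=> //; apply: h => //.
  by apply: osc_le hm; rewrite leq_maxl.
by apply: osc_le hl; rewrite leq_maxr.
Qed.

Lemma mean_lin M a F G : uc (M:=M) F -> uc (M:=M) G ->
  mint M (fun x => a * F x + G x) = a * mint M F + mint M G.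
Proof.
move=> uF uG; have uL := uc_lin a uF uG.
have C0 := mconst_ge0 M.
apply: (@eq_small _ _ (mconst M * (1 + `|a| + 1))).
  by rewrite mulr_ge0// !addr_ge0.
move=> e e0; have [m hm] := uF e e0; have [l hl] := uG e e0; have [k hk] := uL e e0.
have [xs [x0 dx _ h]] := mean_approx M (maxn (maxn m l) k).
have h1 : `|mint M F - avg xs F| <= mconst M * e.
  by apply: h => //; apply: osc_le hm; rewrite -maxnA leq_maxl.
have h2 : `|mint M G - avg xs G| <= mconst M * e.
  by apply: h => //; apply: osc_le hl; rewrite maxnAC leq_maxr.
have h3 : `|mint M (fun x => a * F x + G x) - avg xs (fun x => a * F x + G x)| <= mconst M * e.
  by apply: h => //; apply: osc_le hk; rewrite leq_maxr.
rewrite avg_lin in h3.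
have h4 : `|a * (mint M F - avg xs F)| <= `|a| * (mconst M * e) by rewrite normrM ler_wpM2l.
move: h2 h3 h4; rewrite !ler_norml => /andP[] ? ? /andP[] ? ? /andP[] ? ?.
by apply/andP; split; nra.
Qed.

Lemma mean_le M F G : uc (M:=M) F -> uc (M:=M) G -> (forall x, mdom x -> F x <= G x) ->
  mint M F <= mint M G.
Proof.
move=> uF uG FG; rewrite -subr_le0; have C0 := mconst_ge0 M.
apply: (@small_le0 _ (mconst M * 2)); first by rewrite mulr_ge0.
move=> e e0; have [xs [x0 dx h1 h2]] := mean_approx2 e0 uF uG.
have h3 : avg xs F <= avg xs G by apply: avg_le => x /dx/FG.
move: h1 h2; rewrite !ler_norml => /andP[] ? ? /andP[] ? ?.
by lra.
Qed.

Lemma mean_ext M F G : uc (M:=M) F -> (forall x, mdom x -> F x = G x) ->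
  mint M F = mint M G.
Proof.
move=> uF FG; have uG := uc_ext uF FG.
by apply/eqP; rewrite eq_le !mean_le// => x /FG ->.
Qed.

Lemma mean_const M c : mint M (fun=> c) = c.
Proof.
apply: (eq_small (mconst_ge0 M)) => e e0.
have [xs [x0 _ h _]] := mean_approx2 e0 (uc_const M c) (uc_const M c).
by rewrite avg_const in h.
Qed.

Lemma mean_const_in M c F : (forall x, mdom x -> F x = c) -> mint M F = c.
Proof. by move=> h; rewrite -(mean_const M c); apply/esym/mean_ext => [|x /h ->//]; exact: uc_const. Qed.

Lemma meanZ M a F : uc (M:=M) F -> mint M (fun x => a * F x) = a * mint M F.
Proof.
move=> uF; have := mean_lin a uF (uc_const M 0); rewrite mean_const addr0 => <-.
apply/esym; apply: mean_ext => [|x _]; last by rewrite addr0.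
exact: uc_lin uF (uc_const M 0).
Qed.

Lemma meanD M F G : uc (M:=M) F -> uc (M:=M) G -> mint M (fun x => F x + G x) = mint M F + mint M G.
Proof.
move=> uF uG; rewrite -{1}[mint M F]mul1r -mean_lin//; apply: mean_ext => [|x _].
  by apply: uc_ext (uc_lin 1 uF uG) _ => x _; rewrite mul1r.
by rewrite mul1r.
Qed.

Lemma mean_sum M (I : Type) (s : seq I) (P : pred I) (F : I -> _ -> R) :
  (forall i, uc (M:=M) (F i)) ->
  mint M (fun x => \sum_(i <- s | P i) F i x) = \sum_(i <- s | P i) mint M (F i).
Proof.
move=> uF; elim: s => [|i s ih].
  by rewrite big_nil; apply: mean_const_in => x _; rewrite big_nil.
rewrite big_cons; case: ifPn => [Pi|nPi]; last first.
  rewrite -ih; apply: mean_ext => [|x _]; last by rewrite big_cons (negbTE nPi).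
  by apply: uc_ext (uc_sum s P uF) _ => x _; rewrite big_cons (negbTE nPi).
rewrite -ih -meanD//; last exact: uc_sum.
apply: mean_ext => [|x _]; last by rewrite big_cons Pi.
by apply: uc_ext (uc_sum (i :: s) P uF) _ => x _.
Qed.

Lemma mean_abs M F C : uc (M:=M) F -> (forall x, mdom x -> `|F x| <= C) ->
  `|mint M F| <= C.
Proof.
move=> uF h; rewrite ler_norml -(mean_const M (- C)) -{2}(mean_const M C).
by apply/andP; split; apply: mean_le => //; try exact: uc_const;
  move=> x /h; rewrite ler_norml => /andP[].
Qed.

Lemma mean_near M F G C : uc (M:=M) F -> uc (M:=M) G -> (forall x, mdom x -> `|F x - G x| <= C) ->
  `|mint M F - mint M G| <= C.
Proof.
move=> uF uG h; have -> : mint M F - mint M G = mint M (fun x => -1 * G x + F x).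
  by rewrite mean_lin// mulN1r addrC.
by apply: mean_abs => [|x /h]; [exact: uc_lin|rewrite mulN1r addrC].
Qed.

(** A nonnegative function that does not vanish has a positive mean, because
    the class of a point has positive weight. *)
Lemma mean_gt0 M F x0 : uc (M:=M) F -> (forall x, mdom x -> 0 <= F x) ->
  mdom x0 -> 0 < F x0 -> 0 < mint M F.
Proof.
move=> uF F0 dx0 Fx0; have e0 : 0 < F x0 / 2 by rewrite divr_gt0.
have [m hm] := uF _ e0.
pose I (x : mpt M) : R := if `[< mlev m x0 x >] then 1 else 0.
have oI : os (M:=M) m 0 I.
  move=> x y dx xy; rewrite /I.
  have -> : `[< mlev m x0 x >] = `[< mlev m x0 y >].
    apply: asbool_equiv_eq; split=> h; first exact: mlev_trans h xy.
    by apply: mlev_trans h _; exact: mlev_sym.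
  by rewrite subrr normr0.
have uI : uc (M:=M) I.
  by move=> e e1; exists m => x y dx xy; rewrite (le_trans (oI x y dx xy))// ltW.
have [xs [xs0 dxs cxs h]] := mean_approx M m.
have := h I 0 uI oI; rewrite mulr0 normr_le0 subr_eq0 => /eqP hI.
have I0 : 0 < mint M I.
  have [y ys yx] := cxs x0 dx0.
  rewrite hI /avg mulr_gt0// ?invr_gt0 ?ltr0n ?lt0n ?size_eq0//.
  rewrite (big_rem y)//= {1}/I asboolT; last exact: mlev_sym.
  by rewrite ltr_wpDr// sumr_ge0// => x _; rewrite /I; case: ifP.
apply: lt_le_trans (mulr_gt0 e0 I0) _; rewrite -meanZ//; apply: mean_le => //.
  apply: uc_ext (uc_lin (F x0 / 2) uI (uc_const M 0)) _ => x _.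
  by rewrite addr0.
move=> x dx; rewrite /I; case: asboolP => hx; last by rewrite mulr0 F0.
by have := hm x0 x dx0 hx; rewrite mulr1 ler_norml => /andP[]; lra.
Qed.

Section Product.
Variables M N : mean R.

Let pdom (z : mpt M * mpt N) := mdom z.1 /\ mdom z.2.
Let plev m (z w : mpt M * mpt N) := mlev m z.1 w.1 /\ mlev m z.2 w.2.
Let pint (F : mpt M * mpt N -> R) := mint M (fun x => mint N (fun y => F (x, y))).

Let prefl m z : plev m z z. Proof. by split; exact: mlev_refl. Qed.
Let psym m z w : plev m z w -> plev m w z.
Proof. by move=> [h1 h2]; split; exact: mlev_sym. Qed.
Let ptrans m z w u : plev m z w -> plev m w u -> plev m z u.
Proof. by move=> [h1 h2] [h3 h4]; split; [exact: mlev_trans h3|exact: mlev_trans h4]. Qed.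
Let ple l m z w : (l <= m)%N -> plev m z w -> plev l z w.
Proof. by move=> lm [h1 h2]; split; exact: mlev_le lm _. Qed.
Let pdomlev m z w : pdom z -> plev m z w -> pdom w.
Proof. by move=> [d1 d2] [h1 h2]; split; [exact: mlev_dom h1|exact: mlev_dom h2]. Qed.

Lemma uc_slice F x : mdom x -> ucont pdom plev F -> uc (M:=N) (fun y => F (x, y)).
Proof.
move=> dx uF e /uF[m hm]; exists m => y y' dy yy'.
by apply: hm; split => //=; exact: mlev_refl.
Qed.

Lemma osc_slice m e F : ucont pdom plev F -> osc pdom plev m e F ->
  os (M:=M) m e (fun x => mint N (fun y => F (x, y))).
Proof.
move=> uF hF x x' dx xx'; have dx' := mlev_dom dx xx'.
apply: mean_near; try exact: uc_slice.
by move=> y dy; apply: hF; split => //=; exact: mlev_refl.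
Qed.

Lemma uc_slice_int F : ucont pdom plev F -> uc (M:=M) (fun x => mint N (fun y => F (x, y))).
Proof. by move=> uF e /[dup] e0 /uF[m hm]; exists m; exact: osc_slice. Qed.

Lemma avg_allpairs (xs : seq (mpt M)) (ys : seq (mpt N)) (F : mpt M * mpt N -> R) :
  avg [seq (x, y) | x <- xs, y <- ys] F = avg xs (fun x => avg ys (fun y => F (x, y))).
Proof.
rewrite /avg size_allpairs natrM invfM -mulrA big_allpairs; congr (_ * _).
by rewrite mulr_sumr.
Qed.

Let papprox m : exists xs : seq (mpt M * mpt N), [/\ xs != [::], (forall x, x \in xs -> pdom x),
    (forall x, pdom x -> exists2 y, y \in xs & plev m y x) &
    forall F e, ucont pdom plev F -> osc pdom plev m e F ->
      `|pint F - avg xs F| <= (mconst M + mconst N) * e].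
Proof.
have [xs [xs0 dxs cxs hx]] := mean_approx M m.
have [ys [ys0 dys cys hy]] := mean_approx N m.
exists [seq (x, y) | x <- xs, y <- ys]; split.
- by rewrite -size_eq0 size_allpairs muln_eq0 !size_eq0 negb_or xs0.
- by move=> _ /allpairsP[[x y] [/= /dxs ? /dys ? ->]].
- move=> [x y] [/= /cxs[x' x'xs h1] /cys[y' y'ys h2]].
  by exists (x', y'); [apply: allpairs_f|split].
move=> F e uF oF; rewrite avg_allpairs.
rewrite -(subrKA (avg xs (fun x => mint N (fun y => F (x, y))))) mulrDl.
rewrite (le_trans (ler_normD _ _))// lerD//.
  by apply: hx; [exact: uc_slice_int|exact: osc_slice].
apply: avg_near => // x /dxs dx; apply: hy; first exact: uc_slice.
by move=> y y' dy yy'; apply: oF; split => //=; exact: mlev_refl.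
Qed.

Definition mean_prod : mean R :=
  @Mean R _ pdom plev pint prefl psym ptrans ple pdomlev
    (mconst M + mconst N) (addr_ge0 (mconst_ge0 M) (mconst_ge0 N)) papprox.

End Product.

Lemma uc_swap M N F : uc (M:=mean_prod M N) F -> uc (M:=mean_prod N M) (fun z => F (z.2, z.1)).
Proof.
by move=> uF e /uF[m hm]; exists m => -[x y] [x' y'] [/= dx dy] [/= h1 h2]; apply: hm; split.
Qed.

(** Both iterated means are close to the same double average. *)
Lemma mean_fubini M N F : uc (M:=mean_prod M N) F ->
  mint M (fun x => mint N (fun y => F (x, y))) =
  mint N (fun y => mint M (fun x => F (x, y))).
Proof.
move=> uF; have uF' := uc_swap uF; have CM := mconst_ge0 M; have CN := mconst_ge0 N.
apply: (@eq_small _ _ ((mconst M + mconst N) * 2)); first by rewrite mulr_ge0// addr_ge0.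
move=> e e0; have [m hm] := uF e e0.
have [xs [xs0 dxs cxs hx]] := mean_approx M m.
have [ys [ys0 dys cys hy]] := mean_approx N m.
have hm' : osc (@mdom R (mean_prod N M)) (@mlev R (mean_prod N M)) m e (fun z => F (z.2, z.1)).
  by move=> [x y] [x' y'] [/= dx dy] [/= h1 h2]; apply: hm; split.
have h1 : `|mint M (fun x => mint N (fun y => F (x, y))) -
    avg xs (fun x => avg ys (fun y => F (x, y)))| <= (mconst M + mconst N) * e.
  rewrite -(subrKA (avg xs (fun x => mint N (fun y => F (x, y))))) mulrDl.
  rewrite (le_trans (ler_normD _ _))// lerD//.
    by apply: hx; [exact: (uc_slice_int uF)|exact: osc_slice].
  apply: avg_near => // x /dxs dx; apply: hy; first exact: (uc_slice dx uF).
  by move=> y y' dy yy'; apply: hm; split => //=; exact: mlev_refl.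
have h2 : `|mint N (fun y => mint M (fun x => F (x, y))) -
    avg ys (fun y => avg xs (fun x => F (x, y)))| <= (mconst M + mconst N) * e.
  rewrite -(subrKA (avg ys (fun y => mint M (fun x => F (x, y))))) addrC mulrDl.
  rewrite (le_trans (ler_normD _ _))// lerD//.
    apply: avg_near => // y /dys dy; apply: hx; first exact: (uc_slice dy uF').
    by move=> x x' dx xx'; apply: hm; split => //=; exact: mlev_refl.
  by apply: hy; [exact: (uc_slice_int uF')|exact: (osc_slice uF' hm')].
have h3 : avg xs (fun x => avg ys (fun y => F (x, y))) = avg ys (fun y => avg xs (fun x => F (x, y))).
  rewrite /avg -!mulr_sumr mulrCA; congr (_ * (_ * _)); exact: exchange_big.
rewrite h3 in h1; move: h1 h2; rewrite !ler_norml => /andP[] ? ? /andP[] ? ?.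
by apply/andP; split; lra.
Qed.

Lemma uc_fst M N F : uc (M:=M) F -> uc (M:=mean_prod M N) (fun z => F z.1).
Proof. by move=> uF e /uF[m hm]; exists m => -[x y] [x' y'] [/= dx dy] [/= h1 h2]; exact: hm. Qed.

Lemma uc_snd M N F : uc (M:=N) F -> uc (M:=mean_prod M N) (fun z => F z.2).
Proof. by move=> uF e /uF[m hm]; exists m => -[x y] [x' y'] [/= dx dy] [/= h1 h2]; exact: hm. Qed.

End MeanTheory.

(** * Integrals over Grassmannians as means *)

Section GrassmannianMean.
Variables (R : realType) (F : nonArchLocalFieldType R) (V : vectType F).
Variables (Lam : set V) (lL : latt Lam).
Implicit Types (g h : 'End(V)) (E L : {vspace V}).
Local Notation K := (GLlat Lam).
Variables (k : nat) (hk : (k <= \dim {:V})%N).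
Local Notation P := (gr_prob Lam k).
Local Notation gr := (@grass R F V k).

Definition gr_dom E := \dim E = k.
Definition gr_int_real (f : {vspace V} -> R) : R := \int[P]_(L in gr) f L.

Lemma gr_probP : P gr = 1%E /\ forall g (A : set {vspace V}), K g ->
  measurable (A : set (borelGr V)) -> P [set (g @: E)%VS | E in A] = P A.
Proof.
have [Q hQ] := gr_prob_exists lL hk.
exact: (@xgetPex _ _ [set P0 : probability (borelGr V) R | P0 gr = 1%E /\
  forall g (A : set {vspace V}), K g -> measurable (A : set (borelGr V)) ->
    P0 [set (g @: E)%VS | E in A] = P0 A] (ex_intro _ Q hQ)).
Qed.

Local Notation ucg := (ucont gr_dom (lev Lam)).
Local Notation oscg := (osc gr_dom (lev Lam)).

Lemma gr_ucont_measurable (f : {vspace V} -> R) : ucg f -> measurable_fun (gr : set (borelGr V)) f.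
Proof.
move=> uf _; apply: (measurability _ (measurable_realfun.RGenOInfty.measurableE R)) => //; last first.
  exact: (measurable_grass lL k).
move=> _ [_ [a ->] <-]; apply: measurable_gr_open; apply/(gr_openP lL) => E [dE /=].
rewrite in_itv /= andbT => aE.
have e0 : 0 < (f E - a) / 2 by rewrite divr_gt0// subr_gt0.
have [m hm] := uf _ e0; exists m => g gG; split.
  by rewrite /grass /= (GL_dim _ (GL_ker (congr_GL lL gG))).
rewrite /= in_itv /= andbT.
have := hm E (g @: E)%VS dE (ex_intro2 _ _ g gG erefl).
by rewrite ler_norml => /andP[_]; lra.
Qed.

Lemma gr_ucont_integrable f (A : set {vspace V}) : ucg f -> measurable (A : set (borelGr V)) ->
  A `<=` gr -> P.-integrable A (EFin \o f).
Proof.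
move=> uf mA Agr; apply: measurable_bounded_integrable => //.
- by apply: le_lt_trans (probability_le1 P mA) _; exact: ltry.
- exact: (@measurable_funS _ _ (borelGr V) _ _ _ _ (measurable_grass lL k) Agr (gr_ucont_measurable uf)).
have [m hm] := uf 1 ltr01; have [xs [_ dxs cxs _]] := gr_reps lL m k.
exists (1 + \sum_(y <- xs) `|f y|); split; first exact: num_real.
move=> M MC E /= AE; rewrite (le_trans _ (ltW MC))//.
have [y ys yE] := cxs E (Agr _ AE).
rewrite -(subrK (f y) (f E)) (le_trans (ler_normD _ _))// lerD//.
  by rewrite distrC; apply: hm yE; exact: dxs.
by rewrite (big_rem y)//= lerDl sumr_ge0.
Qed.

Definition gr_class m E : set {vspace V} := [set E' | lev Lam m E E'].

Lemma gr_class_sub m E : \dim E = k -> gr_class m E `<=` gr.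
Proof. by move=> dE E' /(lev_dim lL); rewrite /grass /= => ->. Qed.

Lemma measurable_class m E : measurable (gr_class m E : set (borelGr V)).
Proof. exact: measurable_gr_class. Qed.

(** Classes of the same scale are permuted transitively, hence have equal
    probability. *)
Lemma gr_class_prob m E E' : \dim E = \dim E' -> P (gr_class m E) = P (gr_class m E').
Proof.
move=> dE; have [g kg ->] := GL_transitive lL dE.
have [_ /(_ g (gr_class m E) kg (measurable_class m E)) <-] := gr_probP.
congr (P _); apply/seteqP; split=> A /=; first by move=> [B EB <-]; exact: lev_GL.
move=> hA; exists (g^-1 @: A)%VS; last by rewrite limgVK// (GL_ker kg).
rewrite /gr_class /= -[E](limgK _ (GL_ker kg)); apply: lev_GL => //.
exact: GL_inv.
Qed.

(** The classes of the representatives have equal probability, and f varies by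
    at most e on each of them. *)
Lemma gr_int_approx m (xs : seq {vspace V}) f e : uniq xs ->
  (forall x, x \in xs -> \dim x = k) ->
  (forall E, \dim E = k -> exists2 x, x \in xs & lev Lam m x E) ->
  (forall x y, x \in xs -> y \in xs -> lev Lam m x y -> x = y) ->
  ucg f -> oscg m e f -> `|gr_int_real f - avg xs f| <= e.
Proof.
move=> uxs dxs cxs ixs uf of_.
have [x0 x0s] : exists x0, x0 \in xs.
  have [P1 _] := gr_probP.
  have [[E dE]|n] := pselect (exists E : {vspace V}, \dim E = k).
    by have [x xs' _] := cxs E dE; exists x.
  exfalso; have : gr = set0 by apply/seteqP; split=> E //= dE; apply: n; exists E.
  by move=> g0; move: P1; rewrite g0 measure0 => /eqP; rewrite eqe eq_sym oner_eq0.
set p := fine (P (gr_class m x0)).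
have pE x : x \in xs -> P (gr_class m x) = p%:E.
  move=> /dxs dx; rewrite (@gr_class_prob m x x0) ?dx ?dxs// fineK//.
  rewrite ge0_fin_numE ?measure_ge0//.
  by apply: le_lt_trans (probability_le1 P (measurable_class m x0)) _; exact: ltry.
have p0 : 0 <= p by rewrite fine_ge0// measure_ge0.
pose U (s : seq {vspace V}) : set {vspace V} := [set E | exists2 x, x \in s & lev Lam m x E].
have UU x s : U (x :: s) = gr_class m x `|` U s.
  apply/seteqP; split=> E /=.
    by move=> [y]; rewrite inE => /orP[/eqP ->|ys] h; [left|right; exists y].
  by move=> [h|[y ys h]]; [exists x|exists y] => //; rewrite inE ?eqxx ?ys ?orbT.
have mU s : measurable (U s : set (borelGr V)).
  elim: s => [|x s ih]; first by rewrite (_ : U [::] = set0)//; apply/seteqP; split=> E //= [].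
  by rewrite UU; apply: measurableU => //; exact: measurable_class.
have main s : uniq s -> {subset s <= xs} ->
    P (U s) = ((size s)%:R * p)%:E /\
    `|\int[P]_(L in U s) f L - p * \sum_(x <- s) f x| <= e * (p * (size s)%:R).
  elim: s => [|x s ih] us sxs.
    have -> : U [::] = set0 by apply/seteqP; split=> E //= [].
    by rewrite measure0 mul0r Rintegral_set0 big_nil !mulr0 subrr normr0.
  have [us1 us2] := andP us.
  have [|ih1 ih2] := ih us2; first by move=> y ys; apply: sxs; rewrite inE ys orbT.
  have xx : x \in xs by apply: sxs; rewrite inE eqxx.
  have disj : gr_class m x `&` U s = set0.
    apply/seteqP; split=> E //= -[h1 [y ys h2]].
    have : x = y.
      apply: ixs => //; first by apply: sxs; rewrite inE ys orbT.
      exact: (lev_trans lL h1 (lev_sym lL h2)).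
    by move=> xy; move: us1; rewrite xy ys.
  have Ugr : gr_class m x `|` U s `<=` gr.
    move=> E [/gr_class_sub|[y ys h]]; first by apply; exact: dxs.
    by rewrite /grass /= (lev_dim lL h) dxs//; apply: sxs; rewrite inE ys orbT.
  have mx := measurable_class m x.
  have ix : P.-integrable (gr_class m x) (EFin \o f).
    by apply: gr_ucont_integrable => //; exact: subset_trans (@subsetUl _ _ _) Ugr.
  have ic : P.-integrable (gr_class m x) (EFin \o (fun=> f x)).
    by apply: gr_ucont_integrable => //; [move=> e' e0'; exists 0%N => ? ? _ _ /=; rewrite subrr normr0 ltW|exact: subset_trans (@subsetUl _ _ _) Ugr].
  rewrite UU; split.
    have hU : P (gr_class m x `|` U s) = (P (gr_class m x) + P (U s))%E by rewrite measureU.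
    transitivity (p%:E + ((size s)%:R * p)%:E)%E; first by rewrite hU; congr (_ + _)%E => //; exact: pE.
    by rewrite -EFinD /= -natr1 mulrDl mul1r addrC.
  rewrite Rintegral_setU//; last 2 first.
  - by apply: gr_ucont_integrable => //; exact: measurableU.
  - by apply/disj_setPS; rewrite disj.
  have hc c : \int[P]_(L in gr_class m x) c = p * c.
    by rewrite Rintegral_cst// mulrC; congr (_ * _); have := pE x xx => /(congr1 fine).
  have hx : `|\int[P]_(L in gr_class m x) f L - p * f x| <= e * p.
    have -> : p * f x = \int[P]_(L in gr_class m x) f x.
      by rewrite hc.
    rewrite -RintegralB// (le_trans (le_normr_Rintegral _ _))//.
      have -> : (fun L => f L - f x) = (fun L => f L + (-1) * f x) by apply/funext => L; rewrite mulN1r.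
      apply: gr_ucont_integrable => //; last exact: subset_trans (@subsetUl _ _ _) Ugr.
      by move=> e' /uf[l hl]; exists l => y y' dy yy'; rewrite /= opprD addrACA subrr addr0; exact: hl.
    have -> : e * p = \int[P]_(L in gr_class m x) e by rewrite hc mulrC.
    apply: le_Rintegral => //.
    - apply: gr_ucont_integrable => //; last exact: subset_trans (@subsetUl _ _ _) Ugr.
      move=> e' /uf[l hl]; exists l => y y' dy yy'.
      rewrite (le_trans (ler_dist_dist _ _))// opprB addrA subrK; exact: hl.
    - apply: gr_ucont_integrable => //; last exact: subset_trans (@subsetUl _ _ _) Ugr.
      by move=> e' e0'; exists 0%N => ? ? _ _ /=; rewrite subrr normr0 ltW.
    by move=> L xL; rewrite distrC; apply: of_ => //; exact: dxs.
  rewrite big_cons /= -natr1 !mulrDr mulr1 opprD addrACA.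
  by rewrite (le_trans (ler_normD _ _))// [leRHS]addrC lerD.
have Uxs : U xs = gr.
  apply/seteqP; split=> E /=; last by move=> /cxs.
  by move=> [x /dxs dx h]; rewrite /grass /= (lev_dim lL h).
have [h1 h2] := main xs uxs (fun _ => id).
have N0 : (size xs)%:R != 0 :> R.
  by rewrite pnatr_eq0; case: (xs) x0s.
have pV : p = (size xs)%:R^-1.
  move: h1; rewrite Uxs (gr_probP.1) => -[h1].
  by apply: (mulfI N0); rewrite mulfV// h1.
rewrite Uxs pV mulVf// mulr1 in h2.
by rewrite /avg.
Qed.

Lemma gr_mean_approx m : exists xs, [/\ xs != [::], (forall x, x \in xs -> gr_dom x),
    (forall x, gr_dom x -> exists2 y, y \in xs & lev Lam m y x) &
    forall f e, ucg f -> oscg m e f -> `|gr_int_real f - avg xs f| <= 1 * e].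
Proof.
have [xs [u d c i]] := gr_reps lL m k; exists xs; split=> //.
  apply/eqP => xs0; have [P1 _] := gr_probP.
  have : gr = set0.
    by apply/seteqP; split=> E //= /c[x]; rewrite xs0.
  by move=> g0; move: P1; rewrite g0 measure0 => /eqP; rewrite eqe eq_sym oner_eq0.
by move=> f e uf of_; rewrite mul1r; exact: (gr_int_approx u d c i uf of_).
Qed.

Lemma gr_dom_lev m x y : gr_dom x -> lev Lam m x y -> gr_dom y.
Proof. by rewrite /gr_dom => <- /(lev_dim lL). Qed.

Definition gr_mean : mean R := @Mean R _ gr_dom (lev Lam) gr_int_real
  (@lev_refl _ _ _ _ lL) (@lev_sym _ _ _ _ lL) (@lev_trans _ _ _ _ lL)
  (fun l m x y => @lev_le _ _ _ _ lL m l x y) gr_dom_lev 1 ler01 gr_mean_approx.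

(** Both a system of representatives and its image under an element of the
    group compute the integral. *)
Lemma gr_mean_invariant g f : K g -> uc (M:=gr_mean) f ->
  mint gr_mean (fun E => f (g @: E)%VS) = mint gr_mean f.
Proof.
move=> kg uf; have ig := GL_ker kg.
have uf' : uc (M:=gr_mean) (fun E => f (g @: E)%VS).
  move=> e /uf[m hm]; exists m => x y dx xy; apply: hm; last exact: lev_GL.
  by rewrite /= /gr_dom GL_dim.
apply: (@eq_small _ _ _ 2) => // e e0; have [m hm] := uf e e0.
have hm' : os (M:=gr_mean) m e (fun E => f (g @: E)%VS).
  move=> x y dx xy; apply: hm; last exact: lev_GL.
  by rewrite /= /gr_dom GL_dim.
have [xs [u d c i]] := gr_reps lL m k.
have h1 := gr_int_approx u d c i uf' hm'.
have h2 : `|gr_int_real f - avg [seq (g @: x)%VS | x <- xs] f| <= e.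
  apply: (@gr_int_approx m) => //.
  - by rewrite map_inj_uniq// => x y h; rewrite -(limgK x ig) h limgK.
  - by move=> _ /mapP[x /d dx ->]; rewrite GL_dim.
  - move=> E dE; have [|x xs' hx] := c (g^-1 @: E)%VS; first by rewrite GL_dim// lker0_inv.
    by exists (g @: x)%VS; [exact: map_f|rewrite -(limgVK E ig); exact: lev_GL].
  - move=> _ _ /mapP[x xs' ->] /mapP[y ys ->] h; rewrite (i x y)//.
    by rewrite -(limgK x ig) -(limgK y ig); apply: lev_GL => //; exact: GL_inv.
have e3 : avg [seq (g @: x)%VS | x <- xs] f = avg xs (fun E => f (g @: E)%VS).
  by rewrite /avg size_map big_map.
rewrite e3 in h2; move: h1 h2; rewrite /= !ler_norml => /andP[] ? ? /andP[] ? ?.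
by apply/andP; split; lra.
Qed.

End GrassmannianMean.

(** * The kernel of the averaging transforms *)

Section Quotients.
Variables (K : fieldType) (V : vectType K).
Implicit Types (E L : {vspace V}) (W : vectType K).

Lemma quot_proj_linear L : linear (@quot_proj K V L).
Proof. by move=> a u v; rewrite quot_projD quot_projZ. Qed.

Definition qp L : 'Hom(V, quot L) := mklin (quot_proj_linear L).

Lemma qpE L x : qp L x = quot_proj L x. Proof. exact: mklinE. Qed.

Definition inc E : 'Hom(subvs_of E, V) := linfun vsval.

Lemma incE E x : inc E x = vsval x. Proof. by rewrite lfunE. Qed.

Lemma limg_surj (U W : vectType K) (T : 'Hom(U, W)) : (forall w, exists v, T v = w) -> limg T = fullv.
Proof.
move=> h; apply/eqP; rewrite eqEsubv subvf; apply/subvP => w _.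
by have [v <-] := h w; rewrite memv_img ?memvf.
Qed.

Lemma surj_limg (U W : vectType K) (T : 'Hom(U, W)) w : limg T = fullv -> exists v, T v = w.
Proof.
by move=> h; have := memvf w; rewrite -h => /memv_imgP[v _ ->]; exists v.
Qed.

Lemma quot_proj_val L (w : quot L) : quot_proj L (vsval w) = w.
Proof.
have dLC : (L^C :&: L = 0)%VS by rewrite capvC capv_compl.
apply: val_inj; rewrite /= vsprojK ?memv_pi //.
by rewrite daddv_pi_id // subvsP.
Qed.

Lemma limg_qp L : limg (qp L) = fullv.
Proof. by apply: limg_surj => w; exists (vsval w); rewrite qpE quot_proj_val. Qed.

Lemma lker_qp L : lker (qp L) = L.
Proof. by apply/vspaceP => v; rewrite memv_ker qpE quot_proj_eq0. Qed.

Lemma lker_inc E : lker (inc E) == 0%VS.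
Proof. by apply/lker0P => u v; rewrite !incE => /val_inj. Qed.

Lemma limg_inc E : limg (inc E) = E.
Proof.
apply/vspaceP => v; apply/memv_imgP/idP => [[u _ ->]|vE]; first by rewrite incE subvsP.
by exists (vsproj E v); rewrite ?memvf// incE vsprojK.
Qed.

Lemma dim_subvs E : \dim {: subvs_of E} = \dim E. Proof. exact: dimvf. Qed.

Lemma dim_quot L : \dim {: quot L} = (\dim {:V} - \dim L)%N.
Proof. by rewrite dim_subvs dimv_compl. Qed.

Lemma quot_factor W (T : 'Hom(V, W)) L : limg T = fullv -> lker T = L ->
  exists U : 'Hom(quot L, W), [/\ lker U == 0%VS, limg U = fullv &
    forall x, T x = U (quot_proj L x)].
Proof.
move=> sT kT; exists (T \o inc L^C)%VF.
have UE x : T x = (T \o inc L^C)%VF (quot_proj L x).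
  rewrite comp_lfunE incE; apply/eqP; rewrite -subr_eq0 -linearB -memv_ker kT.
  by rewrite -quot_proj_eq0 -qpE linearB /= !qpE quot_proj_val subrr.
split=> //.
  apply/lker0P => u v; rewrite !comp_lfunE !incE => h.
  apply/eqP; rewrite -subr_eq0 -(quot_proj_val (u - v)) quot_proj_eq0.
  have : vsval u - vsval v \in lker T by rewrite memv_ker linearB /= h subrr.
  by rewrite kT linearB.
by apply: limg_surj => w; have [v <-] := surj_limg w sT; exists (quot_proj L v); rewrite -UE.
Qed.

Lemma limg_addv W (T : 'Hom(V, W)) E : limg T = fullv ->
  (T @: E == fullv)%VS = (E + lker T == fullv)%VS.
Proof.
move=> sT; apply/eqP/eqP => h.
  apply/eqP; rewrite eqEsubv subvf; apply/subvP => x _.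
  have := memvf (T x); rewrite -h => /memv_imgP[e eE Te].
  rewrite -(subrK e x) addrC memv_add// memv_ker linearB /= Te subrr//.
rewrite -sT -h limgD; have -> : (T @: lker T = 0)%VS by apply/eqP; rewrite -lkerE.
by rewrite addv0.
Qed.

Section Pairing.
Variables (U W1 W2 : vectType K) (S : 'Hom(U, W1)) (T : 'Hom(U, W2)).

Let pair_linear : linear (fun x => (S x, T x) : (W1 * W2)%type).
Proof. by move=> a u v; rewrite !linearP. Qed.

Definition lin_pair : 'Hom(U, (W1 * W2)%type) := mklin pair_linear.

Lemma lin_pairE x : lin_pair x = (S x, T x). Proof. exact: mklinE. Qed.

End Pairing.

End Quotients.

Section Kernels.
Variables (R : realType) (F : nonArchLocalFieldType R) (V : vectType F).
Variables (Lam : set V) (lL : latt Lam).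
Implicit Types (g h : 'End(V)) (E L M N : {vspace V}) (W : vectType F).
Local Notation pi_ := (unif F).
Local Notation K := (GLlat Lam).
Let sL : submod Lam := latt_submod lL.

(** The lattice that Lam induces on E occurs in E itself (elat) and as a
    subset of V (slat); qlat is the lattice that it induces on V / L. *)
Definition elat E : set (subvs_of E) := [set v | Lam (vsval v)].
Definition slat E : set V := Lam `&` [set x | x \in E].
Definition qlat L : set (quot L) := quot_proj L @` Lam.
Arguments elat : clear implicits.
Arguments qlat : clear implicits.

Lemma elat_latt E : latt (elat E).
Proof.
have := latt_preim (lker_inc E) lL; congr (latt _).
by apply/seteqP; split=> x; rewrite /elat /= incE.
Qed.

Lemma qlat_img L : qlat L = qp L @` Lam.
Proof. by apply: eq_imagel => x _; rewrite qpE. Qed.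

Lemma qlat_latt L : latt (qlat L).
Proof. by rewrite qlat_img; exact: latt_img (limg_qp L) lL. Qed.

Lemma slat_inc E : slat E = inc E @` elat E.
Proof.
apply/seteqP; split=> [x [Lx xE]|_ [v Lv <-]]; last by rewrite incE; split=> //=; exact: subvsP.
by exists (vsproj E x); rewrite ?incE /elat /= vsprojK.
Qed.

Lemma slat_submod E : submod (slat E).
Proof. by rewrite slat_inc; apply: submod_img; apply: latt_submod; exact: elat_latt. Qed.

Lemma slat_full : slat fullv = Lam.
Proof. by apply/seteqP; split=> [x []//|x Lx]; split=> //=; exact: memvf. Qed.

Lemma slat_GL g E : K g -> slat (g @: E)%VS = g @` slat E.
Proof.
move=> kg; apply/seteqP; split=> [x [Lx /memv_imgP[y yE xy]]|_ [x [Lx xE] <-]].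
  by exists y => //; split=> //; apply: (GL_memV kg); rewrite -xy.
by split; [exact: GL_mem|rewrite /= memv_img].
Qed.

Lemma slat_capv E L : slat (E :&: L) = slat E `&` [set x | x \in L].
Proof.
apply/seteqP; split=> x; rewrite /slat /= memv_cap; first by move=> [? /andP[]].
by move=> [[? ?] ?]; split=> //; apply/andP.
Qed.

Lemma slat_img W (T : 'Hom(V, W)) E : T @` slat E = (T \o inc E)%VF @` elat E.
Proof. by rewrite slat_inc image_comp; apply: eq_imagel => x _; rewrite comp_lfunE. Qed.

Lemma slat_img_latt W (T : 'Hom(V, W)) E : (T @: E = fullv)%VS -> latt (T @` slat E).
Proof.
move=> h; rewrite slat_img; apply: latt_img (elat_latt E).
by rewrite limg_comp limg_inc.
Qed.

Lemma slat_img_sub W (T : 'Hom(V, W)) E : T @` slat E `<=` T @` Lam.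
Proof. by apply: image_subset => x []. Qed.

(** The image lies in a proper subspace of W. *)
Lemma vol_slat0 W (T : 'Hom(V, W)) (Y : set W) E : latt Y -> T @` Lam `<=` Y ->
  (T @: E)%VS != fullv -> vol Y (T @` slat E) = 0.
Proof.
move=> lY TY; apply: vol_subspace0 => //.
- by apply: submod_img; exact: slat_submod.
- exact: subset_trans (@slat_img_sub _ T E) TY.
by move=> _ [x [_ xE] <-]; rewrite memv_img.
Qed.

(** The factor by which the projection along L changes volumes of E, relative
    to the lattice. *)
Definition delta E L : R := vol (qlat L) (quot_proj L @` slat E).

Definition pairq L M : 'Hom(V, (quot L * quot M)%type) := lin_pair (qp L) (qp M).

Lemma pairqE L M x : pairq L M x = (quot_proj L x, quot_proj M x).
Proof. by rewrite lin_pairE !qpE. Qed.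

Definition delta2 E L M : R := vol (qlat L `*` qlat M : set (quot L * quot M)%type) (pairq L M @` slat E).

Lemma quot_img L (A : set V) : quot_proj L @` A = qp L @` A.
Proof. by apply: eq_imagel => x _; rewrite qpE. Qed.

Lemma vol_quot W (T : 'Hom(V, W)) L (X A : set V) : limg T = fullv -> lker T = L ->
  vol (T @` X) (T @` A) = vol (quot_proj L @` X) (quot_proj L @` A).
Proof.
move=> sT kT; have [U [kU sU UE]] := quot_factor sT kT.
have e (B : set V) : T @` B = U @` (quot_proj L @` B).
  by rewrite image_comp; apply: eq_imagel => x _; rewrite UE.
by rewrite !e vol_iso.
Qed.

Lemma delta_map W (T : 'Hom(V, W)) E L : limg T = fullv -> lker T = L ->
  vol (T @` Lam) (T @` slat E) = delta E L.
Proof. exact: vol_quot. Qed.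

Lemma delta_ge0 E L : 0 <= delta E L. Proof. exact: vol_ge0. Qed.

Lemma delta_le1 E L : delta E L <= 1.
Proof. by apply: vol_le1; [exact: qlat_latt|apply: image_subset => x []]. Qed.

Lemma delta_full L : delta fullv L = 1.
Proof. by rewrite /delta slat_full vol_self//; exact: qlat_latt. Qed.

Lemma delta_eq0 E L : (E + L)%VS != fullv -> delta E L = 0.
Proof.
move=> h; rewrite /delta quot_img; apply: vol_slat0; first exact: qlat_latt.
  by rewrite -qlat_img.
by rewrite limg_addv ?lker_qp ?limg_qp.
Qed.

Lemma delta_gt0 E L : (E + L)%VS = fullv -> 0 < delta E L.
Proof.
move=> h; rewrite /delta quot_img; apply: vol_gt0; first exact: qlat_latt.
by apply: slat_img_latt; apply/eqP; rewrite limg_addv ?lker_qp ?limg_qp ?h.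
Qed.

Lemma delta_GL g E L : K g -> delta (g @: E)%VS (g @: L)%VS = delta E L.
Proof.
move=> kg; have ig := GL_ker kg.
rewrite -(@delta_map _ (qp (g @: L)%VS \o g)%VF E L).
- rewrite /delta slat_GL// /qlat !quot_img; congr vol.
    by rewrite -[in LHS]kg.2 image_comp; apply: eq_imagel => x _; rewrite comp_lfunE.
  by rewrite image_comp; apply: eq_imagel => x _; rewrite comp_lfunE.
- by rewrite limg_comp lker0_limgf ?limg_qp.
apply/vspaceP => x; rewrite memv_ker comp_lfunE qpE quot_proj_eq0.
exact: memv_limgE.
Qed.

(** Together with the symmetric relation this is lev, by lev_near and
    near_lev, but it makes sense without comparing dimensions. *)
Definition near_sub m E E' := forall x, slat E x -> exists2 x', slat E' x' &
  exists2 y, Lam y & x = x' + pi_ ^+ m.+1 *: y.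

Lemma lev_near_sub m E E' : lev Lam m E E' -> near_sub m E E' /\ near_sub m E' E.
Proof.
by move=> h; split=> x [Lx xE]; [have [x' [? ? ?]] := lev_near lL h xE Lx
  |have [x' [? ? ?]] := lev_near lL (lev_sym lL h) xE Lx]; exists x'.
Qed.

Lemma vol_near W (S T : 'Hom(V, W)) (Y : set W) m E E' : latt Y ->
  S @` Lam `<=` Y -> T @` Lam `<=` Y ->
  (forall x, Lam x -> exists2 y, Y y & S x = T x + pi_ ^+ m.+1 *: y) ->
  near_sub m E E' -> near_sub m E' E ->
  `|vol Y (S @` slat E) - vol Y (T @` slat E')| <= m.+1%:R^-1.
Proof.
move=> lY SY TY ST h h'; have sY := latt_submod lY.
have TS x : Lam x -> exists2 y, Y y & T x = S x + pi_ ^+ m.+1 *: y.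
  by move=> /ST[y Yy ->]; exists (- y); [exact: submodN|rewrite scalerN addrK].
have aux (S' T' : 'Hom(V, W)) A B : T' @` Lam `<=` Y ->
    (forall x, Lam x -> exists2 y, Y y & S' x = T' x + pi_ ^+ m.+1 *: y) ->
    near_sub m A B -> forall x, (S' @` slat A) x ->
    exists2 x', (T' @` slat B) x' & exists2 y, Y y & x = x' + pi_ ^+ m.+1 *: y.
  move=> TY' ST' hAB _ [x xA <-]; have [x' Bx' [y Ly xE]] := hAB x xA.
  have [z Yz ->] := ST' x xA.1; exists (T' x'); first by exists x'.
  exists (T' y + z); first by apply: submodD => //; apply: TY'; exists y.
  by rewrite xE linearD linearZ /= scalerDr addrA.
apply: vol_close => //; try exact: aux; try by apply: submod_img; exact: slat_submod.
  exact: subset_trans (@slat_img_sub _ S E) SY.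
exact: subset_trans (@slat_img_sub _ T E') TY.
Qed.

Lemma delta_near m E E' L : near_sub m E E' -> near_sub m E' E ->
  `|delta E L - delta E' L| <= m.+1%:R^-1.
Proof.
move=> h h'; have lq := qlat_latt L; rewrite /delta !quot_img; apply: vol_near => //.
- by rewrite qlat_img.
- by rewrite qlat_img.
by move=> x _; exists 0; [case: (latt_submod lq)|rewrite scaler0 addr0].
Qed.

Lemma delta_lev m E E' L L' : lev Lam m E E' -> lev Lam m L L' ->
  `|delta E L - delta E' L'| <= m.+1%:R^-1.
Proof.
move=> hE [g gG ->]; have kg := congr_GL lL gG.
rewrite -[E'](limgVK _ (GL_ker kg)) delta_GL//.
have [h1 h2] : near_sub m E (g^-1 @: E')%VS /\ near_sub m (g^-1 @: E')%VS E.
  apply: lev_near_sub; apply: (lev_trans lL hE).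
  by exists g^-1%VF => //; exact: congr_grpV.
exact: delta_near.
Qed.

Lemma pairq_sub L M : pairq L M @` Lam `<=` (qlat L `*` qlat M).
Proof. by move=> _ [x Lx <-]; rewrite pairqE; split; exists x. Qed.

Lemma qlat2_latt L M : latt (qlat L `*` qlat M : set (quot L * quot M)%type).
Proof. by apply: latt_prod; exact: qlat_latt. Qed.

Lemma limg_pairq E L M : (pairq L M @: E == fullv)%VS =
  (E + L == fullv)%VS && ((E :&: L) + M == fullv)%VS.
Proof.
apply/eqP/andP => [h|[/eqP h1 /eqP h2]].
  have hs w1 w2 : exists2 e, e \in E & quot_proj L e = w1 /\ quot_proj M e = w2.
    have := memvf (w1, w2); rewrite -h => /memv_imgP[e eE].
    by rewrite pairqE => -[-> ->]; exists e.
  rewrite !eqEsubv !subvf /=; split; apply/subvP => x _.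
    have [e eE [e1 _]] := hs (quot_proj L x) 0.
    rewrite -(subrK e x) addrC memv_add// -quot_proj_eq0 -qpE linearB /= !qpE e1 subrr//.
  have [e eE [e1 e2]] := hs 0 (quot_proj M x).
  rewrite -(subrK e x) addrC memv_add//.
    by rewrite memv_cap eE -quot_proj_eq0 e1 eqxx.
  by rewrite -quot_proj_eq0 -qpE linearB /= !qpE e2 subrr.
apply/eqP; rewrite eqEsubv subvf; apply/subvP => -[w1 w2] _.
have [v vE] := quot_proj_surj w1; have := memvf v.
rewrite -h1 => /memv_addP[e eE [l lL' vel]].
have [u uE] := quot_proj_surj (w2 - quot_proj M e); have := memvf u.
rewrite -h2 => /memv_addP[f + [k kM ufk]]; rewrite memv_cap => /andP[fE fL].
apply/memv_imgP; exists (e + f); first exact: memvD.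
move: lL' kM fL; rewrite -!quot_proj_eq0 => /eqP l0 /eqP k0 /eqP f0.
rewrite pairqE !quot_projD f0 addr0; congr (_, _).
  by rewrite -vE vel quot_projD l0 addr0.
have : quot_proj M f = w2 - quot_proj M e by rewrite -uE ufk quot_projD k0 addr0.
by move=> ->; rewrite addrC subrK.
Qed.

(** Project along L first, then the part of E inside L along M. *)
Lemma delta2E E L M : delta2 E L M = delta E L * delta (E :&: L)%VS M.
Proof.
have [h|h] := boolP (pairq L M @: E == fullv)%VS; last first.
  rewrite /delta2 vol_slat0//; [|exact: qlat2_latt|exact: pairq_sub].
  move: h; rewrite limg_pairq negb_and => /orP[] /delta_eq0 ->; by rewrite ?mul0r ?mulr0.
have lZ := slat_img_latt (eqP h).
rewrite /delta2 vol_fibration//; try exact: qlat_latt.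
congr (_ * _); rewrite /delta; congr vol.
  apply/seteqP; split=> [_ [_ [x Ex <-] <-]|_ [x Ex <-]]; first by rewrite pairqE; exists x.
  by exists (pairq L M x); [exists x|rewrite pairqE].
rewrite slat_capv; apply/seteqP; split=> [w [x Ex]|_ [x [Ex /= xL] <-]].
  by rewrite pairqE => -[/eqP + <-]; rewrite quot_proj_eq0 => xL; exists x.
by exists x => //; rewrite pairqE; congr (_, _); apply/eqP; rewrite quot_proj_eq0.
Qed.

Lemma delta2_sym E L M : delta2 E L M = delta2 E M L.
Proof.
pose S := lin_pair (lin_snd (quot L) (quot M)) (lin_fst (quot L) (quot M)).
have SE x : S x = (x.2, x.1) by rewrite lin_pairE lin_sndE lin_fstE.
rewrite /delta2 -(@vol_iso _ _ _ _ S).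
- congr vol.
    apply/seteqP; split=> [_ [x [x1 x2] <-]|[w2 w1] [/= h2 h1]]; first by rewrite SE.
    by exists (w1, w2); rewrite ?SE.
  by rewrite image_comp; apply: eq_imagel => x _; rewrite /= SE !pairqE.
- by apply/lker0P => -[u1 u2] [v1 v2]; rewrite !SE => -[-> ->].
by apply: limg_surj => -[w2 w1]; exists (w1, w2); rewrite SE.
Qed.

(** Project V along L and M in either order. *)
Lemma delta_sym L M : delta L M = delta M L.
Proof.
by have := delta2_sym fullv L M; rewrite !delta2E !delta_full !mul1r !capfv.
Qed.

(** Alternatively, project along the intersection first. *)
Lemma delta2_cap E L M : delta2 E L M = delta L M * delta E (L :&: M)%VS.
Proof.
have e0 : delta2 fullv L M = delta L M by rewrite delta2E delta_full mul1r capfv.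
have [h|h] := boolP (limg (pairq L M) == fullv)%VS; last first.
  have -> : delta L M = 0.
    by rewrite -e0 /delta2 vol_slat0//; [exact: qlat2_latt|exact: pairq_sub].
  rewrite mul0r /delta2 vol_slat0//; [exact: qlat2_latt|exact: pairq_sub|].
  apply: contra h => /eqP h; rewrite eqEsubv subvf -h limgS ?subvf//.
have lT := latt_img (eqP h) lL.
rewrite /delta2 (vol_trans _ _ lT) (@delta_map _ _ _ (L :&: M)%VS (eqP h)); last first.
  apply/vspaceP => x; rewrite memv_ker memv_cap pairqE -!quot_proj_eq0.
  by apply/eqP/andP => [[-> ->]//|[/eqP -> /eqP ->]].
by congr (_ * _); rewrite -e0 /delta2 slat_full.
Qed.

Lemma quot_move g L : K g -> exists U : 'Hom(quot L, quot (g @: L)%VS),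
  [/\ lker U == 0%VS, limg U = fullv & forall x, U (quot_proj L x) = quot_proj (g @: L)%VS (g x)].
Proof.
move=> kg; have ig := GL_ker kg.
have [||U [kU sU UE]] := @quot_factor _ _ _ (qp (g @: L)%VS \o g)%VF L.
- by rewrite limg_comp lker0_limgf ?limg_qp.
- by apply/vspaceP => x; rewrite memv_ker comp_lfunE qpE quot_proj_eq0; exact: memv_limgE.
by exists U; split=> // x; rewrite -UE comp_lfunE qpE.
Qed.

(** Elements of the congruence subgroup move the last two arguments back to L
    and M, and change the pair of projections by a multiple of pi^(m+1). *)
Lemma delta2_lev m E E' L L' M M' :
  lev Lam m E E' -> lev Lam m L L' -> lev Lam m M M' ->
  `|delta2 E L M - delta2 E' L' M'| <= m.+1%:R^-1.
Proof.
move=> hE [g gG ->] [h hG ->]; have kg := congr_GL lL gG; have kh := congr_GL lL hG.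
have [U [kU sU UE]] := quot_move L kg; have [U' [kU' sU' UE']] := quot_move M kh.
pose P := lin_pair (U \o lin_fst (quot L) (quot M))%VF (U' \o lin_snd (quot L) (quot M))%VF.
have PE x : P x = (U x.1, U' x.2) by rewrite lin_pairE !comp_lfunE lin_fstE lin_sndE.
pose T := lin_pair (qp L \o g^-1)%VF (qp M \o h^-1)%VF.
have TE x : T x = (quot_proj L (g^-1%VF x), quot_proj M (h^-1%VF x)).
  by rewrite lin_pairE !comp_lfunE !qpE.
have -> : delta2 E' (g @: L)%VS (h @: M)%VS = vol (qlat L `*` qlat M) (T @` slat E').
  rewrite -(@vol_iso _ _ _ _ P); last 2 first.
  - by apply/lker0P => -[u1 u2] [v1 v2]; rewrite !PE => -[/(lker0P kU) -> /(lker0P kU') ->].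
  - apply: limg_surj => -[w1 w2]; have [x1 <-] := surj_limg w1 sU; have [x2 <-] := surj_limg w2 sU'.
    by exists (x1, x2); rewrite PE.
  congr vol; last first.
    rewrite image_comp; apply: eq_imagel => x _.
    by rewrite /= PE TE pairqE !UE !UE' !lker0_lfunVK ?(GL_ker kg) ?(GL_ker kh).
  apply/seteqP; split=> [[_ _] [/= [x Lx <-] [y Ly <-]]|_ [[_ _] [/= [x Lx <-] [y Ly <-]] <-]].
    exists (quot_proj L (g^-1%VF x), quot_proj M (h^-1%VF y)).
      by split; [exists (g^-1%VF x)|exists (h^-1%VF y)] => //; apply: GL_mem => //; exact: GL_inv.
    by rewrite PE !UE !UE' !lker0_lfunVK ?(GL_ker kg) ?(GL_ker kh).
  by rewrite PE UE UE'; split; [exists (g x)|exists (h y)] => //; exact: GL_mem.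
have [h1 h2] := lev_near_sub hE.
apply: vol_near => //; [exact: qlat2_latt|exact: pairq_sub| |].
  move=> _ [x Lx <-]; rewrite TE; split; [exists (g^-1%VF x)|exists (h^-1%VF x)] => //;
    by apply: GL_mem => //; exact: GL_inv.
move=> x Lx.
have [y Ly gx] := congr_grpV lL gG Lx; have [z Lz hx] := congr_grpV lL hG Lx.
exists (- (quot_proj L y, quot_proj M z)).
  by apply: submodN; [exact: latt_submod (qlat2_latt L M)|split; [exists y|exists z]].
have -> : T x = pairq L M x + pi_ ^+ m.+1 *: (quot_proj L y, quot_proj M z).
  by rewrite TE pairqE gx hx !quot_projD !quot_projZ.
by rewrite -addrA -scalerDr subrr scaler0 addr0.
Qed.

Lemma delta2_GL g E L M : K g ->
  delta2 (g @: E)%VS (g @: L)%VS (g @: M)%VS = delta2 E L M.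
Proof.
move=> kg; rewrite !delta2E (delta_GL E L kg); congr (_ * _).
rewrite -(@delta_GL g (E :&: L)%VS)//; congr delta; apply/esym.
by rewrite lker0_img_cap// (GL_ker kg).
Qed.

(** An isomorphism multiplies all volumes by the same factor, which is read
    off on the lattice of E. A map that is not bijective has a proper subspace
    as image, of volume 0. *)
Lemma pullback_vol W (S : 'Hom(V, W)) (Y : set W) E (f : subvs_of E -> W) A :
  latt Y -> S @` Lam `<=` Y -> \dim E = \dim {:W} -> (forall v, f v = S (vsval v)) ->
  pullback f (fun B => (vol Y B)%:C) A = (vol Y (S @` slat E) * vol (elat E) A)%:C.
Proof.
move=> lY SY dE fE; pose T := (S \o inc E)%VF.
have fT v : f v = T v by rewrite fE comp_lfunE incE.
rewrite /pullback; case: asboolP => [bf|nbf].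
  have sT : limg T = fullv.
    by apply: limg_surj => w; case: bf => f' _ f'K; exists (f' w); rewrite -fT.
  have kT : lker T == 0%VS by apply/lker0P => u v; rewrite -!fT; exact: bij_inj.
  have lT := latt_img sT (elat_latt E).
  rewrite slat_img (eq_imagel (fun x _ => fT x)).
  by rewrite (vol_trans _ _ lT) vol_iso.
rewrite vol_slat0 ?mul0r//; apply/eqP => h; apply: nbf.
have sT : limg T = fullv by rewrite limg_comp limg_inc.
have kT : lker T == 0%VS.
  by rewrite -dimv_eq0; have := limg_ker_dim T fullv; rewrite capfv sT dim_subvs dE; lia.
by exists (T^-1)%VF => v; rewrite fT ?lker0_lfunK// limg_lfunVK// sT memvf.
Qed.

Lemma pullback_delta E L A : (\dim E + \dim L)%N = \dim {:V} ->
  pullback (fun v : subvs_of E => quot_proj L (vsval v)) (@muL _ _ _ Lam L) A =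
  (delta E L * vol (elat E) A)%:C.
Proof.
move=> dEL; have lq := qlat_latt L.
have -> : @muL _ _ _ Lam L = fun B => (vol (qlat L) B)%:C by apply/funext => B; exact: haar1E.
rewrite (@pullback_vol _ (qp L))//; first by rewrite /delta quot_img.
- by rewrite qlat_img.
- by rewrite dim_quot; lia.
by move=> v; rewrite qpE.
Qed.

Lemma pullback_delta2 E L M A : (\dim E + \dim L + \dim M)%N = (\dim {:V} + \dim {:V})%N ->
  pullback (fun v : subvs_of E => (quot_proj L (vsval v), quot_proj M (vsval v)))
    (box_measure (@muL _ _ _ Lam L) (@muL _ _ _ Lam M)) A =
  (delta2 E L M * vol (elat E) A)%:C.
Proof.
move=> dELM; rewrite box_measureE; try exact: qlat_latt.
rewrite (@pullback_vol _ (pairq L M))//.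
- exact: qlat2_latt.
- exact: pairq_sub.
- have -> : \dim {: (quot L * quot M)%type} = (\dim {: quot L} + \dim {: quot M})%N by rewrite !dimvf.
  have := dimvS (subvf L); have := dimvS (subvf M); rewrite !dim_quot; lia.
by move=> v; rewrite pairqE.
Qed.

End Kernels.
Arguments elat {R F V} Lam E.
Arguments qlat {R F V} Lam L.

(** * Ultrametric kernels are conditionally negative *)

Section UltrametricKernel.
Variables (R : realType) (M : mean R).
Implicit Types (x y : mpt M) (a : mpt M -> R).

Lemma mint_prodM a b : uc (M:=M) a -> uc (M:=M) b ->
  mint (mean_prod M M) (fun z => a z.1 * b z.2) = mint M a * mint M b.
Proof.
move=> ua ub; rewrite mulrC -(meanZ _ ua) /=.
apply: mean_ext => [|x _]; last by rewrite meanZ// mulrC.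
exact: (uc_slice_int (uc_mul (uc_fst M ua) (uc_snd M ub))).
Qed.

Lemma mean_transversal j : exists xs : seq (mpt M), [/\ uniq xs,
  (forall x, mdom x -> exists2 y, y \in xs & mlev j y x) &
  (forall x y, x \in xs -> y \in xs -> mlev j x y -> x = y)].
Proof.
have [xs [_ _ cxs _]] := mean_approx M j.
have [|||ys [u s c i]] := @transversal_exists _ xs (@mlev R M j).
- by move=> x y; exact: mlev_sym.
- by move=> x y z; exact: mlev_trans.
- by move=> x _; exact: mlev_refl.
exists ys; split=> // x dx; have [y /c[z zs yz] xy] := cxs x dx.
by exists z => //; apply: mlev_trans xy; exact: mlev_sym.
Qed.

Variables (d : mpt M -> mpt M -> R) (r : R).
Hypothesis r01 : 0 < r < 1.
Hypothesis d0 : forall x y, 0 <= d x y.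
Hypothesis d1 : forall x y, d x y <= 1.
Hypothesis dr : forall x y j, mdom x -> mdom y ->
  (mlev j x y -> d x y <= r ^+ j.+1) /\ (~ mlev j x y -> r ^+ j <= d x y).
Hypothesis ud : uc (M:=mean_prod M M) (fun z => d z.1 z.2).

(** Up to an error r ^+ J the kernel is 1 minus a combination with positive
    coefficients of the indicators of the relations mlev j for j < J.  The
    quadratic form of such an indicator is the sum of the squares of the
    integrals over the classes, and at scale m this sum does not vanish. *)
Lemma ultrametric_negative a m x0 :
  (forall x y, mdom x -> mlev m x y -> a x = a y) ->
  mint M a = 0 -> mdom x0 -> a x0 != 0 ->
  mint M (fun x => mint M (fun y => a x * a y * d x y)) < 0.
Proof.
move=> am a0 dx0 ax0; have /andP[r0 r1] := r01.
have ua : uc (M:=M) a by exact: (uc_lc am).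
have [xs hxs] := choice mean_transversal.
pose I j x y : R := if `[< mlev j x y >] then 1 else 0.
have ul j x y z : mlev j x y -> `[< mlev j z x >] = `[< mlev j z y >].
  move=> h; apply: asbool_equiv_eq; split=> h'; first exact: (mlev_trans h' h).
  exact: (mlev_trans h' (mlev_sym h)).
have uI j x : uc (M:=M) (I j x).
  by apply: (uc_lc (m:=j)) => y z _ /ul h; rewrite /I h.
pose lam j x y : R := \sum_(t <- xs j) I j t x * I j t y.
have lamE j x y : mdom x -> lam j x y = if `[< mlev j x y >] then 1 else 0.
  move=> dx; have [u c i] := hxs j; have [t txs ht] := c x dx.
  rewrite /lam (big_rem t)//= [X in _ + X]big_seq big1 ?addr0.
    rewrite {1}/I asboolT// mul1r /I.
    by rewrite (@asbool_equiv_eq _ (mlev j x y))//; split=> h;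
      [exact: (mlev_trans (mlev_sym ht) h)|exact: (mlev_trans ht h)].
  move=> s; rewrite mem_rem_uniq// inE => /andP[st sxs].
  rewrite {1}/I asboolF ?mul0r// => h; move/eqP: st; apply.
  by apply: i => //; exact: (mlev_trans h (mlev_sym ht)).
pose c j := r ^+ j - r ^+ j.+1.
have c0 j : 0 < c j by rewrite subr_gt0 exprS gtr_pMl// exprn_gt0.
pose S J x y := 1 - \sum_(j < J) c j * lam j x y.
have SE J x y : mdom x -> mdom y -> `|d x y - S J x y| <= r ^+ J.
  move=> dx dy.
  have [[h ->]|[-> _]] : ((forall j, (j < J)%N -> mlev j x y) /\ S J x y = r ^+ J) \/
      (d x y = S J x y /\ exists2 j, (j < J)%N & ~ mlev j x y).
    elim: J => [|J [[h e]|[e [j jJ nj]]]].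
    - by left; split=> //; rewrite /S big_ord0 subr0 expr0.
    - have Se : S J.+1 x y = r ^+ J - c J * lam J x y.
        by rewrite /S big_ord_recr /= opprD addrA -/(S J x y) e.
      have [hJ|hJ] := pselect (mlev J x y).
        left; split; first by move=> j; rewrite ltnS leq_eqVlt => /orP[/eqP ->|/h].
        by rewrite Se lamE// asboolT// mulr1 opprB addrC subrK.
      right; split; last by exists J.
      rewrite Se lamE// asboolF// mulr0 subr0; apply/eqP; rewrite eq_le (dr J dx dy).2// andbT.
      case: (J) h => [|J'] h; first by rewrite expr0 d1.
      by apply: (dr J' dx dy).1; exact: h.
    right; split; last by exists j => //; exact: ltnW.
    rewrite e /S big_ord_recr /= lamE// asboolF ?mulr0 ?addr0// => /(mlev_le (ltnW jJ)).
    exact: nj.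
  - rewrite ler_norml; have := d0 x y; have rJ := exprn_ge0 J (ltW r0).
    case: J h rJ => [|J] h rJ d0'; first by have := d1 x y; rewrite expr0; move: rJ; rewrite expr0; lra.
    by have := (dr J dx dy).1 (h J (ltnSn _)); lra.
  by rewrite subrr normr0 exprn_ge0// ltW.
have [C C0 hC] := uc_bounded ua.
pose PP := mean_prod M M.
have uaI j x : uc (M:=M) (fun y => a y * I j x y) by apply: uc_mul.
have uaa : uc (M:=PP) (fun z => a z.1 * a z.2).
  exact: (uc_mul (uc_fst M ua) (uc_snd M ua)).
pose T j x (z : mpt PP) := (a z.1 * I j x z.1) * (a z.2 * I j x z.2).
have uT j x : uc (M:=PP) (T j x).
  exact: (uc_mul (uc_fst M (uaI j x)) (uc_snd M (uaI j x))).
pose q j := \sum_(x <- xs j) (mint M (fun y => a y * I j x y)) ^+ 2.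
have uTs j : uc (M:=PP) (fun z => \sum_(x <- xs j) T j x z) by exact: uc_sum.
have ucTs j : uc (M:=PP) (fun z => c j * \sum_(x <- xs j) T j x z).
  by apply: uc_ext (uc_lin (c j) (uTs j) (uc_const PP 0)) _ => z _; rewrite addr0.
pose H J (z : mpt PP) := (-1) * (\sum_(j < J) c j * (\sum_(x <- xs j) T j x z)) + a z.1 * a z.2.
have uH J : uc (M:=PP) (H J) by apply: uc_lin => //; exact: uc_sum.
have HE J z : H J z = a z.1 * a z.2 * S J z.1 z.2.
  rewrite /H /S mulrBr mulr1 mulN1r addrC; congr (_ - _).
  rewrite mulr_sumr; apply: eq_bigr => j _; rewrite mulrCA; congr (_ * _).
  by rewrite mulr_sumr; apply: eq_bigr => x _; rewrite /T mulrACA.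
have mH J : mint PP (H J) = - \sum_(j < J) c j * q j.
  rewrite mean_lin//; last exact: uc_sum.
  rewrite mint_prodM// a0 mulr0 addr0 mulN1r mean_sum//; congr (- _).
  apply: eq_bigr => j _; rewrite meanZ// mean_sum//; congr (_ * _).
  by apply: eq_bigr => x _; rewrite expr2; exact: (mint_prodM (uaI j x) (uaI j x)).
pose D (z : mpt PP) := a z.1 * a z.2 * d z.1 z.2.
have uD : uc (M:=PP) D by exact: uc_mul.
have qm : 0 < c m * q m.
  rewrite mulr_gt0//; have [u cx i] := hxs m; have [t txs ht] := cx x0 dx0.
  rewrite /q (big_rem t)//= ltr_wpDr ?sumr_ge0// => [x _|]; first by rewrite sqr_ge0.
  rewrite exprn_even_gt0//= (@mean_ext _ M _ (fun y => a x0 * I m t y))//; last first.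
    move=> y dy; rewrite /I; case: asboolP => ty; last by rewrite !mulr0.
    by rewrite !mulr1; apply/esym/am => //; exact: (mlev_trans (mlev_sym ht) ty).
  rewrite meanZ// mulf_neq0// gt_eqF//; apply: (@mean_gt0 _ M _ x0) => // [y _|].
    by rewrite /I; case: ifP.
  by rewrite /I asboolT.
suff : mint PP D + c m * q m <= 0 by rewrite /= /D; lra.
apply: (@small_le0 _ _ (C * C)); first by rewrite mulr_ge0.
move=> e e0.
have [J [mJ rJ]] : exists J, (m < J)%N /\ r ^+ J <= e.
  have rn : `|r| < 1 by rewrite ger0_norm// ltW.
  have /cvgrPdist_le/(_ e e0)[N _ hN] := cvg_expr rn.
  exists (maxn m.+1 N); split; first by rewrite leq_max ltnSn.
  have := hN (maxn m.+1 N); rewrite /= leq_maxr sub0r normrN ger0_norm; first exact.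
  by rewrite exprn_ge0// ltW.
have h1 : `|mint PP D - mint PP (H J)| <= C * C * r ^+ J.
  apply: mean_near => // -[x y] [/= dx dy]; rewrite /D HE /= -mulrBr normrM.
  apply: ler_pM => //; last exact: SE.
  by rewrite normrM; apply: ler_pM => //; exact: hC.
have h2 : c m * q m <= \sum_(j < J) c j * q j.
  rewrite (bigD1 (Ordinal mJ))//= lerDl sumr_ge0// => j _; rewrite mulr_ge0 ?(ltW (c0 j))//.
  by rewrite /q sumr_ge0// => x _; rewrite sqr_ge0.
have h3 : C * C * r ^+ J <= C * C * e by rewrite ler_wpM2l ?mulr_ge0.
by move: h1; rewrite mH ler_norml => /andP[_]; lra.
Qed.

End UltrametricKernel.

(** * The averages of the kernel *)

Section KernelMeans.
Variables (R : realType) (F : nonArchLocalFieldType R) (V : vectType F).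
Variables (Lam : set V) (lL : latt Lam).
Implicit Types (g h : 'End(V)) (E L M N : {vspace V}) (W : vectType F).
Local Notation K := (GLlat Lam).

Lemma inv_small (e : R) : 0 < e -> exists m, m.+1%:R^-1 <= e.
Proof.
move=> e0; exists (Num.truncn e^-1); rewrite -[leRHS]invrK lef_pV2 ?posrE ?invr_gt0 ?ltr0n//.
by rewrite ltW// truncnS_gt.
Qed.

Lemma uc_delta k (hk : (k <= \dim {:V})%N) L : uc (M:=gr_mean lL hk) (fun E => delta Lam E L).
Proof.
move=> e /inv_small[m hm]; exists m => E E' _ EE'; apply: le_trans hm.
by apply: (delta_lev lL EE'); exact: lev_refl.
Qed.

Lemma uc_delta_r k (hk : (k <= \dim {:V})%N) E : uc (M:=gr_mean lL hk) (fun L => delta Lam E L).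
Proof.
by apply: uc_ext (uc_delta hk E) _ => L _; exact: delta_sym.
Qed.

Lemma uc_delta_pair k l (hk : (k <= \dim {:V})%N) (hl : (l <= \dim {:V})%N) :
  uc (M:=mean_prod (gr_mean lL hk) (gr_mean lL hl)) (fun z => delta Lam z.1 z.2).
Proof.
move=> e /inv_small[m hm]; exists m => -[E L] [E' L'] _ [h1 h2]; apply: le_trans hm.
exact: delta_lev.
Qed.

(** The stabiliser of the lattice acts transitively on the subspaces N. *)
Lemma kappa k (hk : (k <= \dim {:V})%N) : exists2 c : R, 0 < c &
  forall N, \dim N = (\dim {:V} - k)%N -> mint (gr_mean lL hk) (fun E => delta Lam E N) = c.
Proof.
have [[N0 dN0]|n] := pselect (exists N, \dim N = (\dim {:V} - k)%N); last first.
  by exists 1 => // N dN; exfalso; apply: n; exists N.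
exists (mint (gr_mean lL hk) (fun E => delta Lam E N0)).
  apply: (@mean_gt0 _ (gr_mean lL hk) _ (N0^C)%VS); first exact: uc_delta.
  - by move=> E _; exact: delta_ge0.
  - by rewrite /= /gr_dom dimv_compl dN0 subKn.
  by apply: delta_gt0 => //; rewrite addvC addv_complf.
move=> N dN; have [g kg ->] : exists2 g, K g & N = (g @: N0)%VS.
  by apply: GL_transitive => //; rewrite dN dN0.
rewrite -(@gr_mean_invariant _ _ _ _ lL _ hk g (fun E => delta Lam E (g @: N0)%VS) kg); last exact: uc_delta.
by congr mint; apply/funext => E; rewrite delta_GL.
Qed.

End KernelMeans.

(** * Relative volumes in a line *)

Section Line.
Variables (R : realType) (F : nonArchLocalFieldType R) (W : vectType F).
Variables (Y : set W) (lY : latt Y).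
Local Notation pi_ := (unif F).
Let sY : submod Y := latt_submod lY.

Definition scaled j : set W := [set pi_ ^+ j *: y | y in Y].

Lemma scaled_pow_latt j : latt (scaled j).
Proof. by apply: latt_scale lY; exact: unifX_neq0. Qed.

Lemma vol_scaled j : vol Y (scaled j) = vol Y (scaled 1) ^+ j.
Proof.
elim: j => [|j ih].
  rewrite expr0 -(vol_self lY); congr vol; apply/seteqP; split=> [_ [y Yy <-]|y Yy].
    by rewrite expr0 scale1r.
  by exists y; rewrite // expr0 scale1r.
rewrite (vol_trans _ _ (scaled_pow_latt j)) ih exprSr; congr (_ * _).
have l : linear (fun w : W => pi_ ^+ j *: w).
  by move=> a u v; rewrite scalerDr !scalerA mulrC.
have lE x : mklin l x = pi_ ^+ j *: x by exact: mklinE.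
rewrite -(@vol_iso _ _ _ _ (mklin l) Y (scaled 1)).
- congr vol; first by apply: eq_imagel => x _; rewrite lE.
  rewrite /scaled image_comp; apply: eq_imagel => x _.
  by rewrite /= lE scalerA expr1 exprSr.
- by apply/lker0P => u v; rewrite !lE => /(scalerI (unifX_neq0 F j)).
by apply: limg_surj => w; exists (pi_ ^- j *: w); rewrite lE scalerKV ?unifX_neq0.
Qed.

Variable dW : \dim {:W} = 1%N.

Lemma line_latt : exists2 y0, (forall w, exists c, w = c *: y0) &
  forall c, Y (c *: y0) <-> absv c <= 1.
Proof.
have [b hb] := obasis_exists lY fullv.
have sb : size b = 1%N by rewrite (obasis_dim hb).
case: b sb hb => [|y0 [|]]// _ [bb hb]; exists y0 => [w|c].
  have := coord_span (X := in_tuple [:: y0]) (v := w).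
  rewrite (span_basis bb) memvf => /(_ isT) ->.
  by rewrite big_ord1 /=; eexists.
have := hb (fun=> c); rewrite big_ord1 /= => ->.
by split=> [/(_ 0%N isT)|h] //.
Qed.

(** It suffices to bound the volume of the multiple by pi^2, where vol_small
    gives 1/2. *)
Lemma vol_scaled_lt1 : 0 < vol Y (scaled 1) < 1.
Proof.
rewrite vol_gt0//=; last exact: scaled_pow_latt.
have [y0 hs hy] := line_latt.
have Y0 : Y y0 by rewrite -[y0]scale1r; apply/hy; rewrite absv1.
have y0N : y0 != 0.
  apply/eqP => y00; have := (hy (pi_^-1)).1.
  rewrite {1}y00 scaler0 absvV => /(_ (let: And3 h _ _ := sY in h)).
  by rewrite invf_le1 ?absv_gt0 ?unif_neq0// leNgt unif_lt1.
have : vol Y (scaled 2) <= 2%:R^-1.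
  apply: (@vol_small _ _ _ _ _ _ y0) => //.
  - exact: latt_submod (scaled_pow_latt 2).
  - by move=> _ [y Yy <-]; apply: submodZ => //; exact: absv_unif_le1.
  move=> [y Yy]; have [c yE] := hs y; rewrite yE scalerA => /eqP.
  rewrite -subr_eq0 -scalerBl scaler_eq0 (negbTE y0N) orbF subr_eq0 expr1 expr2 -mulrA => /eqP h.
  have {}h : pi_ * c = 1 by apply: (mulfI (unif_neq0 F)); rewrite mulr1.
  have : absv (pi_ * c) <= absv pi_.
    by rewrite absvM ler_piMr ?absv_ge0//; apply/hy; rewrite -yE.
  by rewrite h absv1 leNgt unif_lt1.
rewrite vol_scaled => h2; rewrite ltNge; apply/negP => /(exprn_ege1 2) h1.
by have := le_trans h1 h2; rewrite leNgt invf_lt1 ?ltr1n ?ltr0n.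
Qed.

Variables (X : set W) (sX : submod X) (XY : X `<=` Y).

Lemma vol_le_scaled j : X `<=` scaled j -> vol Y X <= vol Y (scaled 1) ^+ j.
Proof. by move=> h; rewrite -vol_scaled; apply: vol_le h; exact: scaled_pow_latt. Qed.

(** Submodules of a line are nested, so X contains every multiple of the
    lattice that it is not contained in. *)
Lemma vol_ge_scaled j : ~ X `<=` scaled j.+1 -> vol Y (scaled 1) ^+ j <= vol Y X.
Proof.
move=> /existsNP[x /not_implyP[Xx nx]]; have [y0 hs hy] := line_latt.
have [c xE] := hs x; rewrite xE in Xx nx.
have cj : absv (pi_ ^+ j) <= absv c.
  have c0 : c != 0.
    apply/eqP => c0; apply: nx; exists 0; first by case: sY.
    by rewrite c0 scale0r scaler0.
  have : ~ absv (pi_ ^- j.+1 * c) <= 1.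
    move=> h; apply: nx; exists ((pi_ ^- j.+1 * c) *: y0); first exact/hy.
    by rewrite scalerA mulrA mulfV ?mul1r// unifX_neq0.
  move=> /negP; rewrite -ltNge => h.
  have : absv (pi_ ^+ j.+1 / c) < 1.
    rewrite -[X in absv X]invrK absvV invf_lt1 ?absv_gt0 ?invr_eq0 ?mulf_neq0 ?invr_eq0 ?unifX_neq0//.
    by rewrite invfM invrK.
  move=> /unif_max; rewrite exprS -mulrA absvM ger_pMr ?absv_gt0 ?unif_neq0//.
  by rewrite absvM absvV ler_pdivrMr ?absv_gt0// mul1r.
have jX : scaled j `<=` X.
  move=> _ [y Yy <-]; have [d yE] := hs y; rewrite yE scalerA.
  have c0 : c != 0 by rewrite -absv_gt0 (lt_le_trans _ cj)// absv_gt0 unifX_neq0.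
  rewrite -[_ * d](@divfK _ c)// -scalerA; apply: (submodZ sX) => //.
  rewrite absvM absvV ler_pdivrMr ?absv_gt0// mul1r absvM.
  apply: le_trans cj; rewrite ler_piMr ?absv_ge0//; apply/hy; rewrite -yE//.
rewrite -vol_scaled; apply: (vol_le _ _ jX); split=> //.
  by have [_ [a a0 h] _] := lY; exists a => // x' /XY/h.
have [_ _ [a a0 h]] := scaled_pow_latt j.
by exists a => // x' /h/jX.
Qed.

End Line.

(** * Hyperplanes *)

Section Hyperplanes.
Variables (R : realType) (F : nonArchLocalFieldType R) (V : vectType F).
Variables (Lam : set V) (lL : latt Lam).
Implicit Types (g h : 'End(V)) (E L M N : {vspace V}) (W : vectType F).
Local Notation pi_ := (unif F).
Hypothesis n0 : (0 < \dim {:V})%N.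

(** By near_lev it is enough to compare the points of L with M, that is, to
    look at the image of L in the line V / M. *)
Lemma lev_scaled m L M : \dim L = \dim M ->
  lev Lam m L M <-> quot_proj M @` slat Lam L `<=` scaled (qlat Lam M) m.+1.
Proof.
move=> dLM; split=> [h _ [x [Lx xL] <-]|h].
  have [x' [xM' Lx' [y Ly ->]]] := lev_near lL h xL Lx.
  exists (quot_proj M y); first by exists y.
  by move: xM'; rewrite -quot_proj_eq0 quot_projD quot_projZ => /eqP ->; rewrite add0r.
apply: near_lev => // x xL Lx.
have [|_ [y Ly <-]] := h (quot_proj M x); first by exists x.
rewrite -quot_projZ => e; exists (x - pi_ ^+ m.+1 *: y); split.
- by rewrite -quot_proj_eq0 -qpE linearB /= !qpE e subrr.
- apply: submodB => //; first exact: latt_submod lL.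
  by apply: submodZ => //; [exact: latt_submod lL|exact: absv_unif_le1].
by exists y => //; rewrite subrK.
Qed.

(** In the line V / M the image of L is a multiple of the lattice by a power
    of the uniformizer, and the exponent measures how close L is to M. The
    number r is the volume of the multiple by pi itself, which is the same for
    all M by transitivity. *)
Lemma delta_hyper : exists2 r : R, 0 < r < 1 & forall L M,
  \dim L = (\dim {:V}).-1 -> \dim M = (\dim {:V}).-1 -> forall j,
  (lev Lam j L M -> delta Lam L M <= r ^+ j.+1) /\
  (~ lev Lam j L M -> r ^+ j <= delta Lam L M).
Proof.
have [[M0 dM0]|n] := pselect (exists M, \dim M = (\dim {:V}).-1); last first.
  by exists 2^-1 => [|L M dL]; [rewrite invr_gt0 invf_lt1 ?ltr0n ?ltr1n|exfalso; apply: n; exists L].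
have dq M : \dim M = (\dim {:V}).-1 -> \dim {: quot M} = 1%N by rewrite dim_quot => ->; lia.
exists (vol (qlat Lam M0) (scaled (qlat Lam M0) 1)).
  by apply: vol_scaled_lt1; [exact: qlat_latt|exact: dq].
move=> L M dL dM j; have lq := qlat_latt lL M.
have -> : vol (qlat Lam M0) (scaled (qlat Lam M0) 1) = vol (qlat Lam M) (scaled (qlat Lam M) 1).
  have [|g kg gM] := @GL_transitive _ _ _ _ lL M0 M; first by rewrite dM0.
  have [U [kU sU UE]] := quot_move M0 kg; rewrite -gM in U kU sU UE.
  have Uq : U @` qlat Lam M0 = qlat Lam M.
    rewrite /qlat image_comp; rewrite -[in RHS]kg.2 image_comp.
    by apply: eq_imagel => x _; rewrite /= UE.
  rewrite -(vol_iso _ _ kU sU) Uq; congr vol.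
  rewrite /scaled -Uq; apply/seteqP; split=> [_ [_ [y qy <-] <-]|_ [_ [y qy <-] <-]].
    by exists (U y); [exists y|rewrite linearZ].
  by exists (pi_ ^+ 1 *: y); [exists y|rewrite linearZ].
have sX : submod (quot_proj M @` slat Lam L).
  by rewrite quot_img; apply: submod_img; exact: slat_submod.
have XY : quot_proj M @` slat Lam L `<=` qlat Lam M by apply: image_subset => x [].
split=> [/lev_scaled h|h].
  by apply: vol_le_scaled => //; apply: h; rewrite dL dM.
by apply: (vol_ge_scaled lq) => //; [exact: dq|move=> hh; apply: h; apply/lev_scaled; rewrite // dL dM].
Qed.

End Hyperplanes.

(** * Averages over the lines of a subspace *)

Section Slices.
Variables (R : realType) (F : nonArchLocalFieldType R) (V : vectType F).
Variables (Lam : set V) (lL : latt Lam).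
Implicit Types (E L M N : {vspace V}).

Section OneSubspace.
Variables (E : {vspace V}) (dE : (0 < \dim E)%N).

Let dE' : (1 <= \dim {: subvs_of E})%N. Proof. by rewrite dim_subvs. Qed.

Definition line_mean : mean R := gr_mean (elat_latt lL E) dE'.

Lemma slat_limg_inc (e : {vspace subvs_of E}) :
  slat Lam (inc E @: e) = inc E @` slat (elat Lam E) e.
Proof.
apply/seteqP; split=> [x [Lx /memv_imgP[u ue xu]]|_ [u [Lu ue] <-]].
  by exists u => //; split=> //; rewrite /elat /= -incE -xu.
by split; [rewrite /= incE|rewrite /= memv_img].
Qed.

Lemma lev_inc m (e e' : {vspace subvs_of E}) : lev (elat Lam E) m e e' ->
  near_sub Lam m (inc E @: e)%VS (inc E @: e')%VS.
Proof.
move=> h x; rewrite slat_limg_inc => -[u [Lu ue] <-].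
have [u' [ue' Lu' [y Ly ->]]] := lev_near (elat_latt lL E) h ue Lu.
exists (inc E u'); first by rewrite slat_limg_inc; exists u'.
by exists (inc E y); [rewrite incE|rewrite linearD linearZ].
Qed.

Lemma dim_limg_inc (e : {vspace subvs_of E}) : \dim (inc E @: e) = \dim e.
Proof. by rewrite limg_dim_eq// (eqP (lker_inc E)) capv0. Qed.

Lemma uc_slice_pair l (hl : (l <= \dim {:V})%N) :
  uc (M:=mean_prod (gr_mean lL hl) line_mean) (fun z => delta Lam (inc E @: z.2)%VS z.1).
Proof.
move=> e e0; have [m hm] := inv_small (divr_gt0 e0 (ltr0n R 2)).
exists m => -[L x] [L' x'] _ [/= h1 h2].
have {}h2 : `|delta Lam (inc E @: x)%VS L - delta Lam (inc E @: x')%VS L| <= e / 2.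
  apply: le_trans hm; apply: delta_near => //; apply: lev_inc => //.
  exact: (lev_sym (elat_latt lL E)).
have {}h1 : `|delta Lam (inc E @: x')%VS L - delta Lam (inc E @: x')%VS L'| <= e / 2.
  by apply: le_trans hm; apply: delta_lev => //; exact: lev_refl.
rewrite -(subrKA (delta Lam (inc E @: x')%VS L)) (le_trans (ler_normD _ _))//; lra.
Qed.

(** For a hyperplane L that does not contain E, the factor of a line e of E
    with respect to L is the factor of E times the factor of e with respect to
    the trace of L on E. *)
Lemma slice : exists2 c : R, 0 < c & forall L, \dim L = (\dim {:V}).-1 ->
  mint line_mean (fun e => delta Lam (inc E @: e)%VS L) = c * delta Lam E L.
Proof.
have n0 : (0 < \dim {:V})%N := leq_trans dE (dimvS (subvf E)).
have [c c0 hc] := kappa (elat_latt lL E) dE'.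
exists c => // L dL; pose T := (qp L \o inc E)%VF.
have [h|h] := eqVneq (E + L)%VS fullv; last first.
  rewrite (delta_eq0 lL h) mulr0; apply: mean_const_in => e _; apply: delta_eq0 => //.
  have eE : (inc E @: e <= limg (inc E))%VS by rewrite limgS ?subvf.
  rewrite limg_inc in eE.
  by apply: contra h => /eqP h; rewrite eqEsubv subvf -h addvS.
have sT : limg T = fullv.
  by rewrite limg_comp limg_inc; apply/eqP; rewrite limg_addv ?limg_qp// lker_qp h.
have lT := latt_img sT (elat_latt lL E).
have eE : vol (qlat Lam L) (T @` elat Lam E) = delta Lam E L.
  rewrite /delta quot_img slat_inc; congr vol.
  by rewrite image_comp; apply: eq_imagel => x _; rewrite comp_lfunE.
have de e : delta Lam (inc E @: e)%VS L = delta Lam E L * delta (elat Lam E) e (lker T).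
  rewrite -(@delta_map _ _ _ (elat Lam E) _ T e (lker T))// -eE -vol_trans//.
  rewrite /delta quot_img slat_limg_inc; congr vol.
  by rewrite image_comp; apply: eq_imagel => x _; rewrite comp_lfunE.
rewrite -(hc (lker T)); last first.
  have := limg_ker_dim T fullv; rewrite capfv sT dim_quot dL; lia.
rewrite mulrC -meanZ; last exact: uc_delta.
by congr mint; apply/funext => e; rewrite de.
Qed.

End OneSubspace.

Section Injectivity.
Hypothesis n2 : (1 < \dim {:V})%N.
Local Notation GM := (gr_mean lL (leq_pred (\dim {:V}))).

(** Average the hypothesis over the lines of E and exchange the integrals. *)
Lemma slice_mean E : (0 < \dim E)%N -> exists2 c : R, 0 < c &
  forall (a : {vspace V} -> R) t, uc (M:=GM) a ->
  (forall e, \dim e = 1%N -> mint GM (fun L => a L * delta Lam e L) = t) ->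
  c * mint GM (fun L => a L * delta Lam E L) = t.
Proof.
move=> dE; have [c c0 hc] := slice dE; exists c => // a t ua h.
rewrite -meanZ; last by apply: uc_mul => //; exact: uc_delta_r.
pose H (z : mpt GM * mpt (line_mean dE)) : R := a z.1 * delta Lam (inc E @: z.2)%VS z.1.
have uH : uc (M:=mean_prod GM (line_mean dE)) H.
  exact: (uc_mul (uc_fst (line_mean dE) ua) (uc_slice_pair dE _)).
transitivity (mint GM (fun L => mint (line_mean dE) (fun e => H (L, e)))).
  apply: mean_ext => [|L dL].
    apply: (@uc_ext _ GM _ _ (uc_lin c (uc_mul ua (uc_delta_r lL _ E)) (uc_const GM 0))) => L _.
    by rewrite addr0.
  transitivity (a L * mint (line_mean dE) (fun e => delta Lam (inc E @: e)%VS L)).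
    by rewrite hc// mulrCA.
  by rewrite -meanZ//; exact: (uc_slice dL (uc_slice_pair dE _)).
rewrite (mean_fubini uH); apply: mean_const_in => e de.
exact: (h (inc E @: e)%VS (etrans (dim_limg_inc e) de)).
Qed.

(** The constant of slice_mean depends only on the dimension of E, by
    transitivity. *)
Lemma line_mass k : (0 < k)%N -> exists2 c : R, 0 < c &
  forall (a : {vspace V} -> R) t, uc (M:=GM) a ->
  (forall e, \dim e = 1%N -> mint GM (fun L => a L * delta Lam e L) = t) ->
  forall E, \dim E = k -> mint GM (fun L => a L * delta Lam E L) = c * t.
Proof.
move=> k0; have [[E0 dE0]|n] := pselect (exists E, \dim E = k); last first.
  by exists 1 => // a t _ _ E dE; exfalso; apply: n; exists E.
have [|c c0 hc] := @slice_mean E0; first by rewrite dE0.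
exists c^-1 => [|a t ua h E dE]; first by rewrite invr_gt0.
have [g kg ->] : exists2 g, GLlat Lam g & E = (g @: E0)%VS.
  by apply: GL_transitive => //; rewrite dE dE0.
have inv e : mint GM (fun L => a L * delta Lam (g @: e)%VS L) =
    mint GM (fun L => a (g @: L)%VS * delta Lam e L).
  rewrite -(@gr_mean_invariant _ _ _ _ lL _ (leq_pred _) g
    (fun L => a L * delta Lam (g @: e)%VS L) kg); last first.
    by apply: uc_mul => //; exact: uc_delta_r.
  by congr mint; apply/funext => L; rewrite delta_GL.
have uag : uc (M:=GM) (fun L => a (g @: L)%VS).
  move=> e /ua[m hm]; exists m => L L' dL LL'; apply: hm; last exact: lev_GL.
  by rewrite /= /gr_dom (GL_dim _ (GL_ker kg)).
rewrite inv; apply: (mulfI (lt0r_neq0 c0)); rewrite mulrA mulfV ?gt_eqF// mul1r.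
apply: hc => // e de; rewrite -inv; apply: h.
by rewrite (GL_dim _ (GL_ker kg)).
Qed.

Lemma slice0 (a : {vspace V} -> R) E : uc (M:=GM) a -> (0 < \dim E)%N ->
  (forall e, \dim e = 1%N -> mint GM (fun L => a L * delta Lam e L) = 0) ->
  mint GM (fun L => a L * delta Lam E L) = 0.
Proof.
by move=> ua dE h; have [c _ hc] := line_mass dE; rewrite (hc a 0 ua h) ?mulr0.
Qed.

Lemma hyper_negative (a : {vspace V} -> R) m L0 :
  (forall L M, \dim L = (\dim {:V}).-1 -> lev Lam m L M -> a L = a M) ->
  mint GM a = 0 -> \dim L0 = (\dim {:V}).-1 -> a L0 != 0 ->
  mint GM (fun L => mint GM (fun M => a L * a M * delta Lam L M)) < 0.
Proof.
move=> am a0 dL0 aL0; have [r r01 hr] := delta_hyper lL (ltnW n2).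
apply: (@ultrametric_negative R GM (delta Lam) r r01 _ _ _ _ a m L0) => //.
- exact: delta_ge0.
- exact: delta_le1.
- by move=> L M j dL dM; exact: hr.
exact: uc_delta_pair.
Qed.

(** By slicing, a vanishing transform forces both the integral of a and its
    quadratic form with kernel delta to vanish; hyper_negative excludes this
    unless a = 0. *)
Lemma transform_inj (a : {vspace V} -> R) m :
  (forall L M, \dim L = (\dim {:V}).-1 -> lev Lam m L M -> a L = a M) ->
  (forall e, \dim e = 1%N -> mint GM (fun L => a L * delta Lam e L) = 0) ->
  forall L, \dim L = (\dim {:V}).-1 -> a L = 0.
Proof.
move=> am h L0 dL0; apply/eqP/negPn/negP => aL0.
have ua : uc (M:=GM) a by apply: (uc_lc (m:=m)) => L M dL; exact: am.
have a0 : mint GM a = 0.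
  rewrite -(slice0 (E:=fullv) ua _ h) ?(ltnW n2)//.
  by congr mint; apply/funext => L; rewrite delta_full// mulr1.
have := hyper_negative am a0 dL0 aL0.
rewrite (@mean_const_in _ GM 0) ?ltxx//.
move=> L dL; have dL' : (0 < \dim L)%N by rewrite dL; lia.
have := slice0 ua dL' h => {}h.
transitivity (mint GM (fun M => a L * (a M * delta Lam L M))).
  by congr mint; apply/funext => M; rewrite mulrA.
by rewrite meanZ ?h ?mulr0//; apply: uc_mul => //; exact: uc_delta_r.
Qed.

End Injectivity.
End Slices.

(** * Classes of lines and of hyperplanes *)

Section Orthogonal.
Variables (R : realType) (F : nonArchLocalFieldType R) (V : vectType F).
Variables (Lam : set V) (lL : latt Lam).
Implicit Types (E L M N : {vspace V}).
Local Notation pi_ := (unif F).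
Let sL : submod Lam := latt_submod lL.
Variables (b : seq V) (hb : obasis Lam fullv b).

Let co (x : V) (i : 'I_(size b)) : F := coord (in_tuple b) i x.

Let coE x : x = \sum_i co x i *: b`_i.
Proof. by rewrite {1}(@coord_basis _ _ _ _ (in_tuple b) x hb.1) ?memvf. Qed.

Let Lam_co x : Lam x <-> forall i, absv (co x i) <= 1.
Proof.
pose c i := if insub i is Some i' then co x i' else 0.
have cE (i : 'I_(size b)) : c i = co x i by rewrite /c valK.
have e : \sum_(i < size b) c i *: b`_i = x.
  by rewrite [RHS]coE; apply: eq_bigr => i _; rewrite cE.
split=> [Lx i|h].
  by have := (hb.2 c).1; rewrite e -cE => /(_ Lx); exact.
by rewrite -e; apply/(hb.2 c) => i ib; have := h (Ordinal ib); rewrite -cE.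
Qed.

Let co_basis (i j : 'I_(size b)) : co b`_j i = (i == j)%:R.
Proof. by rewrite /co eq_sym; exact: (@coord_free _ _ _ (in_tuple b) j i (basis_free hb.1)). Qed.

Definition dot (x y : V) : F := \sum_i co x i * co y i.

Let dot_linear x : linear (dot x : V -> F^o).
Proof.
move=> a u v; rewrite /dot scaler_sumr -big_split /=; apply: eq_bigr => i _.
by rewrite /co linearP mulrDr /= mulrCA.
Qed.

Definition perp x : {vspace V} := lker (mklin (dot_linear x)).

Lemma mem_perp x y : (y \in perp x) = (dot x y == 0).
Proof. by rewrite memv_ker mklinE. Qed.

Lemma dot_basis x (j : 'I_(size b)) : dot x b`_j = co x j.
Proof.
rewrite /dot (bigD1 j)//= co_basis eqxx mulr1 big1 ?addr0// => i ij.
by rewrite co_basis (negbTE ij) mulr0.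
Qed.

Lemma dim_perp x : x != 0 -> \dim (perp x) = (\dim {:V}).-1.
Proof.
move=> x0; have [i xi] : exists i, co x i != 0.
  apply: contrapT => h; move/eqP: x0; apply; rewrite (coE x) big1// => i _.
  by have [->|xi] := eqVneq (co x i) 0; [rewrite scale0r|exfalso; apply: h; exists i].
have := limg_ker_dim (mklin (dot_linear x)) fullv; rewrite capfv -/(perp x).
have -> : limg (mklin (dot_linear x)) = fullv.
  apply/eqP; rewrite eqEsubv subvf; apply/subvP => c _; apply/memv_imgP.
  exists ((c / co x i) *: b`_i); first exact: memvf.
  by rewrite linearZ /= mklinE dot_basis; apply/esym; exact: divfK.
by rewrite [\dim {: F^o}]dimvf /= addn1 => <-.
Qed.

(** Orthogonality against the vectors x_i b_j - x_j b_i determines z up to a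
    scalar, at every level of precision. *)
Lemma perp_lev m x z : (forall c, Lam (c *: x) <-> absv c <= 1) -> Lam z ->
  (forall c, Lam (c *: z) <-> absv c <= 1) ->
  lev Lam m (perp x) (perp z) -> lev Lam m <[x]>%VS <[z]>%VS.
Proof.
move=> px Lz pz h.
have Lx : Lam x by rewrite -[x]scale1r; apply/px; rewrite absv1.
have nz y : (forall c, Lam (c *: y) <-> absv c <= 1) -> y != 0.
  move=> py; apply/eqP => y0; have := (py pi_^-1).1.
  rewrite y0 scaler0 absvV => /(_ (let: And3 h _ _ := sL in h)).
  by rewrite invf_le1 ?absv_gt0 ?unif_neq0// leNgt unif_lt1.
have [i0 xi] : exists i, absv (co x i) = 1.
  apply: contrapT => h0; have := (px pi_^-1).1.
  rewrite absvV => h1; have : (absv pi_)^-1 <= 1.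
    apply: h1; apply/Lam_co => i; rewrite /co linearZ /= -/(co x i) absvM absvV.
    rewrite mulrC ler_pdivrMr ?absv_gt0 ?unif_neq0// mul1r; apply: unif_max.
    rewrite lt_neqAle (Lam_co x).1// andbT; apply/eqP => xi; apply: h0; by exists i.
  by rewrite invf_le1 ?absv_gt0 ?unif_neq0// leNgt unif_lt1.
set t := co x i0 in xi.
have t0 : t != 0 by rewrite -absv_gt0 xi.
have Lb (j : 'I_(size b)) : Lam b`_j by have [] := obasis_mem hb (ltn_ord j).
have hs' (j : 'I_(size b)) : exists s, absv s <= 1 /\ t * co z j - co x j * co z i0 = pi_ ^+ m.+1 * s.
  have dE y : dot y (t *: b`_j - co x j *: b`_i0) = t * co y j - co x j * co y i0.
    rewrite -[dot y _](mklinE (dot_linear y)) linearB !linearZ /= !mklinE !dot_basis.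
    exact: (congr1 (fun u => t * co y j + u) (mulrN _ _)).
  have [||y' [y'z Ly' [q Lq qE]]] := lev_near lL h (x := t *: b`_j - co x j *: b`_i0).
  - by rewrite mem_perp dE mulrC subrr.
  - by apply: submodB => //; apply: submodZ => //; [rewrite xi|apply: (Lam_co x).1].
  exists (dot z q); split.
    apply: absv_sum_le => // i _; rewrite absvM_le1//; [exact: (Lam_co z).1|exact: (Lam_co q).1].
  rewrite -dE qE -[dot z _](mklinE (dot_linear z)) linearD linearZ /= !mklinE.
  by move: y'z; rewrite mem_perp => /eqP ->; rewrite add0r.
have [s hs] := choice hs'.
apply: (lev_sym lL); apply: near_lev => //.
  by rewrite !dim_vline !nz.
move=> _ /vlineP[c ->] /pz c1.
have zE : z = (co z i0 / t) *: x + pi_ ^+ m.+1 *: \sum_j (s j / t) *: b`_j.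
  rewrite {1}(coE z) (coE x) !scaler_sumr -big_split /=; apply: eq_bigr => j _.
  rewrite !scalerA -scalerDl; congr (_ *: _).
  have [_ e] := hs j; rewrite [pi_ ^+ _ * _]mulrA -e.
  by move: (co z i0) (co z j) (co x j) t0 => ? ? ? ?; field.
exists ((c * (co z i0 / t)) *: x); split.
- by rewrite memvZ// memv_line.
- apply/px; rewrite !absvM absvV xi invr1 mulr1 -absvM; apply: absvM_le1 => //.
  exact: (Lam_co z).1.
exists (c *: \sum_j (s j / t) *: b`_j).
  apply: submodZ => //; apply: submod_sum => // j _; apply: submodZ => //.
  by rewrite absvM absvV xi invr1 mulr1; exact: (hs j).1.
by rewrite {1}zE scalerDr !scalerA [c * pi_ ^+ _]mulrC.
Qed.

Lemma primitive_vector e : \dim e = 1%N -> exists x, [/\ e = <[x]>%VS, Lam x &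
  forall c, Lam (c *: x) <-> absv c <= 1].
Proof.
move=> de; have [b1 h1] := obasis_exists lL e.
have := obasis_dim h1; rewrite de.
case: b1 h1 => [|x [|]]// [bb h1] _; exists x.
have h c : Lam (c *: x) <-> absv c <= 1.
  have := h1 (fun=> c); rewrite big_ord1 /= => ->.
  by split=> [/(_ 0%N isT)|h] //.
split=> //; first by rewrite -span_seq1 (span_basis bb).
by rewrite -[x]scale1r; apply/h; rewrite absv1.
Qed.

(** By perp_lev, lines in different classes have orthogonal hyperplanes in
    different classes. *)
Lemma lines_le_hyperplanes m (xs ys : seq {vspace V}) : uniq xs ->
  (forall x, x \in xs -> \dim x = 1%N) ->
  (forall x y, x \in xs -> y \in xs -> lev Lam m x y -> x = y) ->
  (forall L, \dim L = (\dim {:V}).-1 -> exists2 y, y \in ys & lev Lam m y L) ->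
  (size xs <= size ys)%N.
Proof.
move=> ux dx ix cy.
have hf' e : exists y, e \in xs -> y \in ys /\ exists x, [/\ e = <[x]>%VS, Lam x,
    forall c, Lam (c *: x) <-> absv c <= 1 & lev Lam m y (perp x)].
  have [ex|] := boolP (e \in xs); last by exists 0%VS.
  have [x [eE Lx px]] := primitive_vector (dx e ex).
  have x0 : x != 0.
    by apply/eqP => x0; have := dx e ex; rewrite eE x0 dim_vline eqxx.
  have [y ys' yx] := cy (perp x) (dim_perp x0).
  by exists y => _; split=> //; exists x.
have [f hf] := choice hf'.
rewrite -(size_map f); apply: uniq_leq_size.
  rewrite map_inj_in_uniq// => e e' ex ex' fe.
  have [_ [x [eE Lx px h]]] := hf e ex; have [_ [x' [eE' Lx' px' h']]] := hf e' ex'.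
  apply: ix => //; rewrite eE eE'; apply: perp_lev => //.
  by apply: (lev_trans lL (lev_sym lL h)); rewrite fe.
by move=> _ /mapP[e ex ->]; have [] := hf e ex.
Qed.

End Orthogonal.

(** * The transform on functions of a given level *)

Section Level.
Variables (R : realType) (F : nonArchLocalFieldType R) (V : vectType F).
Variables (Lam : set V) (lL : latt Lam).
Implicit Types (E L M N : {vspace V}).

Definition level (T : Type) k m (f : {vspace V} -> T) :=
  forall E E', \dim E = k -> lev Lam m E E' -> f E = f E'.

Section OneDimension.
Variables (k : nat) (hk : (k <= \dim {:V})%N) (m : nat).
Local Notation GM := (gr_mean lL hk).

Lemma level_uc (f : {vspace V} -> R) : level k m f -> uc (M:=GM) f.
Proof. by move=> h; apply: (uc_lc (m:=m)) => E E'; exact: h. Qed.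

Definition cls (x E : {vspace V}) : R := if `[< lev Lam m x E >] then 1 else 0.

Lemma cls_lev x E E' : lev Lam m E E' -> cls x E = cls x E'.
Proof.
move=> h; rewrite /cls (@asbool_equiv_eq _ (lev Lam m x E'))//; split=> h'.
  exact: (lev_trans lL h' h).
exact: (lev_trans lL h' (lev_sym lL h)).
Qed.

Lemma cls_uc x : uc (M:=GM) (cls x).
Proof. by apply: level_uc => E E' _; exact: cls_lev. Qed.

Variables (xs : seq {vspace V}) (ux : uniq xs).
Hypothesis dx : forall x, x \in xs -> \dim x = k.
Hypothesis cx : forall E, \dim E = k -> exists2 x, x \in xs & lev Lam m x E.
Hypothesis ix : forall x y, x \in xs -> y \in xs -> lev Lam m x y -> x = y.

Lemma level_mint (f : {vspace V} -> R) : level k m f -> mint GM f = avg xs f.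
Proof.
move=> lf; apply/eqP; rewrite -subr_eq0 -normr_le0.
apply: (gr_int_approx lL hk ux dx cx ix) => [|x y d xy].
  exact: (level_uc lf).
by rewrite (lf x y)// subrr normr0.
Qed.

Lemma cls_sum (c : {vspace V} -> R) E x : x \in xs -> lev Lam m x E ->
  \sum_(y <- xs) c y * cls y E = c x.
Proof.
move=> xxs xE; rewrite (big_rem x)//= {1}/cls asboolT// mulr1.
rewrite big_seq big1 ?addr0// => y; rewrite mem_rem_uniq// inE => /andP[yx yxs].
rewrite /cls asboolF ?mulr0// => h; move/eqP: yx; apply.
by apply: ix => //; exact: (lev_trans lL h (lev_sym lL xE)).
Qed.

Lemma level_decomp (f : {vspace V} -> R) E : level k m f -> \dim E = k ->
  f E = \sum_(x <- xs) f x * cls x E.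
Proof.
move=> lf dE; have [x xxs xE] := cx dE.
by rewrite (cls_sum f xxs xE) (lf x E)// dx.
Qed.

Lemma size_transversal_neq0 : (size xs)%:R != 0 :> R.
Proof.
have [ys [ys0 dys _ _]] := mean_approx GM 0.
rewrite pnatr_eq0 size_eq0; apply/eqP => xs0.
case: ys ys0 dys => // y ys _ /(_ y); rewrite inE eqxx => /(_ isT) dy.
by have [x] := cx dy; rewrite xs0.
Qed.

Lemma mint_cls (f : {vspace V} -> R) x : x \in xs -> level k m f ->
  mint GM (fun E => cls x E * f E) = (size xs)%:R^-1 * f x.
Proof.
move=> xxs lf; rewrite level_mint; last by move=> E E' dE h; rewrite (cls_lev x h) (lf E E').
rewrite /avg; congr (_ * _); rewrite (big_rem x)//= {1}/cls asboolT ?mul1r; last exact: lev_refl.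
rewrite big_seq big1 ?addr0// => y; rewrite mem_rem_uniq// inE => /andP[yx yxs].
rewrite /cls asboolF ?mul0r// => h; move/eqP: yx; apply.
by apply: ix => //; exact: (lev_sym lL h).
Qed.

End OneDimension.

Section Transform.
Variables (k l : nat) (hk : (k <= \dim {:V})%N) (hl : (l <= \dim {:V})%N) (m : nat).
Local Notation GK := (gr_mean lL hk).
Local Notation GL := (gr_mean lL hl).

(** Up to normalisation, the entries of the matrix of the transform. *)
Definition kernel_mass x N : R := mint GK (fun E => cls m x E * delta Lam E N).

Let uJ x N : uc (M:=GK) (fun E => cls m x E * delta Lam E N).
Proof. by apply: uc_mul; [exact: cls_uc|exact: uc_delta]. Qed.

Lemma kernel_mass_level x j : level j m (kernel_mass x).
Proof.
move=> N _ dN [g gG ->]; have kg := congr_GL lL gG.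
rewrite /kernel_mass -(@gr_mean_invariant _ _ _ _ lL _ hk g _ kg (uJ x (g @: N)%VS)).
congr mint; apply/funext => E; rewrite delta_GL//; congr (_ * _).
by apply: cls_lev => //; exists g.
Qed.

Definition transform (h : {vspace V} -> R) E : R := mint GL (fun N => h N * delta Lam E N).

Lemma transform_level h j : level l m h -> level j m (transform h).
Proof.
move=> lh E _ dE [g gG ->]; have kg := congr_GL lL gG.
have uh : uc (M:=GL) (fun N => h N * delta Lam (g @: E)%VS N).
  by apply: uc_mul; [exact: (level_uc hl lh)|exact: uc_delta_r].
rewrite /transform -(@gr_mean_invariant _ _ _ _ lL _ hl g _ kg uh).
apply: mean_ext => [|N dN]; first by apply: uc_mul; [exact: (level_uc hl lh)|exact: uc_delta_r].
by rewrite delta_GL//; congr (_ * _); apply: lh => //; exists g.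
Qed.

Variables (xs ys : seq {vspace V}).
Hypothesis hxs : [/\ uniq xs, (forall x, x \in xs -> \dim x = k),
  (forall E, \dim E = k -> exists2 x, x \in xs & lev Lam m x E) &
  (forall x y, x \in xs -> y \in xs -> lev Lam m x y -> x = y)].
Hypothesis hys : [/\ uniq ys, (forall x, x \in ys -> \dim x = l),
  (forall E, \dim E = l -> exists2 x, x \in ys & lev Lam m x E) &
  (forall x y, x \in ys -> y \in ys -> lev Lam m x y -> x = y)].

Lemma transformE h x : x \in xs -> level l m h ->
  transform h x = (size xs)%:R / (size ys)%:R * \sum_(y <- ys) h y * kernel_mass x y.
Proof.
move=> xxs lh; have [ux dx cx ix] := hxs; have [uy dy cy iy] := hys.
have N0 := size_transversal_neq0 hk cx.
apply: (mulfI (invr_neq0 N0)); rewrite -(mint_cls hk ux dx cx ix xxs (transform_level (j:=k) lh)).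
rewrite !mulrA mulVf// mul1r.
have uh : uc (M:=GL) h := level_uc hl lh.
pose H (z : mpt GK * mpt GL) := cls m x z.1 * (h z.2 * delta Lam z.1 z.2).
have uH : uc (M:=mean_prod GK GL) H.
  apply: (uc_mul (uc_fst GL (cls_uc hk m x))).
  by apply: (uc_mul (uc_snd GK uh)); exact: uc_delta_pair.
transitivity (mint GK (fun E => mint GL (fun N => H (E, N)))).
  congr mint; apply/funext => E; rewrite /H /= -meanZ//.
  by apply: uc_mul => //; exact: uc_delta_r.
rewrite (mean_fubini uH) -[RHS]/(avg ys (fun y => h y * kernel_mass x y)).
rewrite -(level_mint hl uy dy cy iy); last first.
  move=> N N' dN hN.
  by have e1 := lh N N' dN hN; have e2 := kernel_mass_level x dN hN; rewrite e1 e2.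
congr mint; apply/funext => N; rewrite /H /kernel_mass -meanZ; last exact: uJ.
by congr mint; apply/funext => E /=; rewrite mulrCA.
Qed.

Lemma kernel_mass_sum (w : {vspace V} -> R) N :
  \sum_(x <- xs) w x * kernel_mass x N = mint GK (fun E => (\sum_(x <- xs) w x * cls m x E) * delta Lam E N).
Proof.
under eq_bigr => x _ do rewrite -(meanZ (w x) (uJ x N)).
rewrite -mean_sum; last first.
  by move=> x; apply: uc_ext (uc_lin (w x) (uJ x N) (uc_const GK 0)) _ => E _; rewrite addr0.
congr mint; apply/funext => E; rewrite mulr_suml; apply: eq_bigr => x _.
by rewrite mulrA.
Qed.

(** The Fredholm alternative for the transform, which on functions of a given
    level is a finite matrix. *)
Lemma transform_solve (v : {vspace V} -> R) : level k m v ->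
  (forall w, level k m w ->
    (forall N, \dim N = l -> mint GK (fun E => w E * delta Lam E N) = 0) ->
    mint GK (fun E => w E * v E) = 0) ->
  exists h, (forall j, level j m h) /\ forall E, \dim E = k -> transform h E = v E.
Proof.
move=> lv hv; have [ux dx cx ix] := hxs; have [uy dy cy iy] := hys.
pose A := \matrix_(i < size ys, j < size xs) kernel_mass (nth 0%VS xs j) (nth 0%VS ys i).
have AE i j : A i j = kernel_mass (nth 0%VS xs j) (nth 0%VS ys i) by rewrite mxE.
pose c : R := (size xs)%:R / (size ys)%:R.
have c0 : c != 0 by rewrite mulf_neq0 ?invr_eq0 ?(size_transversal_neq0 hk cx) ?(size_transversal_neq0 hl cy).
pose u := \row_(j < size xs) (c^-1 * v (nth 0%VS xs j)).
have : (u <= A)%MS.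
  rewrite submxE; apply/eqP/matrixP => i q; rewrite !mxE.
  pose w0 (x : {vspace V}) := if insub (index x xs) is Some j then cokermx A j q else 0.
  have w0E (j : 'I_(size xs)) : w0 (nth 0%VS xs j) = cokermx A j q.
    by rewrite /w0 index_uniq ?valK.
  pose w E := \sum_(x <- xs) w0 x * cls m x E.
  have lw : level k m w.
    by move=> E E' dE h; apply: eq_bigr => x _; rewrite (cls_lev x h).
  have hN N : \dim N = l -> mint GK (fun E => w E * delta Lam E N) = 0.
    move=> dN; rewrite /w -kernel_mass_sum; have [y yys yN] := cy N dN.
    transitivity (\sum_(x <- xs) w0 x * kernel_mass x y).
      by apply: eq_bigr => x _; rewrite (kernel_mass_level x (dy y yys) yN).
    have := congr1 (fun B : 'M[R]_(size ys, size xs) => B (Ordinal (n:=size ys) (m:=index y ys) (etrans (index_mem y ys) yys)) q) (mulmx_coker A).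
    rewrite !mxE => {2}<-; rewrite (big_nth 0%VS) big_mkord; apply: eq_bigr => j _.
    by rewrite w0E AE /= nth_index// mulrC.
  have h : \sum_(x <- xs) w0 x * v x = 0.
    apply: (mulfI (invr_neq0 (size_transversal_neq0 hk cx))); rewrite mulr0 -[RHS](hv w lw hN).
    rewrite (level_mint hk ux dx cx ix) => [|E E' dE h].
      rewrite /avg; congr (_ * _); apply: eq_big_seq => x xxs.
      by rewrite /w (cls_sum ux ix w0 xxs)//; exact: lev_refl.
    by have e1 := lw E E' dE h; have e2 := lv E E' dE h; rewrite e1 e2.
  transitivity (c^-1 * \sum_(x <- xs) w0 x * v x); last by rewrite h mulr0.
  rewrite mulr_sumr (big_nth 0%VS) big_mkord; apply: eq_bigr => j _.
  by rewrite mxE w0E -mulrA [v _ * _]mulrC.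
move=> /submxP[B uB].
pose h0 (y : {vspace V}) := if insub (index y ys) is Some i then B ord0 i else 0.
have h0E (i : 'I_(size ys)) : h0 (nth 0%VS ys i) = B ord0 i by rewrite /h0 index_uniq ?valK.
pose h N := \sum_(y <- ys) h0 y * cls m y N.
have lh j : level j m h.
  by move=> E E' dE hE; apply: eq_bigr => x _; rewrite (cls_lev x hE).
exists h; split=> // E dE; have [x xxs xE] := cx E dE.
rewrite -(transform_level (lh l) (dx x xxs) xE) -(lv x E (dx x xxs) xE) transformE//.
have := congr1 (fun B : 'rV[R]_(size xs) => B ord0 (Ordinal (n:=size xs) (m:=index x xs) (etrans (index_mem x xs) xxs))) uB.
rewrite !mxE /= nth_index// => /(congr1 (fun t => c * t)); rewrite mulrA mulfV// mul1r => ->.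
rewrite -/c; congr (_ * _); rewrite (big_nth 0%VS) big_mkord; apply: eq_bigr => i _.
have e := cls_sum uy iy h0 (mem_nth 0%VS (ltn_ord i)) (lev_refl lL m _).
by rewrite AE /= nth_index// -h0E; congr (_ * _); exact: e.
Qed.

End Transform.
End Level.

(** * The transform from hyperplanes to lines *)

Section LineTransform.
Variables (R : realType) (F : nonArchLocalFieldType R) (V : vectType F).
Variables (Lam : set V) (lL : latt Lam).
Implicit Types (e E L M N : {vspace V}).
Hypothesis n2 : (1 < \dim {:V})%N.
Local Notation hn1 := (leq_pred (\dim {:V})).
Let h1 : (1 <= \dim {:V})%N := ltnW n2.
Local Notation GM := (gr_mean lL hn1).
Local Notation G1 := (gr_mean lL h1).

(** The matrix of the transform is injective on functions on hyperplanes and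
    has at most as many rows as columns, so its transpose is injective too. *)
Lemma transpose_inj m (w : {vspace V} -> R) : level Lam 1 m w ->
  (forall L, \dim L = (\dim {:V}).-1 -> mint G1 (fun e => w e * delta Lam e L) = 0) ->
  forall e, \dim e = 1%N -> w e = 0.
Proof.
move=> lw hw; have [xs hxs] := gr_reps lL m 1; have [ys hys] := gr_reps lL m (\dim {:V}).-1.
have [ux dx cx ix] := hxs; have [uy dy cy iy] := hys.
pose A := \matrix_(i < size xs, j < size ys) kernel_mass lL h1 m (nth 0%VS xs i) (nth 0%VS ys j).
have AE i j : A i j = kernel_mass lL h1 m (nth 0%VS xs i) (nth 0%VS ys j) by rewrite mxE.
have rA : row_free A^T.
  apply: inj_row_free => v vA.
  pose h0 (y : {vspace V}) := if insub (index y ys) is Some i then v ord0 i else 0.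
  have h0E (i : 'I_(size ys)) : h0 (nth 0%VS ys i) = v ord0 i by rewrite /h0 index_uniq ?valK.
  pose h N := \sum_(y <- ys) h0 y * cls Lam m y N.
  have lh j : level Lam j m h.
    by move=> E E' dE hE; apply: eq_bigr => x _; rewrite (cls_lev lL x hE).
  have hE (i : 'I_(size ys)) : h (nth 0%VS ys i) = v ord0 i.
    by rewrite -h0E; exact: (cls_sum lL uy iy h0 (mem_nth 0%VS (ltn_ord i)) (lev_refl lL m _)).
  have T0 e : \dim e = 1%N -> mint GM (fun L => h L * delta Lam e L) = 0.
    move=> de; have [x xxs xe] := cx e de.
    rewrite -[LHS]/(transform lL hn1 h e) -(transform_level lL hn1 (lh _) (dx x xxs) xe).
    rewrite (transformE lL h1 hn1 hxs hys xxs (lh _)).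
    suff -> : \sum_(y <- ys) h y * kernel_mass lL h1 m x y = 0 by rewrite mulr0.
    have := congr1 (fun B : 'rV[R]_(size xs) => B ord0 (Ordinal (n:=size xs) (m:=index x xs) (etrans (index_mem x xs) xxs))) vA.
    rewrite !mxE => {2}<-; rewrite (big_nth 0%VS) big_mkord; apply: eq_bigr => j _.
    by rewrite hE [A^T _ _]mxE AE /= nth_index.
  have h00 := transform_inj n2 (lh _) T0.
  by apply/rowP => j; rewrite mxE -hE; apply: h00; apply: dy; exact: mem_nth.
have {}rA : row_free A.
  rewrite /row_free eqn_leq rank_leq_row -mxrank_tr (eqP rA).
  have [b hb] := obasis_exists lL fullv.
  exact: (lines_le_hyperplanes lL hb ux dx ix cy).
pose u := \row_(i < size xs) w (nth 0%VS xs i).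
have uA : u *m A = 0.
  apply/rowP => j; rewrite !mxE.
  have dN : \dim (nth 0%VS ys j) = (\dim {:V}).-1 by apply: dy; exact: mem_nth.
  transitivity (mint G1 (fun e => w e * delta Lam e (nth 0%VS ys j))); last exact: hw.
  transitivity (\sum_(x <- xs) w x * kernel_mass lL h1 m x (nth 0%VS ys j)).
    by rewrite (big_nth 0%VS) big_mkord; apply: eq_bigr => i _; rewrite AE mxE.
  rewrite kernel_mass_sum; apply: mean_ext => [|e de].
    apply: uc_mul; last exact: uc_delta.
    apply: (level_uc lL h1 (m:=m)) => E E' dE hE.
    by apply: eq_bigr => x _; rewrite (cls_lev lL x hE).
  by congr (_ * _); apply/esym; exact: (level_decomp lL ux dx cx ix lw de).
have u0 : u = 0 by apply: (row_free_inj rA); rewrite uA mul0mx.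
move=> e de; have [x xxs xe] := cx e de; rewrite -(lw x e (dx x xxs) xe).
have := congr1 (fun B : 'rV[R]_(size xs) => B ord0 (Ordinal (n:=size xs) (m:=index x xs) (etrans (index_mem x xs) xxs))) u0.
by rewrite !mxE /= nth_index.
Qed.

Lemma solve_lines m (v : {vspace V} -> R) : level Lam 1 m v ->
  exists h, (forall j, level Lam j m h) /\
    forall e, \dim e = 1%N -> transform lL hn1 h e = v e.
Proof.
move=> lv; have [xs hxs] := gr_reps lL m 1; have [ys hys] := gr_reps lL m (\dim {:V}).-1.
apply: (@transform_solve _ _ _ _ lL _ _ h1 hn1 _ _ _ hxs hys _ lv) => w lw hw.
by apply: mean_const_in => e de; rewrite (transpose_inj lw hw de) mul0r.
Qed.

(** * Pairs of hyperplanes *)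

Local Notation PP := (mean_prod GM GM).
Let h2 : (2 <= \dim {:V})%N := n2.
Local Notation G2 := (gr_mean lL h2).

Lemma uc_delta2 k (hk : (k <= \dim {:V})%N) :
  uc (M:=mean_prod (gr_mean lL hk) PP) (fun z => delta2 Lam z.1 z.2.1 z.2.2).
Proof.
move=> e /inv_small[m hm]; exists m => -[E [L M]] [E' [L' M']] _ [hE [hL hM]].
by apply: le_trans hm; exact: delta2_lev.
Qed.

Variables (a b : {vspace V} -> R) (m : nat).
Hypothesis la : level Lam (\dim {:V}).-1 m a.
Hypothesis lb : level Lam (\dim {:V}).-1 m b.
Let ua : uc (M:=GM) a := level_uc lL hn1 la.
Let ub : uc (M:=GM) b := level_uc lL hn1 lb.

Definition pair_transform E : R :=
  mint GM (fun L => mint GM (fun M => a L * b M * delta2 Lam E L M)).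

Let uab k (hk : (k <= \dim {:V})%N) : uc (M:=mean_prod (gr_mean lL hk) PP)
  (fun z => a z.2.1 * b z.2.2 * delta2 Lam z.1 z.2.1 z.2.2).
Proof.
apply: uc_mul; last exact: uc_delta2.
exact: (uc_snd _ (uc_mul (uc_fst GM ua) (uc_snd GM ub))).
Qed.

Lemma pair_transform_level k : (k <= \dim {:V})%N -> level Lam k m pair_transform.
Proof.
move=> hk E _ dE [g gG ->]; have kg := congr_GL lL gG.
have u1 : uc (M:=PP) (fun z => a z.1 * b z.2 * delta2 Lam (g @: E)%VS z.1 z.2).
  have d1 : mdom (m0:=gr_mean lL hk) (g @: E)%VS by rewrite /= /gr_dom (GL_dim _ (GL_ker kg)).
  exact: (uc_slice d1 (uab hk)).
have u2 : uc (M:=PP) (fun z => a z.1 * b z.2 * delta2 Lam E z.1 z.2).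
  exact: (uc_slice (dE : mdom (m0:=gr_mean lL hk) E) (uab hk)).
rewrite /pair_transform -[RHS](@gr_mean_invariant _ _ _ _ lL _ hn1 g _ kg (uc_slice_int u1)).
apply: mean_ext => [|L dL]; first exact: (uc_slice_int u2).
have dgL : mdom (m0:=GM) (g @: L)%VS by rewrite /= /gr_dom (GL_dim _ (GL_ker kg)).
rewrite -[RHS](@gr_mean_invariant _ _ _ _ lL _ hn1 g _ kg (uc_slice dgL u1)).
apply: mean_ext => [|M dM]; first exact: (uc_slice dL u2).
rewrite /= delta2_GL//; congr (_ * _ * _).
  by apply: la => //; exists g.
by apply: lb => //; exists g.
Qed.

(** Exchanging the integrals and projecting along the intersection of the two
    hyperplanes. *)
Lemma pair_transform_mean (w : {vspace V} -> R) c : uc (M:=G2) w ->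
  (forall N, \dim N = (\dim {:V} - 2)%N -> mint G2 (fun E => w E * delta Lam E N) = c) ->
  mint G2 (fun E => w E * pair_transform E) =
  c * mint GM (fun L => mint GM (fun M => a L * b M * delta Lam L M)).
Proof.
move=> uw hw.
pose H (z : mpt G2 * mpt PP) : R := w z.1 * (a z.2.1 * b z.2.2 * delta2 Lam z.1 z.2.1 z.2.2).
have uH : uc (M:=mean_prod G2 PP) H by exact: (uc_mul (uc_fst PP uw) (uab h2)).
pose D (z : mpt PP) : R := a z.1 * b z.2 * delta Lam z.1 z.2.
have uD : uc (M:=PP) D.
  by apply: (uc_mul (uc_mul (uc_fst GM ua) (uc_snd GM ub))); exact: uc_delta_pair.
transitivity (mint G2 (fun E => mint PP (fun z => H (E, z)))).
  apply: mean_ext => [|E dE].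
    by apply: uc_mul => //; exact: (uc_slice_int (uab h2)).
  rewrite -[LHS](@meanZ _ PP (w E) (fun z => a z.1 * b z.2 * delta2 Lam E z.1 z.2))//.
  exact: (uc_slice dE (uab h2)).
rewrite (mean_fubini uH) -[RHS](@meanZ _ PP c D uD).
apply: mean_ext => [|[L M] [/= dL dM]]; first exact: (uc_slice_int (uc_swap uH)).
transitivity (mint G2 (fun E => w E * (a L * b M * delta2 Lam E L M))) => //.
rewrite -[RHS]/(c * (a L * b M * delta Lam L M)).
have [LM|LM] := eqVneq (L + M)%VS fullv; last first.
  rewrite (delta_eq0 lL LM) !mulr0; apply: mean_const_in => E _.
  by rewrite delta2_cap// (delta_eq0 lL LM) !(mul0r, mulr0).
have dN : \dim (L :&: M) = (\dim {:V} - 2)%N.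
  have := dimv_sum_cap L M; rewrite LM; move: dL dM; rewrite /gr_dom => -> ->.
  by move: h2; lia.
rewrite [RHS]mulrC -(hw _ dN) -meanZ; last by apply: uc_mul => //; exact: uc_delta.
congr mint; apply/funext => E; rewrite delta2_cap//.
by rewrite [RHS]mulrCA; congr (_ * _); rewrite mulrA.
Qed.

(** By pair_transform_mean, a function on planes that is orthogonal to all the
    kernels delta(-, N) is orthogonal to the pair transform. *)
Lemma solve_pairs : exists h, (forall j, level Lam j m h) /\
  forall E, \dim E = 2 -> transform lL (leq_subr 2 (\dim {:V})) h E = pair_transform E.
Proof.
have [xs hxs] := gr_reps lL m 2; have [ys hys] := gr_reps lL m (\dim {:V} - 2).
apply: (@transform_solve _ _ _ _ lL _ _ h2 (leq_subr 2 _) _ _ _ hxs hys _ (pair_transform_level h2)) => w lw hw.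
by rewrite (pair_transform_mean (level_uc lL h2 lw) hw) mul0r.
Qed.

(** The averages of the function 1 against the kernels are the constant kappa. *)
Lemma pair_transform_total : exists2 c : R, 0 < c & mint G2 pair_transform =
  c * mint GM (fun L => mint GM (fun M => a L * b M * delta Lam L M)).
Proof.
have [c c0 hc] := kappa lL h2; exists c => //.
rewrite -(@pair_transform_mean (fun=> 1))//; last 2 first.
- exact: uc_const.
- by move=> N dN; rewrite -(hc N dN); congr mint; apply/funext => E; rewrite mul1r.
by congr mint; apply/funext => E; rewrite mul1r.
Qed.

End LineTransform.

(** * Locally constant functions *)

Section LocallyConstant.
Variables (R : realType) (F : nonArchLocalFieldType R) (V : vectType F).
Variables (Lam : set V) (lL : latt Lam).
Implicit Types (e E L M N : {vspace V}).
Local Notation pi_ := (unif F).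
Local Notation G := (congr_grp Lam).
Local Notation K := (GLlat Lam).

Lemma level_locally_constant m (f : {vspace V} -> R[i]) :
  (forall j, level Lam j m f) -> locally_constant f.
Proof.
move=> lf L; apply/(gr_nbhs lL); exists m => M hM.
by apply/esym; exact: (lf _ L M erefl hM).
Qed.

(** The group is closed in the compact endLam: an endomorphism congruent
    modulo pi to an element of the group lies in the group. *)
Lemma GL_compact : compact (K : set (topvec 'End(V))).
Proof.
have lE := endLam_latt lL; have sE := endLam_submod lL.
apply: (subclosed_compact _ (latt_compact lE)); last first.
  by move=> g kg x Lx; exact: GL_mem.
rewrite -openC openE => g nkg; apply/(latt_nbhs _ _ lE).
exists pi_ => [|w wE kh]; first exact: unif_neq0.
apply: nkg; set h := (_ + _) in kh.
have -> : g = ((\1%VF - pi_ *: (w \o h^-1)%VF) \o h)%VF.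
  apply/lfunP => x; rewrite comp_lfunE add_lfunE opp_lfunE scale_lfunE id_lfunE comp_lfunE.
  by rewrite lker0_lfunK ?(GL_ker kh)// add_lfunE scale_lfunE addrK.
apply: (GLM _ kh); apply: (congr_GL lL (m:=0)) => x Lx; exists (- w (h^-1%VF x)).
  apply: submodN; first exact: latt_submod lL.
  by apply: wE; exact: GL_mem (GL_inv kh) Lx.
by rewrite add_lfunE opp_lfunE scale_lfunE id_lfunE comp_lfunE expr1 scalerN.
Qed.

(** By compactness of the group, through which the Grassmannian is an orbit,
    the local levels of f have a common bound. *)
Lemma locally_constant_level k (f : {vspace V} -> R[i]) : locally_constant f ->
  exists m, level Lam k m f.
Proof.
move=> lf.
have [[E0 dE0]|n] := pselect (exists E : {vspace V}, \dim E = k); last first.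
  by exists 0%N => E E' dE; exfalso; apply: n; exists E.
have hl' g : exists lm : nat * nat, K g ->
    (forall E, lev Lam lm.2 (g @: E0)%VS E -> f E = f (g @: E0)%VS) /\
    forall h, bal lm.1 g h -> exists2 u, G lm.2 u & h = (u \o g)%VF.
  have [kg|] := pselect (K g); last by exists (0%N, 0%N).
  have /(gr_nbhs lL)[m hm] := lf (g @: E0)%VS.
  have [l hl] := GL_congr_nbhs lL m kg.
  by exists (l, m).
have [lm hlm] := choice hl'.
have := GL_compact; rewrite compact_cover => cK.
have [||D DX XD] := cK _ K (fun g => bal (lm g).1 (g : 'End(V))).
- by move=> g _; exact: bal_open.
- by move=> g kg; exists g => //; exact: bal_center.
exists (\max_(g <- finmap.enum_fset D) (lm g).2) => E E' dE EE'.
have [g kg gE] : exists2 g, K g & E = (g @: E0)%VS by apply: GL_transitive; rewrite // dE0.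
have [h hD gh] := XD g kg.
have kh : K h by have := DX h hD; rewrite inE.
have [h1 h2] := hlm h kh.
have [u uG gu] := h2 g gh.
have hE : lev Lam (lm h).2 (h @: E0)%VS E by exists u; rewrite // gE gu limg_comp.
rewrite (h1 E hE) (h1 E')//; apply: (lev_trans lL hE); apply: (lev_le lL _ EE').
exact: (@leq_bigmax_seq _ _ xpredT (fun g => (lm g).2) h hD isT).
Qed.

End LocallyConstant.

(** * Bilinear averages *)

Section Bilinear.
Variables (R : realType) (F : nonArchLocalFieldType R) (V : vectType F).
Variables (Lam : set V) (lL : latt Lam).
Implicit Types (e E L M N : {vspace V}).
Variables (k l : nat) (hk : (k <= \dim {:V})%N) (hl : (l <= \dim {:V})%N).
Local Notation GK := (gr_mean lL hk).
Local Notation GL := (gr_mean lL hl).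

Definition bil (a b : {vspace V} -> R) E : R :=
  mint GK (fun L => mint GL (fun M => a L * b M * delta2 Lam E L M)).

Lemma uc_bil a b E : uc (M:=GK) a -> uc (M:=GL) b ->
  uc (M:=mean_prod GK GL) (fun z => a z.1 * b z.2 * delta2 Lam E z.1 z.2).
Proof.
move=> ua ub; apply: uc_mul; first exact: (uc_mul (uc_fst GL ua) (uc_snd GK ub)).
move=> e /inv_small[m hm]; exists m => -[L M] [L' M'] _ [/= hL hM].
by apply: le_trans hm; apply: delta2_lev => //; exact: lev_refl.
Qed.

Lemma bil_inner a b E L : uc (M:=GL) b ->
  mint GL (fun M => a L * b M * delta2 Lam E L M) =
  a L * delta Lam E L * transform lL hl b (E :&: L)%VS.
Proof.
move=> ub; rewrite -meanZ; last by apply: uc_mul => //; exact: uc_delta_r.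
by congr mint; apply/funext => M; rewrite delta2E// mulrACA.
Qed.

Lemma dim_cap_delta E L : delta Lam E L != 0 -> \dim L = k ->
  \dim (E :&: L) = (\dim E + k - \dim {:V})%N.
Proof.
move=> d dL; have [h|h] := eqVneq (E + L)%VS fullv; last by rewrite delta_eq0 ?eqxx in d.
by have := dimv_sum_cap E L; rewrite h dL; lia.
Qed.

(** The inner integral involves b only through its transform. This is why a
    product does not depend on the choice of the hats. *)
Lemma bil_congr a b b' E : uc (M:=GK) a -> uc (M:=GL) b -> uc (M:=GL) b' ->
  (forall E', \dim E' = (\dim E + k - \dim {:V})%N ->
     transform lL hl b E' = transform lL hl b' E') ->
  bil a b E = bil a b' E.
Proof.
move=> ua ub ub' h; apply: mean_ext => [|L dL]; first exact: (uc_slice_int (uc_bil E ua ub)).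
rewrite !bil_inner//; have [->|d] := eqVneq (delta Lam E L) 0; first by rewrite mulr0 !mul0r.
by rewrite h//; exact: dim_cap_delta.
Qed.

Lemma bil_const a b E t : uc (M:=GK) a -> uc (M:=GL) b ->
  (forall E', \dim E' = (\dim E + k - \dim {:V})%N -> transform lL hl b E' = t) ->
  bil a b E = t * transform lL hk a E.
Proof.
move=> ua ub h; have u : uc (M:=GK) (fun L => a L * delta Lam E L).
  by apply: uc_mul => //; exact: uc_delta_r.
rewrite -[RHS](@meanZ _ GK t _ u); apply: mean_ext => [|L dL].
  exact: (uc_slice_int (uc_bil E ua ub)).
rewrite bil_inner//; have [->|d] := eqVneq (delta Lam E L) 0; first by rewrite !(mulr0, mul0r).
by have e := h _ (dim_cap_delta d dL); rewrite e mulrC.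
Qed.

End Bilinear.

(** * Sections in terms of real transforms *)

Section Sections.
Variables (R : realType) (F : nonArchLocalFieldType R) (V : vectType F).
Variables (Lam : set V) (lL : latt Lam).
Implicit Types (e E L M N : {vspace V}) (f g : {vspace V} -> R[i]) (phi psi : section V).
Local Notation n := (\dim {:V}).

Lemma complexM (a b c d : R) : (a +i* b) * (c +i* d) = (a * c - b * d) +i* (a * d + b * c).
Proof. by simpc. Qed.

Lemma Re_mulC (z : R[i]) (c : R) : complex.Re (z * c%:C) = complex.Re z * c.
Proof. by case: z => a b /=; rewrite mulr0 subr0. Qed.

Lemma Im_mulC (z : R[i]) (c : R) : complex.Im (z * c%:C) = complex.Im z * c.
Proof. by case: z => a b /=; rewrite mulr0 add0r. Qed.

Definition re f L : R := complex.Re (f L).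
Definition im f L : R := complex.Im (f L).

Lemma level_re k m f : level Lam k m f -> level Lam k m (re f).
Proof. by move=> h E E' dE hE; rewrite /re (h E E'). Qed.

Lemma level_im k m f : level Lam k m f -> level Lam k m (im f).
Proof. by move=> h E E' dE hE; rewrite /im (h E E'). Qed.

Lemma uc_re k (hk : (k <= n)%N) f : locally_constant f -> uc (M:=gr_mean lL hk) (re f).
Proof.
by move=> /(locally_constant_level lL k)[m h]; exact: (level_uc lL hk (level_re h)).
Qed.

Lemma uc_im k (hk : (k <= n)%N) f : locally_constant f -> uc (M:=gr_mean lL hk) (im f).
Proof.
by move=> /(locally_constant_level lL k)[m h]; exact: (level_uc lL hk (level_im h)).
Qed.

Lemma gr_intE k (f g : {vspace V} -> R[i]) : (forall L, \dim L = k -> f L = g L) ->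
  gr_int Lam k f = gr_int_real Lam k (re g) +i* gr_int_real Lam k (im g).
Proof.
by move=> h; rewrite /gr_int /gr_int_real /re /im; congr (_ +i* _);
  apply: eq_Rintegral => L; rewrite inE => /h ->.
Qed.

Lemma gr_int_transform i l (hl : (l <= n)%N) f E A : (i <= n)%N -> l = (n - i)%N ->
  \dim E = i -> locally_constant f ->
  gr_int Lam l (fun L => f L *
    pullback (fun v : subvs_of E => quot_proj L (vsval v)) (@muL _ _ _ Lam L) A) =
  (transform lL hl (re f) E +i* transform lL hl (im f) E) * (vol (elat Lam E) A)%:C.
Proof.
move=> hi li dE lf.
rewrite (@gr_intE l _ (fun L => f L * (delta Lam E L * vol (elat Lam E) A)%:C)); last first.
  by move=> L dL; rewrite pullback_delta// dE dL; lia.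
rewrite complexM mulr0 mulr0 subr0 add0r; congr (_ +i* _).
  rewrite -[LHS]/(mint (gr_mean lL hl) _) mulrC /transform -meanZ; last first.
    by apply: uc_mul; [exact: uc_re|exact: uc_delta_r].
  by congr mint; apply/funext => L; rewrite /re Re_mulC; ring.
rewrite -[LHS]/(mint (gr_mean lL hl) _) mulrC /transform -meanZ; last first.
  by apply: uc_mul; [exact: uc_im|exact: uc_delta_r].
by congr mint; apply/funext => L; rewrite /im Im_mulC; ring.
Qed.

(** In units of the lattice a section is the transform of its hat. *)
Lemma val_repE i l (hl : (l <= n)%N) phi f : (i <= n)%N -> l = (n - i)%N ->
  locally_constant f -> val_rep Lam i phi f <-> forall E A, phi E A =
    if \dim E == i then
      (transform lL hl (re f) E +i* transform lL hl (im f) E) * (vol (elat Lam E) A)%:C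
    else 0.
Proof.
move=> hi li lf; rewrite /val_rep -li; split=> [[_ h] E A|h].
  by rewrite h; case: eqP => // dE; rewrite (gr_int_transform hl A hi li dE lf).
by split=> // E A; rewrite h; case: eqP => // dE; rewrite (gr_int_transform hl A hi li dE lf).
Qed.

Lemma hatP i phi f : val_rep Lam i phi f -> val_rep Lam i phi (hat Lam i phi).
Proof. by move=> h; exact: (@xgetPex _ (fun=> 0) (val_rep Lam i phi) (ex_intro _ f h)). Qed.

Lemma smulE i j k l (hk : (k <= n)%N) (hl : (l <= n)%N) phi psi E (A : set (subvs_of E)) :
  (i <= n)%N -> (j <= n)%N -> k = (n - i)%N -> l = (n - j)%N ->
  let f := hat Lam i phi in let g := hat Lam j psi in
  locally_constant f -> locally_constant g ->
  (smul Lam i j phi psi : section V) E A = if \dim E == (i + j)%N then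
    ((bil lL hk hl (re f) (re g) E - bil lL hk hl (im f) (im g) E) +i*
     (bil lL hk hl (re f) (im g) E + bil lL hk hl (im f) (re g) E)) *
    (vol (elat Lam E) A)%:C else 0.
Proof.
move=> hi hj ki lj f g lf lg; rewrite /smul -/f -/g -ki -lj; case: eqP => // dE.
set v := vol (elat Lam E) A.
pose GK := gr_mean lL hk; pose GL := gr_mean lL hl; pose PP := mean_prod GK GL.
pose D z : R := delta2 Lam E z.1 z.2.
have ub (a b : {vspace V} -> R) : uc (M:=GK) a -> uc (M:=GL) b ->
    uc (M:=PP) (fun z => a z.1 * b z.2 * delta2 Lam E z.1 z.2) by exact: uc_bil.
have comb (a b c d : {vspace V} -> R) s : uc (M:=GK) a -> uc (M:=GL) b ->
    uc (M:=GK) c -> uc (M:=GL) d ->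
    mint PP (fun z => (a z.1 * b z.2 + s * (c z.1 * d z.2)) * (delta2 Lam E z.1 z.2 * v)) =
    (bil lL hk hl a b E + s * bil lL hk hl c d E) * v.
  move=> ua ub' uc_ ud.
  transitivity (mint PP (fun z => v * (a z.1 * b z.2 * delta2 Lam E z.1 z.2) +
      (v * s) * (c z.1 * d z.2 * delta2 Lam E z.1 z.2))).
    by congr mint; apply/funext => z; ring.
  rewrite mean_lin; [|exact: ub|]; last first.
    apply: uc_ext (uc_lin (v * s) (ub _ _ uc_ ud) (uc_const PP 0)) _ => z _.
    by rewrite addr0.
  rewrite meanZ; last exact: ub.
  have e (X Y : R) : v * X + v * s * Y = (X + s * Y) * v by ring.
  exact: e.
rewrite (@gr_intE k _ (fun L =>
   gr_int_real Lam l (re (fun M => f L * g M * (delta2 Lam E L M * v)%:C)) +i*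
   gr_int_real Lam l (im (fun M => f L * g M * (delta2 Lam E L M * v)%:C)))); last first.
  move=> L dL; apply: gr_intE => M dM; rewrite pullback_delta2// dE dL dM; lia.
have [uf1 uf2] := (uc_re hk lf, uc_im hk lf); have [ug1 ug2] := (uc_re hl lg, uc_im hl lg).
rewrite complexM mulr0 mulr0 subr0 add0r; congr (_ +i* _).
  have := comb (re f) (re g) (im f) (im g) (-1) uf1 ug1 uf2 ug2; rewrite mulN1r => <-.
  rewrite -[LHS]/(mint PP (fun z => complex.Re (f z.1 * g z.2 * (delta2 Lam E z.1 z.2 * v)%:C))).
  congr mint; apply/funext => z; rewrite Re_mulC /re /im mulN1r.
  by case: (f z.1) (g z.2) => a b [c d].
have := comb (re f) (im g) (im f) (re g) 1 uf1 ug2 uf2 ug1; rewrite mul1r => <-.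
rewrite -[LHS]/(mint PP (fun z => complex.Im (f z.1 * g z.2 * (delta2 Lam E z.1 z.2 * v)%:C))).
congr mint; apply/funext => z; rewrite Im_mulC /re /im mul1r.
by case: (f z.1) (g z.2) => a b [c d].
Qed.

Lemma lat_sectionE k E (A : set (subvs_of E)) : (lat_section Lam k : section V) E A =
  if \dim E == k then (vol (elat Lam E) A)%:C else 0.
Proof. by rewrite /lat_section; case: eqP => // _; rewrite haar1E//; exact: elat_latt. Qed.

(** By kappa a constant function has a constant transform. *)
Lemma lat_section_rep k c : (k <= n)%N ->
  exists f, val_rep Lam k (sscale c%:C (lat_section Lam k)) f.
Proof.
move=> hk; have hl := leq_subr k n; have [t t0 ht] := kappa lL hl.
exists (fun=> (c / t)%:C).
have lc : locally_constant (fun _ : {vspace V} => (c / t)%:C).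
  by apply: (@level_locally_constant _ _ _ _ lL 0).
apply: (val_repE hl _ hk erefl lc).2 => E A; rewrite /sscale lat_sectionE.
case: eqP => dE; last by rewrite mulr0.
have ud := uc_delta_r lL hl E.
have h : mint (gr_mean lL hl) (fun L => delta Lam E L) = t.
  have e := ht E (etrans dE (esym (subKn hk))); rewrite -e.
  by congr mint; apply/funext => L; exact: delta_sym.
have h1 := @meanZ _ (gr_mean lL hl) (c / t) _ ud; rewrite h divfK ?gt_eqF// in h1.
have h2 := @meanZ _ (gr_mean lL hl) 0 _ ud; rewrite mul0r in h2.
by congr (_ * _); transitivity (c +i* 0) => //; congr (_ +i* _); apply/esym; [exact: h1|exact: h2].
Qed.

(** * Powers of the invariant section *)

Hypothesis n2 : (1 < n)%N.
Local Notation hn1 := (leq_pred n).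

Lemma pred_sub : n.-1 = (n - 1)%N. Proof. by rewrite subn1. Qed.

(** Multiplying by the invariant section of degree 1 integrates against a
    function whose transform is 1 on all lines, and the average of that
    function against the kernel of any subspace of dimension k + 1 is a
    positive constant. *)
Lemma lat_powE k : (k <= n)%N -> exists2 c : R, 0 < c &
  lat_pow Lam k = sscale c%:C (lat_section Lam k).
Proof.
elim: k => [|k ih] hk.
  exists 1 => //; apply: functional_extensionality_dep => E; apply/funext => A.
  by rewrite /sscale mul1r.
have [c c0 powE] := ih (ltnW hk).
have [f0 hf0] := @lat_section_rep 1 1 (ltnW n2).
have one : sscale 1%:C (lat_section Lam 1) = lat_section Lam 1.
  by apply: functional_extensionality_dep => E; apply/funext => A; rewrite /sscale mul1r.
rewrite one in hf0; have hf := hatP hf0.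
have [g0 hg0] := lat_section_rep c (ltnW hk); rewrite -powE in hg0; have hg := hatP hg0.
set f := hat Lam 1 _ in hf; set g := hat Lam k _ in hg.
have lf := hf.1; have lg := hg.1.
have Tf e : \dim e = 1%N -> transform lL hn1 (re f) e = 1 /\ transform lL hn1 (im f) e = 0.
  move=> de; have := (val_repE hn1 _ (ltnW n2) pred_sub lf).1 hf e (elat Lam e).
  rewrite lat_sectionE de eqxx vol_self; last exact: elat_latt.
  by rewrite mulr1 => -[<- <-].
have hl := leq_subr k n.
have Tg E : \dim E = k -> transform lL hl (re g) E = c /\ transform lL hl (im g) E = 0.
  move=> dE; have := (val_repE hl _ (ltnW hk) erefl lg).1 hg E (elat Lam E).
  rewrite powE /sscale lat_sectionE dE eqxx vol_self; last exact: elat_latt.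
  by rewrite !mulr1 => -[<- <-].
have [t t0 ht] := line_mass lL (ltn0Sn k).
exists (c * t); first by rewrite mulr_gt0.
apply: functional_extensionality_dep => E; apply/funext => A.
have [uf1 uf2] := (uc_re hn1 lf, uc_im hn1 lf); have [ug1 ug2] := (uc_re hl lg, uc_im hl lg).
rewrite [LHS](@smulE 1 k _ _ hn1 hl _ _ E A (ltnW n2) (ltnW hk) pred_sub erefl lf lg).
rewrite /sscale lat_sectionE add1n; case: eqP => dE; last by rewrite mulr0.
have dE' E' : \dim E' = (\dim E + n.-1 - n)%N -> \dim E' = k by rewrite dE => ->; lia.
have e1 := bil_const uf1 ug1 (fun E' h => (Tg E' (dE' E' h)).1).
have e2 := bil_const uf2 ug2 (fun E' h => (Tg E' (dE' E' h)).2).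
have e3 := bil_const uf1 ug2 (fun E' h => (Tg E' (dE' E' h)).2).
have e4 := bil_const uf2 ug1 (fun E' h => (Tg E' (dE' E' h)).1).
have m1 := ht _ 1 uf1 (fun e de => (Tf e de).1) E dE.
have m2 := ht _ 0 uf2 (fun e de => (Tf e de).2) E dE.
rewrite e1 e2 e3 e4 /transform m1 m2 !mulr0 !mul0r mulr1 subr0 addr0.
by [].
Qed.

(** * Smooth sections of degree 1 *)

Lemma haar_space_elat E (mu : set (subvs_of E) -> R[i]) A : haar_space mu ->
  mu A = mu (elat Lam E) * (vol (elat Lam E) A)%:C.
Proof.
move=> /haar_spaceE[c h]; rewrite !h -mulrA -rmorphM /= /vol mulrCA mulfV ?mulr1//.
by rewrite gt_eqF// vol0_latt//; exact: elat_latt.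
Qed.

Lemma sact_elat phi (g : 'End(V)) E : GLlat Lam g ->
  (sact g phi : section V) E (elat Lam E) = phi (g^-1 @: E)%VS (elat Lam (g^-1 @: E)%VS).
Proof.
move=> kg; have ig := GL_ker kg; have kv := GL_inv kg.
have gE w : w \in (g^-1 @: E)%VS -> g w \in E.
  by move=> h; rewrite -(limgVK E ig) memv_img.
rewrite /sact /pullback asboolT.
  congr (phi _ _); apply/seteqP; split=> [_ [v Lv <-]|u Lu].
    by rewrite /elat /= vsprojK ?memv_img ?subvsP//; exact: GL_mem.
  have gu := gE _ (subvsP u).
  exists (vsproj E (g (vsval u))).
    by rewrite /elat /= vsprojK//; exact: GL_mem.
  by rewrite [vsval (vsproj E _)]vsprojK// lker0_lfunK// vsvalK.
exists (fun u => vsproj E (g (vsval u))) => v.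
  by rewrite [vsval (vsproj (g^-1 @: E)%VS _)]vsprojK ?memv_img ?subvsP// lker0_lfunVK// vsvalK.
have gu := gE _ (subvsP v).
by rewrite [vsval (vsproj E _)]vsprojK// lker0_lfunK// vsvalK.
Qed.

(** An open subgroup contains a congruence subgroup, and the latter preserves
    the lattices of the subspaces. *)
Lemma smooth_level i phi : smooth_section i phi ->
  exists m, forall k, level Lam k m (fun E => phi E (elat Lam E)).
Proof.
move=> [_ _ [H [[oH _ H1 _ _] Hphi]]].
have /(nbhs_congr_grp lL)[m hm] : nbhs (\1%VF : topvec 'End(V)) H by exact: open_nbhs_nbhs.
exists m => k E _ _ [g gG ->]; have kg := congr_GL lL gG.
have := sact_elat phi (g @: E)%VS kg; rewrite Hphi; last exact: hm.
by rewrite limgK ?(GL_ker kg).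
Qed.

(** The transform from hyperplanes to lines is onto. *)
Lemma smooth_rep phi : smooth_section 1 phi -> exists f, val_rep Lam 1 phi f.
Proof.
move=> sphi; have [m lv] := smooth_level sphi; have [hphi phi0 _] := sphi.
set s := (fun E => _) in lv.
have [a [la ha]] := solve_lines lL n2 (level_re (lv 1%N)).
have [b [lb hb]] := solve_lines lL n2 (level_im (lv 1%N)).
exists (fun L => a L +i* b L).
have lc : locally_constant (fun L => a L +i* b L).
  apply: (level_locally_constant lL (m:=m)) => j E E' dE hE.
  by rewrite (la j E E')// (lb j E E').
apply: (val_repE hn1 _ (ltnW n2) pred_sub lc).2 => E A; case: eqP => dE; last exact: phi0.
rewrite (haar_space_elat A (hphi E)); congr (_ * _).
have e1 : transform lL hn1 (re (fun L => a L +i* b L)) E = re s E := ha E dE.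
have e2 : transform lL hn1 (im (fun L => a L +i* b L)) E = im s E := hb E dE.
by rewrite e1 e2 /re /im /s; case: (phi E (elat Lam E)).
Qed.

End Sections.

(** * The quadratic form *)

Section QuadraticForm.
Variables (R : realType) (F : nonArchLocalFieldType R) (V : vectType F).
Variables (Lam : set V) (lL : latt Lam).
Implicit Types (e E L M N : {vspace V}) (f g : {vspace V} -> R[i]) (phi psi : section V).
Local Notation n := (\dim {:V}).
Hypothesis n2 : (1 < n)%N.
Local Notation hn1 := (leq_pred n).
Local Notation GM := (gr_mean lL hn1).
Local Notation hn2 := (leq_subr 2 n).
Local Notation G2 := (gr_mean lL (n2 : (2 <= n)%N)).

Lemma mean_split (M : mean R) (T P Q : mpt M -> R) : uc (M:=M) P -> uc (M:=M) Q ->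
  (forall x, mdom x -> T x = P x + Q x) -> mint M T = mint M P + mint M Q.
Proof.
move=> uP uQ h; rewrite -meanD//; apply/esym; apply: mean_ext => [|x dx]; last by rewrite h.
by apply: uc_ext (uc_lin 1 uP uQ) _ => x _; rewrite mul1r.
Qed.

Lemma neg_sum (c d x y : R) : 0 < c -> 0 < d -> x <= 0 -> y <= 0 -> x < 0 \/ y < 0 ->
  c * x + d * y < 0.
Proof. by move=> c0 d0 x0 y0 [|] h; nra. Qed.

Lemma transform_full k (hk : (k <= n)%N) a E : \dim E = n ->
  transform lL hk a E = mint (gr_mean lL hk) a.
Proof.
move=> dE; have -> : E = fullv.
  by apply/eqP; rewrite eqEdim subvf dE leqnn.
by congr mint; apply/funext => L; rewrite delta_full// mulr1.
Qed.

Lemma lat_pow_hat k : (k <= n)%N -> let g := hat Lam k (lat_pow Lam k) in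
  exists2 c : R, 0 < c & locally_constant g /\ forall E, \dim E = k ->
    transform lL (leq_subr k n) (re g) E = c /\ transform lL (leq_subr k n) (im g) E = 0.
Proof.
move=> hk g; have [c c0 powE] := lat_powE lL n2 hk; exists c => //.
have [g0 hg0] := lat_section_rep lL c hk; rewrite -powE in hg0; have hg := hatP hg0.
split=> [|E dE]; first exact: hg.1.
have := (val_repE lL (leq_subr k n) _ hk erefl hg.1).1 hg E (elat Lam E).
rewrite {1}powE /sscale lat_sectionE// dE eqxx vol_self; last exact: elat_latt.
by rewrite !mulr1 => -[<- <-].
Qed.

Lemma uc_transform k l (hk : (k <= n)%N) (hl : (l <= n)%N) a : uc (M:=gr_mean lL hl) a ->
  uc (M:=mean_prod (gr_mean lL hk) (gr_mean lL hl)) (fun z => a z.2 * delta Lam z.1 z.2).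
Proof.
by move=> ua; apply: uc_mul; [exact: (uc_snd _ ua)|exact: uc_delta_pair].
Qed.

(** Exchange the integrals; the inner one is then the constant kappa. *)
Lemma transform_total k (hk : (k <= n)%N) : exists2 c : R, 0 < c &
  forall a, uc (M:=gr_mean lL (leq_subr k n)) a ->
    mint (gr_mean lL hk) (transform lL (leq_subr k n) a) = c * mint (gr_mean lL (leq_subr k n)) a.
Proof.
have [c c0 hc] := kappa lL hk; exists c => // a ua.
have u := uc_transform hk ua.
rewrite (mean_fubini u) -[RHS](meanZ c ua).
apply: mean_ext => [|N dN]; first exact: (uc_slice_int (uc_swap u)).
rewrite -(hc N dN) mulrC -meanZ//; exact: uc_delta.
Qed.

Lemma bil_sym a b E : uc (M:=GM) a -> uc (M:=GM) b ->
  bil lL hn1 hn1 a b E = bil lL hn1 hn1 b a E.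
Proof.
move=> ua ub; rewrite /bil (mean_fubini (uc_bil E ua ub)).
apply: (congr1 (mint GM)); apply/funext => M; apply: (congr1 (mint GM)); apply/funext => L.
by rewrite /= (delta2_sym Lam E L M) [a L * b M]mulrC.
Qed.

Lemma bilZ a b s E : uc (M:=GM) a -> uc (M:=GM) b ->
  bil lL hn1 hn1 a (fun L => s * b L) E = s * bil lL hn1 hn1 a b E.
Proof.
move=> ua ub; rewrite -[RHS](meanZ s (uc_bil E ua ub)).
rewrite -[LHS]/(mint (mean_prod GM GM) (fun z => a z.1 * (s * b z.2) * delta2 Lam E z.1 z.2)).
by congr mint; apply/funext => z; rewrite !mulrA [a _ * s]mulrC.
Qed.

Lemma degree1_transform phi f : val_rep Lam 1 phi f -> forall e, \dim e = 1%N ->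
  phi e (elat Lam e) = transform lL hn1 (re f) e +i* transform lL hn1 (im f) e.
Proof.
move=> hf e de; rewrite ((val_repE lL hn1 _ (ltnW n2) (pred_sub V) hf.1).1 hf) de eqxx.
by rewrite vol_self ?mulr1//; exact: elat_latt.
Qed.

Lemma conj_rep phi f : val_rep Lam 1 phi f ->
  val_rep Lam 1 (sconj phi) (fun L => (f L)^*).
Proof.
move=> hf; have lf := hf.1.
have lc : locally_constant (fun L => (f L)^*).
  by move=> L; near=> M; congr (_^*); near: M; exact: lf.
apply: (val_repE lL hn1 _ (ltnW n2) (pred_sub V) lc).2 => E A.
rewrite /sconj ((val_repE lL hn1 _ (ltnW n2) (pred_sub V) lf).1 hf).
case: eqP => dE; last by rewrite conjc0.
have e1 : transform lL hn1 (re (fun L => (f L)^*)) E = transform lL hn1 (re f) E.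
  by congr mint; apply/funext => L; rewrite /re; case: (f L).
have e2 : transform lL hn1 (im (fun L => (f L)^*)) E = - transform lL hn1 (im f) E.
  rewrite -mulN1r /transform -meanZ; last by apply: uc_mul; [exact: uc_im|exact: uc_delta_r].
  by congr mint; apply/funext => L; rewrite /im mulN1r -mulNr; case: (f L).
by rewrite e1 e2 complexM rmorphM /=; simpc.
Unshelve. all: by end_near.
Qed.

Section OneSection.
Variables (phi : section V) (f : {vspace V} -> R[i]) (m : nat).
Hypothesis hf : val_rep Lam 1 phi f.
Hypothesis fhat : f = hat Lam 1 phi.
Hypothesis lm : level Lam n.-1 m f.
Let a := re f.
Let b := im f.
Let la : level Lam n.-1 m a := level_re lm.
Let lb : level Lam n.-1 m b := level_im lm.
Let ua : uc (M:=GM) a := level_uc lL hn1 la.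
Let ub : uc (M:=GM) b := level_uc lL hn1 lb.
Let psi := smul Lam 1 1 phi (sconj phi).

(** The hat of the conjugate section has the same transform as the conjugate
    of f, and with the latter the mixed terms in a and b cancel. *)
Lemma square_modulus E (A : set (subvs_of E)) : (psi : section V) E A =
  if \dim E == 2 then
    (bil lL hn1 hn1 a a E + bil lL hn1 hn1 b b E)%:C * (vol (elat Lam E) A)%:C else 0.
Proof.
have hg := hatP (conj_rep hf); set g := hat Lam 1 _ in hg.
have hf' : val_rep Lam 1 phi (hat Lam 1 phi) by exact: hatP hf.
rewrite [LHS](@smulE _ _ _ _ lL 1 1 _ _ hn1 hn1 _ _ E A (ltnW n2) (ltnW n2) (pred_sub V) (pred_sub V) hf'.1 hg.1).
rewrite -fhat -/a -/b -/g addn1; case: eqP => // dE; congr (_ * _).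
have [ug1 ug2] := (uc_re lL hn1 hg.1, uc_im lL hn1 hg.1).
have Tg e : \dim e = 1%N -> transform lL hn1 (re g) e = transform lL hn1 a e /\
    transform lL hn1 (im g) e = transform lL hn1 (fun L => (-1) * b L) e.
  move=> de; have := degree1_transform hg de.
  rewrite /sconj (degree1_transform hf de) /= => -[<- <-]; split=> //.
  rewrite -mulN1r /transform -meanZ; last by apply: uc_mul => //; exact: uc_delta_r.
  by congr mint; apply/funext => L; rewrite mulrA.
have dE' E' : \dim E' = (\dim E + n.-1 - n)%N -> \dim E' = 1%N by rewrite dE => ->; lia.
have ub' : uc (M:=GM) (fun L => (-1) * b L).
  by apply: uc_ext (uc_lin (-1) ub (uc_const GM 0)) _ => L _; rewrite addr0.
have c1 x : uc (M:=GM) x -> bil lL hn1 hn1 x (re g) E = bil lL hn1 hn1 x a E.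
  by move=> ux; apply: bil_congr => // E' h; exact: (Tg E' (dE' E' h)).1.
have c2 x : uc (M:=GM) x -> bil lL hn1 hn1 x (im g) E = - bil lL hn1 hn1 x b E.
  move=> ux; rewrite (@bil_congr _ _ _ _ lL _ _ hn1 hn1 x (im g) (fun L => (-1) * b L))//.
    by rewrite bilZ// mulN1r.
  by move=> E' h; exact: (Tg E' (dE' E' h)).2.
rewrite !c1// !c2// opprK (bil_sym E ua ub) addNr.
by [].
Qed.

Lemma square_modulus_rep : exists h, val_rep Lam 2 psi h.
Proof.
have [h1 [lh1 hh1]] := solve_pairs lL n2 la la.
have [h2 [lh2 hh2]] := solve_pairs lL n2 lb lb.
exists (fun N => (h1 N + h2 N)%:C).
have lc : locally_constant (fun N => (h1 N + h2 N)%:C).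
  apply: (level_locally_constant lL (m:=m)) => j E E' dE hE.
  by rewrite (lh1 j E E')// (lh2 j E E').
apply: (val_repE lL hn2 _ n2 erefl lc).2 => E A; rewrite square_modulus.
case: eqP => // dE; congr (_ * _).
have u1 : uc (M:=gr_mean lL hn2) (fun N => h1 N * delta Lam E N).
  by apply: uc_mul; [exact: (level_uc lL hn2 (lh1 _))|exact: uc_delta_r].
have u2 : uc (M:=gr_mean lL hn2) (fun N => h2 N * delta Lam E N).
  by apply: uc_mul; [exact: (level_uc lL hn2 (lh2 _))|exact: uc_delta_r].
rewrite -[X in (X + _)%:C](hh1 E dE) -[X in (_ + X)%:C](hh2 E dE) /transform -meanD//.
congr (_ +i* _).
  by congr mint; apply/funext => N; rewrite /re /= mulrDl.
by apply/esym; apply: mean_const_in => N _; rewrite /im /= mul0r.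
Qed.

Hypothesis a0 : mint GM a = 0.
Hypothesis b0 : mint GM b = 0.

Lemma pair_mean_le0 x : level Lam n.-1 m x -> mint GM x = 0 ->
  mint GM (fun L => mint GM (fun M => x L * x M * delta Lam L M)) <= 0.
Proof.
move=> lx x0; have [[L [dL xL]]|h] := pselect (exists L, \dim L = n.-1 /\ x L != 0).
  exact: ltW (hyper_negative n2 lx x0 dL xL).
rewrite (@mean_const_in _ GM 0)// => L dL; apply: mean_const_in => M _.
have [->|xL] := eqVneq (x L) 0; first by rewrite !mul0r.
by exfalso; apply: h; exists L.
Qed.

(** The integral of h is, up to a positive factor, the integral of its
    transform over all planes. This transform is the pair transform of a plus
    that of b, so the integral is a positive combination of the two quadratic
    forms with kernel delta. *)
Lemma square_modulus_negative L0 : \dim L0 = n.-1 -> f L0 != 0 ->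
  let h := hat Lam 2 psi in
  mint (gr_mean lL hn2) (re h) < 0 /\ mint (gr_mean lL hn2) (im h) = 0.
Proof.
move=> dL0 fL0 h; have [h0 hh0] := square_modulus_rep; have hh : val_rep Lam 2 psi h := hatP hh0.
have [uh1 uh2] := (uc_re lL hn2 hh.1, uc_im lL hn2 hh.1).
have Th E : \dim E = 2 -> transform lL hn2 (re h) E =
    pair_transform lL a a E + pair_transform lL b b E /\ transform lL hn2 (im h) E = 0.
  move=> dE; have := (val_repE lL hn2 _ n2 erefl hh.1).1 hh E (elat Lam E).
  rewrite square_modulus dE eqxx vol_self; last exact: elat_latt.
  by rewrite !mulr1 => -[<- <-].
have [c c0 hc] := transform_total n2.
split; apply/eqP; last first.
  rewrite -(mulrI_eq0 _ (mulfI (lt0r_neq0 c0))) -hc//; apply/eqP.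
  by apply: mean_const_in => E dE; exact: (Th E dE).2.
rewrite eqb_id -(pmulr_rlt0 _ c0) -hc//.
have [c1 c10 hc1] := pair_transform_total lL n2 la la.
have [c2 c20 hc2] := pair_transform_total lL n2 lb lb.
have up x : level Lam n.-1 m x -> uc (M:=G2) (pair_transform lL x x).
  by move=> lx; exact: (level_uc lL _ (pair_transform_level lL lx lx n2)).
have split := @mean_split G2 (transform lL hn2 (re h)) _ _ (up a la) (up b lb) (fun E dE => (Th E dE).1).
rewrite (etrans split (congr2 +%R hc1 hc2)).
have na := pair_mean_le0 la a0; have nb := pair_mean_le0 lb b0.
have [fa|fa] := eqVneq (a L0) 0.
  have fb : b L0 != 0.
    apply: contra fL0 => /eqP fb; apply/eqP.
    by move: fa fb; rewrite /a /b /re /im; case: (f L0) => x y /= -> ->.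
  by apply: neg_sum => //; right; exact: (hyper_negative n2 lb b0 dL0 fb).
by apply: neg_sum => //; left; exact: (hyper_negative n2 la a0 dL0 fa).
Qed.

End OneSection.

End QuadraticForm.

Theorem theorem1p5 (R : realType) (F : nonArchLocalFieldType R)
    (V : vectType F) (n : nat) (hV : \dim {:V} = n) (hn : (2 <= n)%N)
    (Lam : set V) (hLam : is_lattice Lam)
    (phi : section V) (hphi : P1 Lam phi) (phi0 : phi <> szero V) :
  exists2 c : R, 0 < c &
    Q Lam phi = sscale c%:C (lat_section Lam n).
Proof.
subst n; have lL := is_lattice_latt hLam; have n2 := hn.
have [[S [_ Ssm Sphi]] prim] := hphi.
have [f0 hf0] := smooth_rep lL n2 (Ssm _ Sphi).
have hf := hatP hf0; set f := hat Lam 1 phi in hf.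
have [m lm] := locally_constant_level lL (\dim {:V}).-1 hf.1.
have [uf1 uf2] := (uc_re lL (leq_pred _) hf.1, uc_im lL (leq_pred _) hf.1).
(* A section whose hat vanishes on all hyperplanes is 0. *)
have [L0 [dL0 fL0]] : exists L0, \dim L0 = (\dim {:V}).-1 /\ f L0 != 0.
  apply: contrapT => h; apply: phi0.
  have fz L : \dim L = (\dim {:V}).-1 -> f L = 0.
    by move=> dL; apply/eqP/negPn/negP => fL; apply: h; exists L.
  apply: functional_extensionality_dep => E; apply/funext => A.
  rewrite ((val_repE lL (leq_pred _) _ (ltnW n2) (pred_sub V) hf.1).1 hf).
  case: eqP => // _; rewrite /transform.
  rewrite (@mean_const_in _ (gr_mean lL (leq_pred _)) 0) => [|L /fz fL]; last by rewrite /re fL mul0r.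
  rewrite (@mean_const_in _ (gr_mean lL (leq_pred _)) 0) => [|L /fz fL]; last by rewrite /im fL mul0r.
  by rewrite mul0r.
have [c1 c10 [lg1 Tg1]] := lat_pow_hat lL n2 (leq_pred (\dim {:V})).
(* At E = V the product in the definition of P_1 is a positive multiple of
   the integral of f. *)
have prim0 : mint (gr_mean lL (leq_pred _)) (re f) = 0 /\ mint (gr_mean lL (leq_pred _)) (im f) = 0.
  have := congr1 (fun p : section V => p fullv (elat Lam fullv)) prim.
  rewrite /= [LHS](@smulE _ _ _ _ lL 1 (\dim {:V}).-1 _ _ (leq_pred _) (leq_subr _ _) _ _ fullv _
    (ltnW n2) (leq_pred _) (pred_sub V) erefl hf.1 lg1).
  rewrite add1n prednK ?(ltnW n2)// eqxx vol_self; last exact: elat_latt.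
  set g := hat _ _ _ in lg1 Tg1 *.
  have dE' (E' : {vspace V}) : \dim E' = (\dim {:V} + (\dim {:V}).-1 - \dim {:V})%N ->
      \dim E' = (\dim {:V}).-1 by move=> ->; lia.
  have [ug1 ug2] := (uc_re lL (leq_subr (\dim {:V}).-1 _) lg1, uc_im lL (leq_subr (\dim {:V}).-1 _) lg1).
  rewrite (bil_const uf1 ug1 (fun E' h => (Tg1 E' (dE' E' h)).1)).
  rewrite (bil_const uf2 ug2 (fun E' h => (Tg1 E' (dE' E' h)).2)).
  rewrite (bil_const uf1 ug2 (fun E' h => (Tg1 E' (dE' E' h)).2)).
  rewrite (bil_const uf2 ug1 (fun E' h => (Tg1 E' (dE' E' h)).1)).
  rewrite !transform_full// !mul0r subr0 add0r mulr1 => -[/eqP + /eqP].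
  by rewrite !mulf_eq0 (gt_eqF c10) /= => /eqP -> /eqP ->.
have [neg imz] := square_modulus_negative n2 hf erefl lm prim0.1 prim0.2 dL0 fL0.
have [h0 hh0] := square_modulus_rep lL n2 hf erefl lm.
have hh := hatP hh0; set h := hat Lam 2 _ in hh neg imz.
have [c2 c20 [lg2 Tg2]] := lat_pow_hat lL n2 (leq_subr 2 (\dim {:V})).
(* The product with the power of the invariant section takes the value c2
   times the integral of h at E = V. *)
exists (- (c2 * mint (gr_mean lL (leq_subr 2 _)) (re h))).
  by rewrite oppr_gt0 pmulr_rlt0.
apply: functional_extensionality_dep => E; apply/funext => A.
rewrite /Q /sopp /sscale lat_sectionE//.
rewrite (@smulE _ _ _ _ lL 2 (\dim {:V} - 2) _ _ (leq_subr 2 _) (leq_subr _ _) _ _ E A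
    n2 (leq_subr 2 _) erefl erefl hh.1 lg2).
rewrite subnKC//; case: eqP => dE; last by rewrite mulr0 oppr0.
set g := hat Lam (\dim {:V} - 2) _ in lg2 Tg2 *.
have dE' (E' : {vspace V}) : \dim E' = (\dim E + (\dim {:V} - 2) - \dim {:V})%N ->
    \dim E' = (\dim {:V} - 2)%N by rewrite dE => ->; lia.
have [ug1 ug2] := (uc_re lL (leq_subr (\dim {:V} - 2) _) lg2, uc_im lL (leq_subr (\dim {:V} - 2) _) lg2).
have [uh1 uh2] := (uc_re lL (leq_subr 2 _) hh.1, uc_im lL (leq_subr 2 _) hh.1).
rewrite (bil_const uh1 ug1 (fun E' h => (Tg2 E' (dE' E' h)).1)).
rewrite (bil_const uh2 ug2 (fun E' h => (Tg2 E' (dE' E' h)).2)).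
rewrite (bil_const uh1 ug2 (fun E' h => (Tg2 E' (dE' E' h)).2)).
rewrite (bil_const uh2 ug1 (fun E' h => (Tg2 E' (dE' E' h)).1)).
rewrite !transform_full// imz !mul0r mulr0 subr0 addr0 -mulNr.
by congr (_ * _); apply/eqP; rewrite eq_complex /= oppr0 !eqxx.
Qed.
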